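(* Let $\tau>0$ and let $(\phi_h^n,\mathbf u_h^n,p_h^n)\in Y_h\times\mathbf V_h\times M_h$ and $U^n\in C^0(\Omega)$ be given. Then the P-BDF1 scheme (defined in the context) admits a unique solution set $$(\phi_h^{n+1},w_h^{n+1},\mathbf u_h^{n+1},p_h^{n+1})\in Y_h\times Y_h\times\mathbf V_h\times M_h,\qquad U^{n+1}\in C^0(\Omega);$$ that is, there is exactly one such tuple $(\phi_h^{n+1},w_h^{n+1},\mathbf u_h^{n+1},p_h^{n+1},U^{n+1})$ that, together with some intermediate functions $\tilde{\mathbf u}_h^{n+1}\in\mathbf X_h$ and $\hat{\mathbf u}^{n+1}\in(L^2(\Omega))^d$, satisfies all equations of the scheme.
   Context: $\Omega\subset\mathbb R^d$ ($d=2,3$) is a bounded domain; $\gamma,\lambda,\mu>0$ are constants; $\tau>0$ is the time step; $(\cdot,\cdot)$ and $\|\cdot\|$ are the $L^2(\Omega)$ inner product and norm. $F:\mathbb R\to\mathbb R$ is a $C^1$ potential bounded from below (for example $F(\phi)=\frac{1}{4\epsilon^2}(\phi^2-1)^2$, $\epsilon>0$), $B$ is a constant with $F+B>0$, and $H(\nu)=F'(\nu)/\sqrt{F(\nu)+B}$. $C^0(\Omega)$ denotes functions continuous on $\bar\Omega$. $\mathcal T_h$ is a shape-regular, quasi-uniform partition of $\Omega$ into elements $K$, and $P_k(K)$ denotes polynomials of degree at most $k$ on $K$. The finite element spaces are $\mathbf X_h=\mathbf V_h=\{\mathbf v_h\in (C^0(\bar\Omega))^d\cap(H^1_0(\Omega))^d:\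 \mathbf v_h|_K\in(P_2(K))^d\ \forall K\}$, $M_h=\{q_h\in C^0(\bar\Omega)\cap L^2_0(\Omega):\ q_h|_K\in P_1(K)\ \forall K\}$ ($L^2_0$ = zero-average $L^2$ functions), $Y_h=\{\psi_h\in C^0(\bar\Omega):\ \psi_h|_K\in P_2(K)\ \forall K\}$. The pair $(\mathbf X_h,M_h)$ satisfies the inf-sup condition: there is $\beta_*>0$ with $\inf_{0\ne q\in M_h}\sup_{0\ne\mathbf v\in\mathbf X_h}\frac{-(\nabla\cdot\mathbf v,q)}{\|\mathbf v\|_{H^1}\|q\|_{L^2}}\ge\beta_*$. Forms: $a(w,\phi)=(\nabla w,\nabla\phi)$, $\tilde a(\mathbf u,\mathbf v)=(\nabla\mathbf u,\nabla\mathbf v)$, $b(\mathbf u,\mathbf v,\mathbf w)=((\mathbf u\cdot\nabla)\mathbf v,\mathbf w)+\frac12((\nabla\cdot\mathbf u)\mathbf v,\mathbf w)$. P-BDF1 scheme: given $(\phi_h^n,\mathbf u_h^n,p_h^n)\in Y_h\times\mathbf V_h\times M_h$ and $U^n\in C^0(\Omega)$, find $(\phi_h^{n+1},w_h^{n+1},\tilde{\mathbf u}_h^{n+1},\mathbf u_h^{n+1},p_h^{n+1})\in Y_h\times Y_h\times\mathbf X_h\times\mathbf V_h\times M_h$, $U^{n+1}\in C^0(\Omega)$ and $\hat{\mathbf u}^{n+1}\in(L^2(\Omega))^d$ such that, with $U_h^n\in Y_h$ the $L^2$ projection of $U^n$, i.e. $(U_h^n,\mu_h)=(U^n,\mu_h)$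 for all $\mu_h\in Y_h$: (i) $\left(\frac{\phi_h^{n+1}-\phi_h^n}{\tau},\varphi_h\right)-(\hat{\mathbf u}^{n+1}\phi_h^n,\nabla\varphi_h)+\gamma a(w_h^{n+1},\varphi_h)=0$ for all $\varphi_h\in Y_h$; (ii) $(w_h^{n+1},\psi_h)-\lambda a(\phi_h^{n+1},\psi_h)-\lambda(H(\phi_h^n)U^{n+1},\psi_h)=0$ for all $\psi_h\in Y_h$; (iii) $\hat{\mathbf u}^{n+1}=\mathbf u_h^n-\tau\phi_h^n\nabla w_h^{n+1}$; (iv) $U^{n+1}=U_h^n+\frac12H(\phi_h^n)(\phi_h^{n+1}-\phi_h^n)$; (v) $\left(\frac{\tilde{\mathbf u}_h^{n+1}-\mathbf u_h^n}{\tau},\mathbf v_h\right)+\mu\tilde a(\tilde{\mathbf u}_h^{n+1},\mathbf v_h)+b(\mathbf u_h^n,\tilde{\mathbf u}_h^{n+1},\mathbf v_h)-(p_h^n,\nabla\cdot\mathbf v_h)+(\phi_h^n\nabla w_h^{n+1},\mathbf v_h)=0$ for all $\mathbf v_h\in\mathbf X_h$; (vi) $\left(\frac{\mathbf u_h^{n+1}-\tilde{\mathbf u}_h^{n+1}}{\tau},\chi_h\right)-(p_h^{n+1}-p_h^n,\nabla\cdot\chi_h)=0$ for all $\chi_h\in\mathbf V_h$, and $(\nabla\cdot\mathbf u_h^{n+1},q_h)=0$ for all $q_h\in M_h$. *)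

(* Defs.v *)
From HB Require Import structures.
From mathcomp Require Import all_boot all_order all_algebra.
From mathcomp Require Import all_classical all_reals all_analysis.

Set Implicit Arguments.
Unset Strict Implicit.
Unset Printing Implicit Defensive.
Import Order.TTheory GRing.Theory Num.Theory.
Import numFieldNormedType.Exports.
Local Open Scope classical_set_scope.
Local Open Scope ring_scope.

(* Points of R^d are row vectors 'rV[R]_d. Their norm in the library is the
   maximum norm, which has the same open, bounded and compact sets as the
   Euclidean norm [enorm]; [enorm] is used for diameters and inscribed balls. *)

Section lebesgue.
Variable R : realType.

(* Lebesgue measure on R^n, as an iterated product measure on n-tuples, which
   carry the product sigma-algebra. *)
Fixpoint leb (n : nat) : set (n.-tuple R) -> \bar R :=
  match n with
  | 0%N => dirac ([tuple] : 0.-tuple R)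
  | n'.+1 => pushforward (product_measure1 (@lebesgue_measure R) (@leb n'))
               (fun p => [tuple of p.1 :: p.2] : n'.+1.-tuple R)
  end.

Definition pt n (t : n.-tuple R) : 'rV[R]_n := \row_i tnth t i.

Definition leb_eint n (A : set 'rV[R]_n) (f : 'rV[R]_n -> \bar R) : \bar R :=
  (\int[@leb n]_(t in @pt n @^-1` A) f (pt t))%E.

Definition leb_int n (A : set 'rV[R]_n) (f : 'rV[R]_n -> R) : R :=
  fine (leb_eint A (EFin \o f)).

Definition null_set n (A : set 'rV[R]_n) : Prop := leb (@pt n @^-1` A) = 0%E.

Definition ae_on n (A : set 'rV[R]_n) (P : 'rV[R]_n -> Prop) : Prop :=
  exists2 Z : set 'rV[R]_n, measurable (@pt n @^-1` Z) /\ null_set Z &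
    forall x, A x -> ~ Z x -> P x.

Definition L2 n (A : set 'rV[R]_n) (f : 'rV[R]_n -> R) : Prop :=
  measurable_fun (@pt n @^-1` A) (f \o @pt n) /\
  (leb_eint A (fun x => (f x ^+ 2)%:E) < +oo)%E.

Definition L2_cvg n (A : set 'rV[R]_n) (f_ : nat -> 'rV[R]_n -> R)
    (f : 'rV[R]_n -> R) : Prop :=
  (fun k => leb_eint A (fun x => ((f_ k x - f x) ^+ 2)%:E)) @ \oo --> 0%E.

End lebesgue.

Section fields.
Variables (R : realType) (d : nat).
Implicit Types (f g : 'rV[R]_d -> R) (u v w : 'rV[R]_d -> 'rV[R]_d).

Definition enorm (x : 'rV[R]_d) : R := Num.sqrt (\sum_i x 0 i ^+ 2).

Definition coor u (i : 'I_d) : 'rV[R]_d -> R := fun x => u x 0 i.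

Definition partial (i : 'I_d) f : 'rV[R]_d -> R :=
  fun x => 'D_(delta_mx 0 i) f x.

(* Pointwise derivatives. A function that is continuous and elementwise
   polynomial on a mesh has them on the interior of every element, hence almost
   everywhere, and there they are its weak derivatives. *)
Definition grad f : 'rV[R]_d -> 'rV[R]_d := fun x => \row_i partial i f x.

Definition dvg u : 'rV[R]_d -> R := fun x => \sum_i partial i (coor u i) x.

Definition conv u v : 'rV[R]_d -> 'rV[R]_d :=
  fun x => \row_i \sum_j u x 0 j * partial j (coor v i) x.

Definition smooth f : Prop :=
  forall s : seq 'I_d, continuous (foldr partial f s) /\
    forall (i : 'I_d) x, derivable (foldr partial f s) x (delta_mx 0 i).

Definition test_function (Omega : set 'rV[R]_d) f : Prop :=
  smooth f /\
  exists C : set 'rV[R]_d, [/\ compact C, C `<=` Omega &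
    forall x, ~ C x -> f x = 0].

(* Closure in H^1(Omega) of the test functions; the L^2 limits [g i] are the
   weak partial derivatives of [f]. *)
Definition H10 (Omega : set 'rV[R]_d) f : Prop :=
  L2 Omega f /\
  exists2 g : 'I_d -> 'rV[R]_d -> R, (forall i, L2 Omega (g i)) &
  exists zeta : nat -> 'rV[R]_d -> R,
    [/\ forall k, test_function Omega (zeta k),
        L2_cvg Omega zeta f &
        forall i, L2_cvg Omega (fun k => partial i (zeta k)) (g i)].

Definition L20 (Omega : set 'rV[R]_d) f : Prop :=
  L2 Omega f /\ leb_int Omega f = 0.

(* Continuity on the closure of Omega; values elsewhere are irrelevant. *)
Definition C0 (Omega : set 'rV[R]_d) f : Prop :=
  {within closure Omega, continuous f}.

Definition eq_C0 (T : Type) (Omega : set 'rV[R]_d) (f g : 'rV[R]_d -> T) : Prop :=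
  forall x, closure Omega x -> f x = g x.

Definition inner (Omega : set 'rV[R]_d) f g : R :=
  leb_int Omega (fun x => f x * g x).

Definition vinner (Omega : set 'rV[R]_d) u v : R :=
  leb_int Omega (fun x => \sum_i u x 0 i * v x 0 i).

Definition L2norm Omega f : R := Num.sqrt (inner Omega f f).

Definition form_a Omega f g : R := vinner Omega (grad f) (grad g).

Definition form_at Omega u v : R :=
  leb_int Omega (fun x => \sum_i \sum_j
    partial j (coor u i) x * partial j (coor v i) x).

Definition form_b Omega u v w : R :=
  vinner Omega (conv u v) w + 2^-1 * vinner Omega (fun x => dvg u x *: v x) w.

Definition vH1norm Omega v : R :=
  Num.sqrt (vinner Omega v v + form_at Omega v v).

Definition bounded_domain (Omega : set 'rV[R]_d) : Prop :=
  [/\ open Omega, connected Omega, Omega !=set0 & bounded_set Omega].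

(* Elements are not restricted to simplices: as usual for a finite element
   partition, they are compact with nonempty connected interior, they cover the
   closure of Omega and do not overlap; only nullity of their boundaries is
   assumed (in place of Lipschitz regularity). *)
Definition fe_partition (Omega : set 'rV[R]_d) N (K : 'I_N -> set 'rV[R]_d) : Prop :=
  [/\ forall j, [/\ compact (K j), interior (K j) !=set0,
        connected (interior (K j)) & null_set (K j `\` interior (K j))],
      closure Omega = \bigcup_j K j &
      forall j k, j != k -> interior (K j) `&` interior (K k) = set0].

Definition diam (A : set 'rV[R]_d) : R :=
  sup [set enorm (z.1 - z.2) | z in A `*` A].

(* Diameter of the largest ball inscribed in A. *)
Definition indiam (A : set 'rV[R]_d) : R :=
  sup [set 2 * r | r in [set r | 0 <= r /\
    exists x, [set y | enorm (y - x) <= r] `<=` A]].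

Definition shape_regular (sigma : R) N (K : 'I_N -> set 'rV[R]_d) : Prop :=
  forall j, diam (K j) <= sigma * indiam (K j).

Definition quasi_uniform (C : R) N (K : 'I_N -> set 'rV[R]_d) : Prop :=
  forall j k, diam (K j) <= C * diam (K k).

(* Polynomials of total degree at most k: [a] is a multi-index. *)
Definition P_ (k : nat) (A : set 'rV[R]_d) f : Prop :=
  exists c : {ffun 'I_d -> 'I_k.+1} -> R, forall x, A x ->
    f x = \sum_(a : {ffun 'I_d -> 'I_k.+1} | (\sum_i a i <= k)%N)
            c a * \prod_i x 0 i ^+ a i.

Variables (Omega : set 'rV[R]_d) (N : nat) (K : 'I_N -> set 'rV[R]_d).

Definition Yh f : Prop := C0 Omega f /\ forall j, P_ 2 (K j) f.

Definition Xh v : Prop :=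
  forall i, [/\ C0 Omega (coor v i), H10 Omega (coor v i) &
    forall j, P_ 2 (K j) (coor v i)].

Definition Vh := Xh.

Definition Mh f : Prop :=
  [/\ C0 Omega f, L20 Omega f & forall j, P_ 1 (K j) f].

Definition inf_sup : Prop :=
  exists2 beta : R, 0 < beta &
  (beta%:E <=
   ereal_inf [set ereal_sup
       [set (- inner Omega (dvg v) q / (vH1norm Omega v * L2norm Omega q))%:E
         | v in [set v | Xh v /\ ~ eq_C0 Omega v (fun=> 0%R)]]
     | q in [set q | Mh q /\ ~ eq_C0 Omega q (fun=> 0%R)]])%E.

End fields.

Section scheme.
Variables (R : realType) (d : nat).

Definition potential (F : R -> R) : Prop :=
  [/\ forall s, derivable F s 1, continuous (derive1 F) & exists m, forall s, m <= F s].

Definition Hfun (F : R -> R) (B : R) (s : R) : R := derive1 F s / Num.sqrt (F s + B).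

Variables (Omega : set 'rV[R]_d) (N : nat) (K : 'I_N -> set 'rV[R]_d).
Variables (gamma lambda mu tau : R) (F : R -> R) (B : R).
Variables (phi0 : 'rV[R]_d -> R) (u0 : 'rV[R]_d -> 'rV[R]_d)
  (p0 U0 : 'rV[R]_d -> R).


(* The suffix 0 marks the data at time level n; [ut] and [uh] are the
   intermediate velocities with a tilde and with a hat, and [U0h] is the L^2
   projection of [U0] on [Yh]. As [uh] is an element of (L^2)^d, its defining
   equation holds almost everywhere. *)
Definition scheme_with (U0h : 'rV[R]_d -> R) (phi w : 'rV[R]_d -> R)
    (ut uh u : 'rV[R]_d -> 'rV[R]_d) (p U : 'rV[R]_d -> R) : Prop :=
  [/\ [/\ Yh Omega K phi, Yh Omega K w, Xh Omega K ut, Vh Omega K u &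
          Mh Omega K p],
      [/\ C0 Omega U, forall i, L2 Omega (coor uh i), Yh Omega K U0h &
          forall m, Yh Omega K m -> inner Omega U0h m = inner Omega U0 m],
      [/\ forall q, Yh Omega K q ->
            inner Omega (fun x => (phi x - phi0 x) / tau) q
            - vinner Omega (fun x => phi0 x *: uh x) (grad q)
            + gamma * form_a Omega w q = 0,
          forall psi, Yh Omega K psi ->
            inner Omega w psi - lambda * form_a Omega phi psi
            - lambda * inner Omega (fun x => Hfun F B (phi0 x) * U x) psi = 0,
          ae_on Omega (fun x =>
            uh x = u0 x - tau *: (phi0 x *: grad w x)) &
          eq_C0 Omega U
            (fun x => U0h x + 2^-1 * Hfun F B (phi0 x) * (phi x - phi0 x))] &
      [/\ forall v, Xh Omega K v ->
            vinner Omega (fun x => tau^-1 *: (ut x - u0 x)) v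
            + mu * form_at Omega ut v + form_b Omega u0 ut v
            - inner Omega p0 (dvg v)
            + vinner Omega (fun x => phi0 x *: grad w x) v = 0,
          forall chi, Vh Omega K chi ->
            vinner Omega (fun x => tau^-1 *: (u x - ut x)) chi
            - inner Omega (fun x => p x - p0 x) (dvg chi) = 0 &
          forall q, Mh Omega K q -> inner Omega (dvg u) q = 0]].

Definition scheme_solution phi w u p U : Prop :=
  exists U0h ut uh, scheme_with U0h phi w ut uh u p U.

End scheme.

(* Main.v *)
(* Up to the explicit formulas for [û] and [U^{n+1}], the scheme is a chain of
   square linear systems on finite-dimensional spaces: the projection of [U^n],
   the pair [(phi, w)], the velocity [ũ], the pair [(u, p)].  Each is solvable
   as soon as it is injective modulo functions vanishing on Omega.  Eliminating
   [û] replaces [gamma] by the weight [gamma + tau phi0^2] in the equation for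
   [phi]; testing that system with [(tau w, - phi)] gives
   [weight |grad w|^2 = 0], and then [(phi, 0)] and [(0, w)] give [phi = w = 0].
   For [ũ] one tests with [ũ] and uses [b(u, v, v) = 0]; [u = 0] follows by
   testing with [(u, p)], and [p = 0] from the inf-sup condition.

   The analytic point is [b(u, v, v) = 0].  The integral of a partial derivative
   of a product of three test functions vanishes by the fundamental theorem of
   calculus on a box containing Omega, and one passes to the H^1_0 limit in one
   factor at a time.  The weak derivatives so obtained agree with the elementwise
   pointwise ones: integrate by parts against weights vanishing on the faces of
   a box inside an element, let the weights tend to 1, and exhaust the interior
   of the element by boxes. *)
Require Import Defs.
From HB Require Import structures.
From mathcomp Require Import all_boot all_order all_algebra.
From mathcomp Require Import all_classical all_reals all_analysis.
From mathcomp Require Import measurable_realfun ring lra.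

Set Implicit Arguments.
Unset Strict Implicit.
Unset Printing Implicit Defensive.
Import Order.TTheory GRing.Theory Num.Theory.
Import numFieldNormedType.Exports.
Local Open Scope classical_set_scope.
Local Open Scope ring_scope.

(** * Linear systems modulo a null space *)

Section finite_dimension.
Variables (R : fieldType) (E : lmodType R).
Implicit Types (S Nl : set E) (x y z : E).

(** Functions are total maps on R^d, constrained only on the closure of Omega, so [Yh], [Xh] and
    [Mh] are infinite-dimensional as sets of functions. This is why the linear algebra is done
    modulo a null space.

    The pair (tau w, - phi) makes the mass terms tau^-1 (phi, tau w) and (w, - phi) cancel, while
    the remaining terms, with weight |grad w|^2, lambda |grad phi|^2 and (lambda/2) H^2 phi^2, all
    have the same sign. Once the integral of weight |grad w|^2 is zero, Cauchy-Schwarz removes the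
    coupling term weight grad w . grad phi; only then does the test (phi, 0) return tau^-1 |phi|^2
    alone.

    The obstacle in b(u, v, v) = 0 is the generality of the elements: their boundaries are known
    only to be null, so no divergence theorem on an element can turn continuity across elements into
    a cancellation of face integrals. Weak derivatives from H^1_0 replace it, and integration by
    parts takes place on boxes only. Moreover nothing is known of the pointwise derivatives on
    element boundaries, not even measurability, so integrals are moved to the union of the element
    interiors. *)

Definition linear_subspace S : Prop := S 0 /\ forall a x y, S x -> S y -> S (a *: x + y).

Definition linear_on S (f : E -> R) : Prop :=
  forall a x y, S x -> S y -> f (a *: x + y) = a * f x + f y.

(* Coordinates are a relation, since they are not unique when [x] is only
   determined modulo [Nl]. *)
Definition finite_dim S Nl : Prop :=
  exists (I : finType) (coord : E -> (I -> R) -> Prop),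
  [/\ forall x, S x -> exists c, coord x c,
      coord 0 (fun=> 0),
      forall a x y c d, coord x c -> coord y d ->
        coord (a *: x + y) (fun i => a * c i + d i) &
      forall x, S x -> coord x (fun=> 0) -> Nl x].

Lemma linear_subspace_sum S m (a : 'I_m -> R) (e : 'I_m -> E) : linear_subspace S ->
  (forall k, S (e k)) -> S (\sum_k a k *: e k).
Proof.
move=> [S0 SD] Se; apply: (big_ind S) => //.
  by move=> x y Sx Sy; rewrite -[x]scale1r; exact: SD.
by move=> k _; rewrite -[_ *: _]addr0; exact: SD.
Qed.

Lemma linear_on0 S f : linear_subspace S -> linear_on S f -> f 0 = 0.
Proof.
move=> [S0 _] /(_ 1 0 0 S0 S0); rewrite scaler0 addr0 mul1r => h.
by apply: (addIr (f 0)); rewrite add0r -h.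
Qed.

Lemma linear_on_sum S f m (a : 'I_m -> R) (e : 'I_m -> E) : linear_subspace S ->
  linear_on S f -> (forall k, S (e k)) ->
  f (\sum_k a k *: e k) = \sum_k a k * f (e k).
Proof.
move=> Ssub fl Se; elim: m a e Se => [|m IH] a e Se.
  by rewrite !big_ord0 (linear_on0 Ssub fl).
by rewrite !big_ord_recl fl ?IH//; exact: linear_subspace_sum.
Qed.

Definition independent Nl m (e : 'I_m -> E) : Prop :=
  forall a : 'I_m -> R, Nl (\sum_k a k *: e k) -> forall k, a k = 0.

Lemma row_kernel m p (M : 'M[R]_(m, p)) : ~~ row_free M ->
  exists2 r : 'rV_m, r != 0 & r *m M = 0.
Proof.
by rewrite -kermx_eq0 => /rowV0Pn[r /sub_kermxP rM r0]; exists r.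
Qed.

(** With more than [#|I|] vectors the coordinate matrix [M] has a nonzero left kernel vector. The
    corresponding combination admits zero coordinates, hence lies in [Nl], against independence. One
    arbitrary coordinate vector per [e k] suffices, because [coord] is stable under linear
    combinations. *)
Lemma finite_dim_independent S Nl : linear_subspace S -> finite_dim S Nl ->
  exists p, forall m (e : 'I_m -> E), (forall k, S (e k)) -> independent Nl e -> (m <= p)%N.
Proof.
move=> Ssub [I [coord [Sc c0 cD cN]]]; exists #|I| => m e Se ie.
have /choice[c ce] : forall k, exists c, coord (e k) c by move=> k; exact/Sc/Se.
pose M := \matrix_(k < m, i < #|I|) c k (enum_val i).
rewrite leqNgt; apply/negP => Im.
have [r r0 rM] : exists2 r : 'rV_m, r != 0 & r *m M = 0.
  by apply: row_kernel; rewrite /row_free neq_ltn (leq_ltn_trans (rank_leq_col M)).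
case/negP: r0; apply/eqP/rowP => k; rewrite mxE; apply: ie k => /=.
have csum p (a : 'I_p -> R) (e' : 'I_p -> E) (c' : 'I_p -> I -> R) :
    (forall k, coord (e' k) (c' k)) ->
    coord (\sum_k a k *: e' k) (fun i => \sum_k a k * c' k i).
  elim: p a e' c' => [|p IH] a e' c' ce'.
    by rewrite big_ord0 (_ : (fun i => _) = fun=> 0)//; apply/funext => i; rewrite big_ord0.
  rewrite big_ord_recl (_ : (fun i => _) = fun i => a ord0 * c' ord0 i +
      \sum_k a (lift ord0 k) * c' (lift ord0 k) i).
    by apply: cD => //; exact: IH.
  by apply/funext => i; rewrite big_ord_recl.
apply: cN; first exact: linear_subspace_sum.
have := csum m (r 0) e c ce; congr (coord _ _); apply/funext => i.
transitivity ((r *m M) 0 (enum_rank i)); last by rewrite rM mxE.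
by rewrite mxE; apply: eq_bigr => k _; rewrite mxE enum_rankK.
Qed.

(** An independent family of maximal size spans modulo [Nl]: adjoining [x] destroys independence,
    and the resulting relation can be solved for [x]. *)
Lemma finite_dim_basis S Nl : linear_subspace S -> linear_subspace Nl -> finite_dim S Nl ->
  exists m (e : 'I_m -> E), [/\ forall k, S (e k), independent Nl e &
    forall x, S x -> exists a : 'I_m -> R, Nl (x - \sum_k a k *: e k)].
Proof.
move=> Ssub Nsub fS; have [p Hp] := finite_dim_independent Ssub fS.
pose P m := `[< exists e : 'I_m -> E, (forall k, S (e k)) /\ independent Nl e >].
have P0 : exists m, P m.
  by exists 0%N; apply/asboolP; exists (fun=> 0); split => [[]|a _ []].
have Pp m : P m -> (m <= p)%N by move=> /asboolP[e [Se ie]]; exact: Hp ie.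
have [m /asboolP[e [Se ie]] mmax] := ex_maxnP P0 Pp.
exists m, e; split => // x Sx.
pose e' (k : 'I_m.+1) := if unlift ord0 k is Some j then e j else x.
have Se' k : S (e' k) by rewrite /e'; case: unliftP.
have : ~ independent Nl e'.
  move=> ie'; suff /mmax : P m.+1 by rewrite ltnn.
  by apply/asboolP; exists e'.
move=> /existsNP[a /not_implyP[Na]] /existsNP[k ak].
have sumE : \sum_k a k *: e' k = a ord0 *: x + \sum_j a (lift ord0 j) *: e j.
  rewrite big_ord_recl /e' unlift_none; congr (_ + _).
  by apply: eq_bigr => j _; rewrite liftK.
(* Otherwise the relation involves the family [e] only, and its independence makes every coefficient
   zero. *)
have a0 : a ord0 != 0.
  apply/eqP => a0; have := ie (a \o lift ord0).
  rewrite sumE a0 scale0r add0r in Na => /(_ Na) h.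
  by have [j kj|k0] := unliftP ord0 k; apply: ak; rewrite ?kj ?k0//; exact: h.
exists (fun j => - (a ord0)^-1 * a (lift ord0 j)).
have -> : x - \sum_j (- (a ord0)^-1 * a (lift ord0 j)) *: e j =
    (a ord0)^-1 *: (\sum_k a k *: e' k) + 0.
  rewrite sumE addr0 scalerDr scalerA mulVf// scale1r scaler_sumr -sumrN.
  by congr (_ + _); apply: eq_bigr => j _; rewrite -scaleNr scalerA mulNr opprK.
by case: Nsub => N0 ND; exact: ND.
Qed.

(** On a basis modulo [Nl] the system becomes a square matrix, and injectivity modulo [Nl] makes its
    rows free, so that it is invertible. The two conditions on tests from [Nl] say that such tests
    carry no information; they reduce the equations to finitely many. *)
Lemma finite_dim_solve S Nl (A : E -> E -> R) (L : E -> R) :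
  linear_subspace S -> linear_subspace Nl -> finite_dim S Nl ->
  (forall x, S x -> linear_on S (A x)) ->
  (forall y, S y -> linear_on S (A^~ y)) ->
  linear_on S L ->
  (forall x y, S x -> S y -> Nl y -> A x y = 0) ->
  (forall y, S y -> Nl y -> L y = 0) ->
  (forall x, S x -> (forall y, S y -> A x y = 0) -> Nl x) ->
  exists2 x, S x & forall y, S y -> A x y = L y.
Proof.
move=> Ssub Nsub fS Ar Al Ll AN LN Ainj.
have [m [e [Se ie spane]]] := finite_dim_basis Ssub Nsub fS.
(* A functional that vanishes on [Nl] and on the basis vanishes on [S]. This serves both for the
   freeness of [M] and for the final verification. *)
have ext (f : E -> R) : linear_on S f -> (forall y, S y -> Nl y -> f y = 0) ->
    (forall k, f (e k) = 0) -> forall y, S y -> f y = 0.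
  move=> fl fN fe y Sy; have [a Na] := spane y Sy.
  pose s := \sum_k a k *: e k.
  have Ss : S s by exact: linear_subspace_sum.
  have Sys : S (y - s) by rewrite addrC -scaleN1r; case: Ssub => _; apply.
  have -> : y = 1 *: s + (y - s) by rewrite scale1r addrC subrK.
  rewrite fl// (fN _ Sys Na) /s (linear_on_sum _ Ssub fl Se) big1 ?mulr0 ?addr0// => k _.
  by rewrite fe mulr0.
pose M := \matrix_(k < m, l < m) A (e k) (e l).
have MA (r : 'rV_m) l : (r *m M) 0 l = A (\sum_k r 0 k *: e k) (e l).
  rewrite (linear_on_sum (f := A^~ (e l)) _ Ssub (Al _ (Se l)) Se) mxE.
  by apply: eq_bigr => k _; rewrite mxE.
have Mfree : row_free M.
  apply/negPn/negP => /row_kernel[r r0 rM]; case/negP: r0; apply/eqP/rowP => k.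
  rewrite mxE; apply: ie k; apply: Ainj; first exact: linear_subspace_sum.
  have Sr : S (\sum_k r 0 k *: e k) by exact: linear_subspace_sum.
  apply: ext; [exact: Ar|by move=> y Sy Ny; exact: AN|].
  by move=> l; rewrite -MA rM mxE.
pose r := (\row_l L (e l)) *m invmx M.
have rM : r *m M = \row_l L (e l) by rewrite mulmxKV// -row_free_unit.
have Sr : S (\sum_k r 0 k *: e k) by exact: linear_subspace_sum.
exists (\sum_k r 0 k *: e k) => // y Sy; apply/eqP; rewrite -subr_eq0; apply/eqP.
apply: (ext (fun y => A (\sum_k r 0 k *: e k) y - L y)) => //.
- by move=> a u v Su Sv; rewrite Ar// Ll//; ring.
- by move=> z Sz Nz; rewrite AN// LN// subrr.
- by move=> l; rewrite -MA rM mxE subrr.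
Qed.

End finite_dimension.

(** * Lebesgue measure on tuples *)

Section leb_measure.
Variable R : realType.

Local Notation RR := (measurableTypeR R).

Definition tcons n (p : RR * n.-tuple R) : n.+1.-tuple R := [tuple of p.1 :: p.2].
Definition tuncons n (t : n.+1.-tuple R) : RR * n.-tuple R :=
  (thead t, [tuple of behead t]).

Lemma measurable_tcons n : measurable_fun setT (@tcons n).
Proof. by apply: measurable_cons; [exact: measurable_fst|exact: measurable_snd]. Qed.

Lemma measurable_tuncons n : measurable_fun setT (@tuncons n).
Proof.
apply/measurable_fun_pairP; split => /=; last exact: measurable_behead.
exact: measurable_tnth.
Qed.

Lemma tconsK n : cancel (@tcons n) (@tuncons n).
Proof. by case=> x t; congr pair; apply/val_inj. Qed.

Section pushforward.
Variables (n : nat) (m : {measure set (RR * n.-tuple R)%type -> \bar R}).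
Hypothesis sfm : sigma_finite setT m.
Let m' := pushforward m (@tcons n).

Let m'0 : m' set0 = 0%E.
Proof. by rewrite /m' /pushforward preimage_set0 measure0. Qed.

Let m'_ge0 A : (0 <= m' A)%E.
Proof. exact: (measure_ge0 m). Qed.

Let m'_sigma_additive : semi_sigma_additive m'.
Proof.
rewrite /m'; exact: (@measure_semi_sigma_additive _ _ _
  (measure_function_pushforward__canonical__measure_function_Measure m (@measurable_tcons n))).
Qed.

HB.instance Definition _ := isMeasure.Build _ _ _ m' m'0 m'_ge0 m'_sigma_additive.

Let m'_sigma_finite : sigma_finite setT m'.
Proof.
have [F FT Foo] := sfm.
exists (fun k => @tuncons n @^-1` F k).
  by apply/seteqP; split => // t _; have : setT (tuncons t) by []; rewrite FT.
move=> k; have [mF Foo'] := Foo k; split.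
  by rewrite -[X in measurable X]setTI; exact: measurable_tuncons.
rewrite /m' /pushforward (_ : _ @^-1` _ = F k)//.
by apply/funext => p; rewrite /preimage/= tconsK.
Qed.

HB.instance Definition _ := Measure_isSigmaFinite.Build _ _ _ m' m'_sigma_finite.

Lemma sigma_finite_pushforward_tcons :
  exists m'' : {sigma_finite_measure set n.+1.-tuple R -> \bar R},
    forall A, m'' A = pushforward m (@tcons n) A.
Proof. by exists m'. Qed.

End pushforward.

(** [leb] is a bare set function defined by recursion, whereas the product measure in the next
    dimension calls for a sigma-finite measure in the previous one. Both properties are therefore
    carried through one induction, as a structured [m] that agrees with [leb]; the canonical
    instances are read off afterwards. *)
Lemma leb_sigma_finite n :
  exists m : {sigma_finite_measure set n.-tuple R -> \bar R},
    forall A, m A = leb A.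
Proof.
elim: n => [|n [m mE]].
  by exists (dirac ([tuple] : 0.-tuple R)).
have sf : sigma_finite setT (@lebesgue_measure R \x m)%E.
  have /sigma_finiteP[F [TF ndF Foo]] := sigma_finiteT (@lebesgue_measure R).
  have /sigma_finiteP[G [TG ndG Goo]] := sigma_finiteT m.
  (* Both exhaustions are nondecreasing, so a single index can serve the two coordinates. *)
  exists (fun n => F n `*` G n).
    rewrite -setXTT TF TG predeqE => -[x y]; split.
      move=> [/= [i _ Fix] [k _ Gky]]; exists (maxn i k) => //; split.
      - by move: x Fix; exact/subsetPset/ndF/leq_maxl.
      - by move: y Gky; exact/subsetPset/ndG/leq_maxr.
    by move=> [i _ []/= ? ?]; split; exists i.
  move=> k; have [? ?] := Foo k; have [? ?] := Goo k.
  split; first exact: measurableX.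
  by rewrite product_measure1E// lte_mul_pinfty// ge0_fin_numE.
have [m' m'E] := sigma_finite_pushforward_tcons sf.
exists m' => A; rewrite m'E /=.
by have -> : @leb R n = m by apply/funext => B; rewrite mE.
Qed.

Lemma leb0 n : @leb R n set0 = 0%E.
Proof. by have [m mE] := leb_sigma_finite n; rewrite -mE measure0. Qed.

Lemma leb_ge0 n A : (0 <= @leb R n A)%E.
Proof. by have [m mE] := leb_sigma_finite n; rewrite -mE. Qed.

Lemma leb_sigma_additive n : semi_sigma_additive (@leb R n).
Proof.
have [m mE] := leb_sigma_finite n.
have <- : m = @leb R n :> (set _ -> \bar R) by apply/funext => B; rewrite mE.
exact: measure_semi_sigma_additive.
Qed.

HB.instance Definition _ n := isMeasure.Build _ _ _ (@leb R n)
  (leb0 n) (@leb_ge0 n) (@leb_sigma_additive n).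

Lemma leb_sigma_finiteT n : sigma_finite setT (@leb R n).
Proof.
have [m mE] := leb_sigma_finite n.
have <- : m = @leb R n :> (set _ -> \bar R) by apply/funext => B; rewrite mE.
exact: sigma_finiteT.
Qed.

HB.instance Definition _ n := Measure_isSigmaFinite.Build _ _ _ (@leb R n)
  (@leb_sigma_finiteT n).

End leb_measure.

(** * Iterated integrals and the measure of boxes *)

Section leb_fubini.
Variable R : realType.
Local Notation RR := (measurableTypeR R).
Local Notation mu := (@lebesgue_measure R).

Lemma leb_tcons n : @leb R n.+1 = pushforward (mu \x @leb R n)%E (@tcons R n).
Proof. by []. Qed.

Lemma integrable_tcons n (f : n.+1.-tuple R -> \bar R) :
  (@leb R n.+1).-integrable setT f ->
  (mu \x @leb R n)%E.-integrable setT (f \o @tcons R n).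
Proof.
move=> /integrableP[mf foo]; apply/integrableP; split.
  exact: (measurableT_comp mf (@measurable_tcons R n)).
apply: le_lt_trans foo; rewrite leb_tcons.
rewrite (ge0_integral_pushforward (@measurable_tcons R n))//=.
exact: measurableT_comp.
Qed.

Lemma integral_tcons n (f : n.+1.-tuple R -> \bar R) :
  (@leb R n.+1).-integrable setT f ->
  (\int[@leb R n.+1]_t f t = \int[(mu \x @leb R n)%E]_p f (tcons p))%E.
Proof.
move=> fi; rewrite leb_tcons (integral_pushforward (@measurable_tcons R n))//.
- by case/integrableP : fi.
- exact: integrable_tcons.
Qed.

Lemma integral_tcons12 n (f : n.+1.-tuple R -> \bar R) :
  (@leb R n.+1).-integrable setT f ->
  (\int[@leb R n.+1]_t f t = \int[mu]_x \int[@leb R n]_t f (tcons (x, t)))%E.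
Proof.
move=> fi; rewrite integral_tcons//.
by rewrite -[LHS](integral12_prod_meas1 (integrable_tcons fi)).
Qed.

Lemma integral_tcons21 n (f : n.+1.-tuple R -> \bar R) :
  (@leb R n.+1).-integrable setT f ->
  (\int[@leb R n.+1]_t f t = \int[@leb R n]_t \int[mu]_x f (tcons (x, t)))%E.
Proof.
move=> fi; rewrite integral_tcons//.
by rewrite -[LHS](integral21_prod_meas1 (integrable_tcons fi)).
Qed.

Definition tbox n (a b : 'I_n -> R) : set (n.-tuple R) :=
  [set t | forall i, a i < tnth t i < b i].

Lemma measurable_tbox n (a b : 'I_n -> R) : measurable (tbox a b).
Proof.
rewrite (_ : tbox a b = \bigcap_(i in setT) ((@tnth n R)^~ i @^-1` `]a i, b i[)).
  apply: fin_bigcap_measurable; first exact: finite_finset.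
  by move=> i _; rewrite -[X in measurable X]setTI; exact: measurable_tnth.
apply/seteqP; split => t /= h i; first by move=> _; rewrite /preimage /= in_itv; exact: h.
by have := h i I; rewrite /preimage /= in_itv.
Qed.

Lemma tcons_tbox n (a b : 'I_n.+1 -> R) :
  @tcons R n @^-1` tbox a b =
    `]a ord0, b ord0[ `*` tbox (a \o lift ord0) (b \o lift ord0).
Proof.
apply/seteqP; split => -[x t]/= h.
  split; first by have := h ord0; rewrite in_itv.
  by move=> i; have := h (lift ord0 i); rewrite tnthS.
case: h => h0 h i; have [j ->|->] := unliftP ord0 i; first by rewrite tnthS; exact: h.
by move: h0; rewrite in_itv.
Qed.

Lemma leb_tbox n (a b : 'I_n.+1 -> R) :
  leb (tbox a b) = (mu `]a ord0, b ord0[ * leb (tbox (a \o lift ord0) (b \o lift ord0)))%E.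
Proof.
by rewrite leb_tcons /pushforward tcons_tbox product_measure1E//; exact: measurable_tbox.
Qed.

Lemma leb_tbox_lty n (a b : 'I_n -> R) : (leb (tbox a b) < +oo)%E.
Proof.
elim: n a b => [a b|n IH a b].
  by rewrite /= diracE ltry.
rewrite leb_tbox lte_mul_pinfty//.
  by rewrite lebesgue_measure_itv; case: ifP.
Qed.

Lemma leb_tbox_gt0 n (a b : 'I_n -> R) : (forall i, a i < b i) -> (0 < leb (tbox a b))%E.
Proof.
elim: n a b => [a b _|n IH a b ab].
  by rewrite /= diracE mem_set ?lte01// => -[].
rewrite leb_tbox mule_gt0//; last by apply: IH => i; exact: ab.
by rewrite lebesgue_measure_itv/= lte_fin ab -EFinD lte_fin subr_gt0 ab.
Qed.

End leb_fubini.

(** * Null sets and integrals of arbitrary functions *)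

Section null_sets.
Context d (T : measurableType d) (R : realType) (mu : {measure set T -> \bar R}).
Import HBNNSimple.
Local Open Scope ereal_scope.

(* The supremum is the one by which the library defines the integral of a
   nonnegative function, measurable or not. *)
Lemma nnsfun_sup_null (Z : set T) (g : T -> \bar R) :
  measurable Z -> mu Z = 0 -> (forall x, 0 <= g x) ->
  ereal_sup [set sintegral mu h | h in [set h : {nnsfun T >-> R} | forall x, (h x)%:E <= g x]] =
  ereal_sup [set sintegral mu h | h in [set h : {nnsfun T >-> R} |
     forall x, (h x)%:E <= (g \_ (~` Z)) x]].
Proof.
move=> mZ Z0 g0; have mCZ := measurableC mZ.
apply/eqP; rewrite eq_le; apply/andP; split; last first.
  apply: le_ereal_sup => _ [h hg <-]; exists h => // x.
  by apply: le_trans (hg x) _; rewrite patchE; case: ifP.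
apply: ge_ereal_sup => _ [h hg <-]; apply: ereal_sup_ubound.
exists (proj_nnsfun h mCZ).
  move=> x; have := hg x; rewrite patchE /= /mindic /= indicE.
  by case: ifP => _ hx; rewrite ?mulr1 ?mulr0.
transitivity (\int[mu]_(x in ~` Z) (h x)%:E).
  by rewrite (integral_nnsfun mu mCZ) mrestrict.
rewrite -integralT_nnsfun -setTD; apply/esym.
apply: ge0_negligible_integral => //; last by move=> x _; rewrite lee_fin fun_ge0.
exact/measurable_EFinP.
Qed.

(* No measurability of [f]: the pointwise partial derivatives are uncontrolled
   on the element boundaries. *)
Lemma integral_setD_null (A Z : set T) (f : T -> \bar R) :
  measurable Z -> mu Z = 0 ->
  \int[mu]_(x in A) f x = \int[mu]_(x in A `\` Z) f x.
Proof.
move=> mZ Z0; have E x : (f \_ (A `\` Z)) x = if x \in ~` Z then (f \_ A) x else 0.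
  by rewrite !patchE setDE in_setI andbC; case: (x \in ~` Z).
rewrite /integral; congr (_ - _).
  rewrite (nnsfun_sup_null mZ Z0)//; congr (ereal_sup [set _ | _ in [set _ | _]]).
  apply/funext => h; apply: eq_forall => x; congr (_ <= _).
  by rewrite [in RHS]funeposE [in RHS]E patchE funeposE; case: ifP => //; rewrite maxxx.
rewrite (nnsfun_sup_null mZ Z0)//; congr (ereal_sup [set _ | _ in [set _ | _]]).
apply/funext => h; apply: eq_forall => x; congr (_ <= _).
by rewrite [in RHS]funenegE [in RHS]E patchE funenegE; case: ifP => //; rewrite oppe0 maxxx.
Qed.

End null_sets.

(** * Measurability of open sets and continuous functions *)

Section open_sets.
Variables (R : realType) (n : nat).
Implicit Types (G A : set 'rV[R]_n).

Definition obox (a b : 'I_n -> R) : set 'rV[R]_n :=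
  [set x | forall i, a i < x 0 i < b i].

Lemma pt_obox a b : @pt R n @^-1` obox a b = tbox a b.
Proof. by apply/seteqP; split => t /= h i; have := h i; rewrite mxE. Qed.

Lemma obox_setI a b a' b' : obox a b `&` obox a' b' =
  obox (fun i => Num.max (a i) (a' i)) (fun i => Num.min (b i) (b' i)).
Proof.
apply/seteqP; split => x.
  by move=> [h h'] i; have := h i; have := h' i; rewrite gt_max lt_min; do 4!case: (_ < _).
by move=> h; split => i; have := h i; rewrite gt_max lt_min; do 4!case: (_ < _).
Qed.

Lemma open_rV_ball G x : open G -> G x ->
  exists2 e : R, 0 < e & forall y : 'rV[R]_n, (forall i, `|x 0 i - y 0 i| < e) -> G y.
Proof.
move=> oG Gx; have /nbhs_ballP[e e0 eG] : nbhs x G by exact: open_nbhs_nbhs.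
exists e => // y xy; apply: eG; split => // i j.
by rewrite (ord1 i); exact: xy.
Qed.

Lemma nbhs_obox (a b : 'I_n -> R) x : obox a b x -> nbhs x (obox a b).
Proof.
move=> abx.
pose e := \big[Num.min/1]_i Num.min (x 0 i - a i) (b i - x 0 i).
have e0 : 0 < e.
  by apply: lt_bigmin => // i _; rewrite lt_min !subr_gt0; have /andP[-> ->] := abx i.
apply/nbhs_ballP; exists e => // y [_ xy] i.
have : `|x 0 i - y 0 i| < Num.min (x 0 i - a i) (b i - x 0 i).
  by apply: lt_le_trans (xy 0 i) _; exact: bigmin_le.
rewrite lt_min => /andP[]; rewrite !ltr_norml => /andP[? ?] /andP[? ?].
by apply/andP; split; lra.
Qed.

Lemma open_obox a b : open (obox a b).
Proof. by rewrite openE => x /nbhs_obox. Qed.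

(** Boxes with rational corners are countably many and suffice. A code that decodes to nothing, or
    whose box is not contained in [G], contributes the empty set. *)
Lemma open_cover_obox G : open G -> exists Q : nat -> set 'rV[R]_n,
  (forall m, Q m = set0 \/ exists a b, Q m = obox a b) /\ G = \bigcup_m Q m.
Proof.
move=> oG.
pose q2 := ({ffun 'I_n -> rat} * {ffun 'I_n -> rat})%type.
pose rb (p : q2) := obox (ratr \o p.1) (ratr \o p.2).
pose Q m := if unpickle m is Some p then
  if `[< rb p `<=` G >] then rb p else set0 else set0.
exists Q; split.
  move=> m; rewrite /Q; case: (unpickle m) => [p|]; last by left.
  by case: ifP => _; [right; exists (ratr \o p.1), (ratr \o p.2)|left].
apply/seteqP; split => [x Gx|x [m _]]; last first.
  rewrite /Q; case: (unpickle m) => [p|//].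
  by case: asboolP => // h; exact: h.
have [e e0 eG] := open_rV_ball oG Gx.
have /choice[a ha] : forall i, exists q : rat, x 0 i - e / 2 < ratr q < x 0 i.
  move=> i; have : x 0 i - e / 2 < x 0 i by rewrite ltrBlDr ltrDl divr_gt0.
  by move=> /rat_in_itvoo[q]; rewrite in_itv/= => ?; exists q.
have /choice[b hb] : forall i, exists q : rat, x 0 i < ratr q < x 0 i + e / 2.
  move=> i; have : x 0 i < x 0 i + e / 2 by rewrite ltrDl divr_gt0.
  by move=> /rat_in_itvoo[q]; rewrite in_itv/= => ?; exists q.
pose p : q2 := ([ffun i => a i], [ffun i => b i]).
exists (pickle p) => //; rewrite /Q pickleK.
have -> : `[< rb p `<=` G >].
  apply/asboolP => y py; apply: eG => i.
  have := py i; rewrite /= !ffunE => /andP[].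
  have /andP[] := ha i; have /andP[] := hb i => *.
  by rewrite ltr_norml; apply/andP; split; lra.
move=> i; rewrite /= !ffunE.
by have /andP[_ ->] := ha i; have /andP[->] := hb i.
Qed.

(** Tuples carry the product sigma-algebra, in which boxes are measurable; an open set enters it as
    a countable union of boxes. *)
Lemma measurable_pt_open G : open G -> measurable (@pt R n @^-1` G).
Proof.
move=> /open_cover_obox[Q [Qbox ->]]; rewrite preimage_bigcup.
apply: bigcupT_measurable => m; have [->|[a [b ->]]] := Qbox m.
  by rewrite preimage_set0.
by rewrite pt_obox; exact: measurable_tbox.
Qed.

Lemma measurable_pt_closed A : closed A -> measurable (@pt R n @^-1` A).
Proof.
move=> cA; have : measurable (@pt R n @^-1` ~` A).
  by apply: measurable_pt_open; rewrite openC.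
by rewrite preimage_setC => /measurableC; rewrite setCK.
Qed.

Lemma measurable_pt_compact A : compact A -> measurable (@pt R n @^-1` A).
Proof.
have hs : hausdorff_space 'rV[R]_n := @norm_hausdorff _ _.
by move=> cA; apply: measurable_pt_closed; exact: (compact_closed hs cA).
Qed.

Lemma measurable_fun_continuous_on G (f : 'rV[R]_n -> R) : open G ->
  (forall x, G x -> {for x, continuous f}) ->
  measurable_fun (@pt R n @^-1` G) (f \o @pt R n).
Proof.
move=> oG fG mD; apply: (measurability _ (RGenOInfty.measurableE R)) => //.
move=> _ [_ [r ->] <-].
rewrite (_ : _ `&` _ = @pt R n @^-1` (G `&` f @^-1` `]r, +oo[%classic))//.
apply: measurable_pt_open; rewrite openE => x [Gx fx].
apply: filterI; first exact: open_nbhs_nbhs.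
by apply: (fG x Gx); apply: open_nbhs_nbhs; split => //; exact: interval_open.
Qed.

Lemma measurable_fun_C0 (Omega : set 'rV[R]_n) (f : 'rV[R]_n -> R) : open Omega ->
  C0 Omega f -> measurable_fun (@pt R n @^-1` Omega) (f \o @pt R n).
Proof.
move=> oO fO; apply: measurable_fun_continuous_on => // x Ox.
have /continuous_subspaceW/(_ fO) : Omega `<=` closure Omega by exact: subset_closure.
by rewrite continuous_open_subspace// => /(_ x); apply; rewrite inE.
Qed.

Lemma C0_bounded (Omega : set 'rV[R]_n) (f : 'rV[R]_n -> R) : bounded_set Omega ->
  C0 Omega f -> exists M, forall x, closure Omega x -> `|f x| <= M.
Proof.
move=> bO fO; have cO : compact (closure Omega).
  apply: bounded_closed_compact; last exact: closed_closure.
  case: bO => M [Mreal HM]; exists M; split => // M' MM' x.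
  have cl : closed [set y : 'rV[R]_n | `|y| <= M'].
    rewrite (_ : [set _ | _] = (fun y : 'rV[R]_n => `|y|) @^-1` [set z | z <= M'])//.
    by apply: closed_comp; [move=> y _; exact: norm_continuous|exact: closed_le].
  suff : closure Omega `<=` [set y : 'rV[R]_n | `|y| <= M'] by exact.
  by rewrite ((closure_id _).1 cl); apply: closure_subset => y; exact: HM.
have := compact_bounded (continuous_compact fO cO).
by move=> [M [_ HM]]; exists (M + 1) => x Ox; apply: (HM (M + 1)); rewrite ?ltrDl//; exists x.
Qed.

End open_sets.

(** * Slices along the first coordinate *)

Section slices.
Variables (R : realType) (n : nat).
Implicit Types (F : 'rV[R]_n.+1 -> R).

Definition tpt (y : 'rV[R]_n) : n.-tuple R := [tuple y 0 i | i < n].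

Lemma ptK : cancel (@pt R n) tpt.
Proof. by move=> t; apply: eq_from_tnth => i; rewrite tnth_mktuple mxE. Qed.

Lemma pt_tcons0 x t : pt (@tcons R n (x, t)) 0 ord0 = x.
Proof. by rewrite mxE. Qed.

Lemma pt_tcons_lift x t j : pt (@tcons R n (x, t)) 0 (lift ord0 j) = tnth t j.
Proof. by rewrite mxE tnthS. Qed.

(** Moving the head of a tuple translates the point along the first axis, so the difference
    quotients of a slice are literally directional ones of the whole function. The left side has the
    shape that the definition of the derivative at [x] in direction 1 produces. *)
Lemma pt_tcons_head (h x : R) t :
  pt (@tcons R n (h *: (1 : R) + x, t)) = h *: delta_mx 0 ord0 + pt (tcons (x, t)).
Proof.
apply/rowP => i; have [j ->|->] := unliftP ord0 i.
  by rewrite pt_tcons_lift [RHS]mxE pt_tcons_lift !mxE /= mulr0 add0r.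
by rewrite pt_tcons0 [RHS]mxE pt_tcons0 !mxE !eqxx /= mulr1 [_ *: _]mulr1.
Qed.

Lemma pt_tcons_tail (h x : R) y j :
  pt (@tcons R n (x, tpt (h *: delta_mx 0 j + y))) =
  h *: delta_mx 0 (lift ord0 j) + pt (tcons (x, tpt y)).
Proof.
apply/rowP => i; have [k ->|->] := unliftP ord0 i.
  rewrite pt_tcons_lift tnth_mktuple [RHS]mxE pt_tcons_lift tnth_mktuple !mxE.
  by rewrite (inj_eq lift_inj).
by rewrite pt_tcons0 [RHS]mxE pt_tcons0 !mxE /= mulr0 add0r.
Qed.

Lemma derivable_head F t x : derivable F (pt (tcons (x, t))) (delta_mx 0 ord0) ->
  derivable (fun s => F (pt (@tcons R n (s, t)))) x 1.
Proof.
move=> dF; rewrite /derivable (_ : (fun h : R => _) = (fun h : R => h^-1 *: ((F \o shift (pt (tcons (x, t))))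
  (h *: delta_mx 0 ord0) - F (pt (tcons (x, t))))))//.
by apply/funext => h; congr (_ *: (F _ - _)); exact: pt_tcons_head.
Qed.

Lemma derive_head F t x :
  'D_1 (fun s => F (pt (@tcons R n (s, t)))) x = partial ord0 F (pt (tcons (x, t))).
Proof.
rewrite /partial /derive (_ : (fun h : R => _) = (fun h : R => h^-1 *: ((F \o shift (pt (tcons (x, t))))
  (h *: delta_mx 0 ord0) - F (pt (tcons (x, t))))))//.
by apply/funext => h; congr (_ *: (F _ - _)); exact: pt_tcons_head.
Qed.

Lemma derivable_tail F x y j :
  derivable F (pt (tcons (x, tpt y))) (delta_mx 0 (lift ord0 j)) ->
  derivable (fun y => F (pt (@tcons R n (x, tpt y)))) y (delta_mx 0 j).
Proof.
move=> dF; rewrite /derivable (_ : (fun h : R => _) = (fun h : R => h^-1 *: ((F \o shift (pt (tcons (x, tpt y))))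
  (h *: delta_mx 0 (lift ord0 j)) - F (pt (tcons (x, tpt y))))))//.
by apply/funext => h; congr (_ *: (F _ - _)); exact: pt_tcons_tail.
Qed.

Lemma partial_tail F x y j :
  partial j (fun y => F (pt (@tcons R n (x, tpt y)))) y =
  partial (lift ord0 j) F (pt (tcons (x, tpt y))).
Proof.
rewrite /partial /derive (_ : (fun h : R => _) = (fun h : R => h^-1 *: ((F \o shift (pt (tcons (x, tpt y))))
  (h *: delta_mx 0 (lift ord0 j)) - F (pt (tcons (x, tpt y))))))//.
by apply/funext => h; congr (_ *: (F _ - _)); exact: pt_tcons_tail.
Qed.

Lemma cvg_rV (T : Type) (E : set_system T) (m : nat) (f : T -> 'rV[R]_m) (l : 'rV[R]_m) :
  Filter E -> (forall i, f x 0 i @[x --> E] --> l 0 i) -> f @ E --> l.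
Proof.
move=> FE fl; apply/cvg_ballP => e e0.
have : \forall x \near E, forall i, ball (l 0 i) e (f x 0 i).
  by apply: filter_forall => i; move/cvg_ballP: (fl i); exact.
by apply: filterS => x h; split => // k j; rewrite (ord1 k); exact: h.
Qed.

Lemma continuous_head t : continuous (fun s : R => pt (@tcons R n (s, t))).
Proof.
move=> x; apply: cvg_rV => i; have [j ->|->] := unliftP ord0 i.
  under eq_fun do rewrite pt_tcons_lift; rewrite pt_tcons_lift; exact: cvg_cst.
by under eq_fun do rewrite pt_tcons0; rewrite pt_tcons0; exact: cvg_id.
Qed.

Lemma continuous_tail x : continuous (fun y => pt (@tcons R n (x, tpt y))).
Proof.
move=> y; apply: (@cvg_rV _ (nbhs y) _ _ _ (nbhs_filter y)) => i; have [j ->|->] := unliftP ord0 i.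
  under eq_fun do rewrite pt_tcons_lift tnth_mktuple.
  by rewrite pt_tcons_lift tnth_mktuple; exact: coord_continuous.
by under eq_fun do rewrite pt_tcons0; rewrite pt_tcons0; exact: cvg_cst.
Qed.

End slices.

(** * Integration by parts on boxes *)

Section box_integral.
Variable R : realType.
Local Notation mu := (@lebesgue_measure R).

Lemma bounded_obox n (a b : 'I_n -> R) : bounded_set (obox a b).
Proof.
pose M := \sum_i (`|a i| + `|b i|); exists M; split; first exact: num_real.
move=> M' MM' x abx; apply: le_trans (ltW MM').
have M0 : 0 <= M by apply: sumr_ge0 => i _; exact: addr_ge0.
have hx i : `|x 0 i| <= M.
  apply: (@le_trans _ _ (`|a i| + `|b i|)).
    have /andP[h1 h2] := abx i; rewrite ler_norml.
    have := ler_norm (b i); have := ler_norm (- a i); rewrite normrN.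
    have := normr_ge0 (b i); have := normr_ge0 (a i).
    by move=> *; apply/andP; split; lra.
  by rewrite /M (bigD1 i)//= lerDl; apply: sumr_ge0 => j _; exact: addr_ge0.
rewrite /Num.norm/= mx_normrE; apply: bigmax_le => // -[k i] _ /=.
by rewrite (ord1 k).
Qed.

Lemma integrable_obox_continuous n (a b : 'I_n -> R) (g : 'rV[R]_n -> R) :
  continuous g -> (@leb R n).-integrable (tbox a b) (EFin \o (g \o @pt R n)).
Proof.
move=> cg; apply: measurable_bounded_integrable.
- exact: measurable_tbox.
- exact: leb_tbox_lty.
- rewrite -pt_obox; apply: measurable_fun_continuous_on; first exact: open_obox.
  by move=> x _; exact: cg.
- have [M HM] := C0_bounded (@bounded_obox n a b) (continuous_subspaceT cg).
  exists M; split; first exact: num_real.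
  move=> M' MM' t tab; apply: le_trans (ltW MM'); apply: HM; apply: subset_closure.
  by rewrite -pt_obox in tab.
Qed.

Lemma integral_oo_derive (a b : R) (f : R -> R) : a < b ->
  (forall x, derivable f x 1) -> continuous ('D_1 f) ->
  (\int[mu]_(x in `]a, b[) ('D_1 f x)%:E = (f b)%:E - (f a)%:E)%E.
Proof.
move=> ab df cf.
rewrite -(@integral_itv_bndoo _ _ _ _ true false); last first.
  apply/measurable_EFinP; apply: measurable_funTS; exact: continuous_measurable_fun.
have cff : continuous f by move=> x; apply/differentiable_continuous/derivable1_diffP.
apply: (@continuous_FTC2 _ _ f) => //.
- exact: continuous_subspaceT.
- by split => //; [apply: cvg_at_right_filter|apply: cvg_at_left_filter]; exact: cff.
- by move=> x _; rewrite derive1E.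
Qed.

(** Induction on the dimension by Fubini. When [i] is a later coordinate, the first one is frozen
    and the induction hypothesis applies to the slice; when [i] is the first, it is integrated
    innermost and the fundamental theorem of calculus leaves two zero boundary values. Asking [F] to
    vanish on whole hyperplanes, and not just on the faces, lets the hypothesis pass to slices
    unchanged. *)
Lemma integral_box_partial n (i : 'I_n) (a b : 'I_n -> R) (F : 'rV[R]_n -> R) :
  (forall x, derivable F x (delta_mx 0 i)) -> continuous (partial i F) ->
  (forall x : 'rV[R]_n, x 0 i = a i \/ x 0 i = b i -> F x = 0) ->
  (\int[@leb R n]_(t in tbox a b) (partial i F (pt t))%:E = 0)%E.
Proof.
elim: n i a b F => [[]//|n IH] i a b F dF cF F0.
have := integrable_obox_continuous a b cF.
move=> /(integrable_mkcond _ (measurable_tbox a b)) intF.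
rewrite integral_mkcond.
have patch_tcons x t : ((fun t => (partial i F (pt t))%:E) \_ (tbox a b))%E (tcons (x, t)) =
   if `[< a ord0 < x < b ord0 >] && `[< tbox (a \o lift ord0) (b \o lift ord0) t >]
   then (partial i F (pt (tcons (x, t))))%:E else 0%E.
  rewrite patchE; congr (if _ then _ else _).
  transitivity (`[< ((@tcons R n) @^-1` tbox a b) (x, t) >]).
    by apply/idP/asboolP; rewrite inE.
  rewrite tcons_tbox; apply/asboolP/andP => -[]/=; rewrite in_itv/=.
    by move=> ? ?; split; exact/asboolP.
  by move=> /asboolP ? /asboolP.
have [j ij|i0] := unliftP ord0 i.
  rewrite integral_tcons12//; apply: integral0_eq => x _.
  under eq_integral do rewrite patch_tcons.
  case: asboolP => xab; last by rewrite /= integral0.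
  have := IH j (a \o lift ord0) (b \o lift ord0) (fun y => F (pt (tcons (x, tpt y)))).
  move=> IHj; rewrite -[RHS]IHj.
  - rewrite [RHS]integral_mkcond; apply: eq_integral => t _.
    rewrite patchE partial_tail -ij ptK.
    by congr (if _ then _ else _); apply/asboolP/idP; rewrite inE.
  - by move=> y; apply: derivable_tail; rewrite -ij.
  - rewrite (_ : partial _ _ = partial i F \o (fun y => pt (tcons (x, tpt y)))).
      by move=> y; apply: continuous_comp; [exact: continuous_tail|exact: cF].
    by apply/funext => y; rewrite partial_tail ij.
  - by move=> y h; apply: F0; rewrite ij pt_tcons_lift tnth_mktuple.
rewrite integral_tcons21//; apply: integral0_eq => t _.
under eq_integral do rewrite patch_tcons.
case: asboolP => tab; last first.
  by under eq_integral do rewrite andbF; rewrite integral0.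
(* The corners are not assumed to be ordered: if they are not, the interval is empty. *)
have [ab|ba] := ltP (a ord0) (b ord0); last first.
  apply: integral0_eq => x _; case: asboolP => // /andP[h1 h2].
  by have := lt_trans h1 h2; rewrite ltNge ba.
pose f := fun s => F (pt (tcons (s, t))).
have Df : 'D_1 f = fun s => partial i F (pt (tcons (s, t))).
  by apply/funext => s; rewrite derive_head i0.
have int_f := @integral_oo_derive _ _ f ab.
rewrite Df integral_mkcond in int_f.
transitivity (((f (b ord0))%:E - (f (a ord0))%:E)%E); last first.
  by rewrite /f !F0 ?i0 ?pt_tcons0 ?subee//; [left|right].
rewrite -int_f; [|by move=> s; apply: derivable_head; rewrite -i0|]; last first.
  by move=> s; apply: (@continuous_comp _ _ _ (fun s => pt (tcons (s, t))));
    [exact: continuous_head|exact: cF].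
apply: eq_integral => x _; rewrite patchE andbT.
by rewrite -(congr1 (fun g => g x) Df); congr (if _ then _ else _).
Qed.

End box_integral.

(** * Continuously differentiable functions *)

Section continuously_differentiable.
Variables (R : realType) (n : nat).
Implicit Types f g : 'rV[R]_n -> R.

(** Differentiability is asked along the axes only, with continuous partial derivatives on the whole
    space. This suffices for integration by parts on boxes and covers test functions and
    polynomials. *)
Definition C1 f : Prop := continuous f /\ forall i,
  (forall x, derivable f x (delta_mx 0 i)) /\ continuous (partial i f).

Lemma partialD_at f g i x : derivable f x (delta_mx 0 i) -> derivable g x (delta_mx 0 i) ->
  partial i (fun x => f x + g x) x = partial i f x + partial i g x.
Proof. exact: deriveD. Qed.

Lemma partialM_at f g i x : derivable f x (delta_mx 0 i) -> derivable g x (delta_mx 0 i) ->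
  partial i (fun x => f x * g x) x = f x * partial i g x + g x * partial i f x.
Proof. exact: deriveM. Qed.

Lemma partialM f g i : C1 f -> C1 g ->
  partial i (fun x => f x * g x) = fun x => f x * partial i g x + g x * partial i f x.
Proof.
by move=> [_ Df] [_ Dg]; apply/funext => x; apply: partialM_at; [have [] := Df i|have [] := Dg i].
Qed.

Lemma C1D f g : C1 f -> C1 g -> C1 (fun x => f x + g x).
Proof.
move=> [cf Df] [cg Dg]; split; first by move=> x; exact: (cvgD (cf x) (cg x)).
move=> i; have [df pf] := Df i; have [dg pg] := Dg i; split.
  by move=> x; exact: derivableD.
rewrite (_ : partial _ _ = fun x => partial i f x + partial i g x).
  by move=> x; exact: (cvgD (pf x) (pg x)).
by apply/funext => x; exact: partialD_at.
Qed.

Lemma C1M f g : C1 f -> C1 g -> C1 (fun x => f x * g x).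
Proof.
move=> [cf Df] [cg Dg]; split; first by move=> x; exact: (cvgM (cf x) (cg x)).
move=> i; have [df pf] := Df i; have [dg pg] := Dg i; split.
  by move=> x; exact: derivableM.
by rewrite partialM// => x; exact: (cvgD (cvgM (cf x) (pg x)) (cvgM (cg x) (pf x))).
Qed.

Lemma C1_cst (k : R) : C1 (fun=> k).
Proof.
split; first exact: cst_continuous.
move=> i; split; first by move=> x; exact: derivable_cst.
by rewrite (_ : partial _ _ = fun=> 0); [exact: cst_continuous|apply/funext => x; exact: derive_cst].
Qed.

Lemma derive_coord i j (x : 'rV[R]_n) :
  is_derive x (delta_mx 0 i : 'rV[R]_n) (fun y : 'rV[R]_n => y 0 j) (j == i)%:R.
Proof.
pose q h : R := h^-1 *: (((fun y : 'rV[R]_n => y 0 j) \o shift x) (h *: delta_mx 0 i) - x 0 j).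
have qE : {near 0^', (fun=> (j == i)%:R) =1 q}.
  near=> h; rewrite /q /= !mxE eqxx /= addrK [_ *: _]mulrA mulVf ?mul1r//.
  by near: h; exact: nbhs_dnbhs_neq.
have ql : q @ 0^' --> ((j == i)%:R : R).
  exact: cvg_trans (near_eq_cvg qE) (cvg_cst _).
by apply: DeriveDef; [exact: (cvgP _ ql)|exact: cvg_lim ql].
Unshelve. all: by end_near. Qed.

Lemma C1_coord j : C1 (fun x => x 0 j).
Proof.
split; first exact: coord_continuous.
move=> i; split; first by move=> x; have [] := derive_coord i j x.
rewrite (_ : partial _ _ = fun=> (j == i)%:R); first by exact: cst_continuous.
by apply/funext => x; have [] := derive_coord i j x.
Qed.

Lemma C1_sum (I : Type) (r : seq I) (P : pred I) (F : I -> 'rV[R]_n -> R) :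
  (forall i, C1 (F i)) -> C1 (fun x => \sum_(i <- r | P i) F i x).
Proof.
move=> CF; elim: r => [|k r IH].
  by under eq_fun do rewrite big_nil; exact: C1_cst.
under eq_fun do rewrite big_cons; case: (P k) => //.
exact: C1D.
Qed.

Lemma C1_prod (I : Type) (r : seq I) (P : pred I) (F : I -> 'rV[R]_n -> R) :
  (forall i, C1 (F i)) -> C1 (fun x => \prod_(i <- r | P i) F i x).
Proof.
move=> CF; elim: r => [|k r IH].
  by under eq_fun do rewrite big_nil; exact: C1_cst.
under eq_fun do rewrite big_cons; case: (P k) => //.
exact: C1M.
Qed.

Lemma C1X f k : C1 f -> C1 (fun x => f x ^+ k).
Proof.
move=> Cf; elim: k => [|k IH]; first exact: C1_cst.
by under eq_fun do rewrite exprS; exact: C1M.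
Qed.

Lemma smooth_C1 f : smooth f -> C1 f.
Proof.
by move=> sf; split; [exact: (sf [::]).1|move=> i; split; [exact: (sf [::]).2|exact: (sf [:: i]).1]].
Qed.

Lemma C1_poly k (c : {ffun 'I_n -> 'I_k.+1} -> R) (P : pred {ffun 'I_n -> 'I_k.+1}) :
  C1 (fun x => \sum_(a | P a) c a * \prod_i x 0 i ^+ a i).
Proof.
apply: C1_sum => a; apply: C1M; first exact: C1_cst.
by apply: C1_prod => i; apply: C1X; exact: C1_coord.
Qed.

End continuously_differentiable.

(** * Integrability and limits *)

Section integral_classes.
Variables (R : realType) (n : nat).
Implicit Types (A B : set 'rV[R]_n) (f g h : 'rV[R]_n -> R).
Local Notation Phi A := (@pt R n @^-1` A).

(** Bounded measurable functions form an algebra, unlike L^2, and are integrable on sets of finite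
    measure. On the element interiors, finite element functions and their pointwise partial
    derivatives all belong to this class, so integrability of any product of them is mechanical. *)
Definition bmeas A f : Prop := measurable_fun (Phi A) (f \o @pt R n) /\
  exists M, forall x, A x -> `|f x| <= M.

Definition integr A f : Prop :=
  (@leb R n).-integrable (Phi A) (EFin \o (f \o @pt R n)).

Lemma bmeas_cst A (k : R) : bmeas A (fun=> k).
Proof. by split; [exact: measurable_cst|exists `|k|]. Qed.

Lemma bmeasD A f g : bmeas A f -> bmeas A g -> bmeas A (fun x => f x + g x).
Proof.
move=> [mf [M fM]] [mg [M' gM]]; split; first exact: measurable_funD.
by exists (M + M') => x Ax; rewrite (le_trans (ler_normD _ _))// lerD ?fM ?gM.
Qed.

Lemma bmeasM A f g : bmeas A f -> bmeas A g -> bmeas A (fun x => f x * g x).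
Proof.
move=> [mf [M fM]] [mg [M' gM]]; split; first exact: measurable_funM.
by exists (M * M') => x Ax; rewrite normrM ler_pM ?fM ?gM.
Qed.

Lemma bmeasZ A k f : bmeas A f -> bmeas A (fun x => k * f x).
Proof. by move=> Af; apply: bmeasM => //; exact: bmeas_cst. Qed.

Lemma bmeasN A f : bmeas A f -> bmeas A (fun x => - f x).
Proof.
by move=> [mf [M fM]]; split; [exact: measurableT_comp|exists M => x Ax; rewrite normrN fM].
Qed.

Lemma bmeas_sum A (I : Type) (r : seq I) (P : pred I) (F : I -> 'rV[R]_n -> R) :
  (forall i, bmeas A (F i)) -> bmeas A (fun x => \sum_(i <- r | P i) F i x).
Proof.
move=> AF; elim: r => [|k r IH].
  by under eq_fun do rewrite big_nil; exact: bmeas_cst.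
under eq_fun do rewrite big_cons; case: (P k) => //.
exact: bmeasD.
Qed.

Lemma bmeasS A B f : measurable (Phi A) -> measurable (Phi B) -> B `<=` A ->
  bmeas A f -> bmeas B f.
Proof.
move=> mA mB BA [mf [M fM]]; split; last by exists M => x Bx; exact/fM/BA.
by apply: measurable_funS mf => // t; exact: BA.
Qed.

Lemma eq_bmeas A f g : (forall x, A x -> f x = g x) -> bmeas A f -> bmeas A g.
Proof.
move=> fg [mf [M fM]]; split; last by exists M => x Ax; rewrite -fg// fM.
by apply: eq_measurable_fun mf => t /[!inE] At /=; rewrite fg.
Qed.

Lemma bmeas_C1 A f : bounded_set A -> measurable (Phi A) -> continuous f -> bmeas A f.
Proof.
move=> bA mA cf; split.
  apply: (@measurable_funS _ _ _ _ setT) => //.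
  have := @measurable_fun_continuous_on R n setT f openT (fun x _ => cf x).
  by rewrite preimage_setT.
have [M HM] := C0_bounded bA (continuous_subspaceT cf).
by exists M => x Ax; apply: HM; exact: subset_closure.
Qed.

Lemma integrable_measurable A f : integr A f -> measurable_fun (Phi A) (f \o @pt R n).
Proof. by case/integrableP => /measurable_EFinP. Qed.

Lemma bmeas_integr A f : measurable (Phi A) -> (leb (Phi A) < +oo)%E ->
  bmeas A f -> integr A f.
Proof.
move=> mA Aoo [mf [M fM]]; apply: measurable_bounded_integrable => //.
exists M; split; first exact: num_real.
by move=> M' MM' t At; apply: le_trans (ltW MM'); exact: fM.
Qed.

Lemma integrD A f g : measurable (Phi A) ->
  integr A f -> integr A g -> integr A (fun x => f x + g x).
Proof.
move=> mA Af Ag; rewrite /integr.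
rewrite (_ : EFin \o _ = (EFin \o (f \o @pt R n)) \+ (EFin \o (g \o @pt R n)))%E//.
exact: integrableD.
Qed.

Lemma integrZ A k f : measurable (Phi A) -> integr A f -> integr A (fun x => k * f x).
Proof.
move=> mA Af; rewrite /integr.
rewrite (_ : EFin \o _ = fun t => (k%:E * (EFin \o (f \o @pt R n)) t)%E)//.
exact: integrableZl.
Qed.

Lemma integrN A f : measurable (Phi A) -> integr A f -> integr A (fun x => - f x).
Proof.
by move=> mA Af; have := integrZ (-1) mA Af; under eq_fun do rewrite mulN1r.
Qed.

Lemma integrB A f g : measurable (Phi A) ->
  integr A f -> integr A g -> integr A (fun x => f x - g x).
Proof. by move=> mA Af Ag; apply: integrD => //; exact: integrN. Qed.

Lemma integr0 A : measurable (Phi A) -> integr A (fun=> 0).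
Proof. by move=> mA; exact: integrable0. Qed.

Lemma integr_sum A (I : Type) (r : seq I) (P : pred I) (F : I -> 'rV[R]_n -> R) :
  measurable (Phi A) ->
  (forall i, integr A (F i)) -> integr A (fun x => \sum_(i <- r | P i) F i x).
Proof.
move=> mA AF; elim: r => [|k r IH].
  by under eq_fun do rewrite big_nil; exact: integr0.
under eq_fun do rewrite big_cons; case: (P k) => //.
exact: integrD.
Qed.

Lemma integrS A B f : measurable (Phi A) -> measurable (Phi B) -> B `<=` A ->
  integr A f -> integr B f.
Proof. by move=> mA mB BA; apply: integrableS => // t; exact: BA. Qed.

Lemma leb_intE A f : leb_int A f = \int[@leb R n]_(t in Phi A) (f (pt t)).
Proof. by []. Qed.

Lemma leb_intD A f g : measurable (Phi A) -> integr A f -> integr A g ->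
  leb_int A (fun x => f x + g x) = leb_int A f + leb_int A g.
Proof. by move=> mA Af Ag; rewrite !leb_intE RintegralD. Qed.

Lemma leb_intZ A k f : measurable (Phi A) -> integr A f ->
  leb_int A (fun x => k * f x) = k * leb_int A f.
Proof. by move=> mA Af; rewrite !leb_intE RintegralZl. Qed.

Lemma leb_intB A f g : measurable (Phi A) -> integr A f -> integr A g ->
  leb_int A (fun x => f x - g x) = leb_int A f - leb_int A g.
Proof. by move=> mA Af Ag; rewrite !leb_intE RintegralB. Qed.

Lemma eq_leb_int A f g : (forall x, A x -> f x = g x) -> leb_int A f = leb_int A g.
Proof. by move=> fg; rewrite !leb_intE; apply: eq_Rintegral => t /[!inE] At; exact: fg. Qed.

Lemma leb_int0 A : leb_int A (fun=> 0) = 0.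
Proof. by rewrite /leb_int /leb_eint integral0_eq. Qed.

Lemma leb_int_sum A (I : Type) (r : seq I) (P : pred I) (F : I -> 'rV[R]_n -> R) :
  measurable (Phi A) -> (forall i, integr A (F i)) ->
  leb_int A (fun x => \sum_(i <- r | P i) F i x) = \sum_(i <- r | P i) leb_int A (F i).
Proof.
move=> mA AF; elim: r => [|k r IH].
  by under eq_fun do rewrite big_nil; rewrite big_nil leb_int0.
under eq_fun do rewrite big_cons; rewrite big_cons; case: (P k) => //.
by rewrite leb_intD// ?IH//; exact: integr_sum.
Qed.

Lemma leb_int_ge0 A f : (forall x, A x -> 0 <= f x) -> 0 <= leb_int A f.
Proof. by move=> f0; rewrite leb_intE; apply: Rintegral_ge0 => t; exact: f0. Qed.

Lemma leb_int_setD_null A Z f : measurable (Phi Z) -> Defs.null_set Z ->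
  leb_int A f = leb_int (A `\` Z) f.
Proof. by move=> mZ Z0; rewrite /leb_int /leb_eint (integral_setD_null _ _ mZ Z0). Qed.

Lemma L2_sqr_integr A f : L2 A f -> integr A (fun x => f x ^+ 2).
Proof.
move=> [mf foo]; apply/integrableP; split.
  by apply/measurable_EFinP; exact: measurable_funX.
under eq_integral do rewrite gee0_abs ?lee_fin ?sqr_ge0//.
exact: foo.
Qed.

Lemma integr_sqr_L2 A f : measurable_fun (Phi A) (f \o @pt R n) ->
  integr A (fun x => f x ^+ 2) -> L2 A f.
Proof.
move=> mf /integrableP[_ foo]; split => //; rewrite /leb_eint.
by under eq_integral do rewrite -[X in (X%:E)]ger0_norm ?sqr_ge0//.
Qed.

Lemma integr_le A f g : measurable (Phi A) -> measurable_fun (Phi A) (f \o @pt R n) ->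
  integr A g -> (forall x, A x -> `|f x| <= g x) -> integr A f.
Proof.
move=> mA mf Ag fg; apply: le_integrable Ag => //.
  exact/measurable_EFinP.
by move=> t At /=; rewrite lee_fin (le_trans (fg _ At))// ler_norm.
Qed.

Lemma L2_integrM A f g : measurable (Phi A) -> L2 A f -> L2 A g ->
  integr A (fun x => f x * g x).
Proof.
move=> mA Lf Lg; have /L2_sqr_integr If := Lf; have /L2_sqr_integr Ig := Lg.
apply: (integr_le mA _ (integrD mA If Ig)).
  by apply: measurable_funM; [exact: Lf.1|exact: Lg.1].
move=> x _; rewrite normrM -[f x ^+ 2]real_normK ?num_real// -[g x ^+ 2]real_normK ?num_real//.
by nra.
Qed.

Lemma L2D A f g : measurable (Phi A) -> L2 A f -> L2 A g -> L2 A (fun x => f x + g x).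
Proof.
move=> mA Lf Lg; apply: integr_sqr_L2.
  by apply: measurable_funD; [exact: Lf.1|exact: Lg.1].
rewrite (_ : (fun x => _) = fun x => f x ^+ 2 + 2 * (f x * g x) + g x ^+ 2); last first.
  by apply/funext => x; ring.
apply: integrD => //; last exact: L2_sqr_integr.
apply: integrD => //; first exact: L2_sqr_integr.
by apply: integrZ => //; exact: L2_integrM.
Qed.

Lemma L2Z A k f : measurable (Phi A) -> L2 A f -> L2 A (fun x => k * f x).
Proof.
move=> mA Lf; apply: integr_sqr_L2.
  by apply: measurable_funM; [exact: measurable_cst|exact: Lf.1].
under eq_fun do rewrite exprMn.
by apply: integrZ => //; exact: L2_sqr_integr.
Qed.

Lemma L2B A f g : measurable (Phi A) -> L2 A f -> L2 A g -> L2 A (fun x => f x - g x).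
Proof.
by move=> mA Lf Lg; have := L2D mA Lf (L2Z (-1) mA Lg); under eq_fun do rewrite mulN1r.
Qed.

Lemma bmeas_L2 A f : measurable (Phi A) -> (leb (Phi A) < +oo)%E -> bmeas A f -> L2 A f.
Proof.
move=> mA Aoo Af; apply: integr_sqr_L2; first exact: Af.1.
by apply: bmeas_integr => //; exact: bmeasM.
Qed.

Lemma bmeasM_L2 A f g : measurable (Phi A) -> bmeas A f -> L2 A g -> L2 A (fun x => f x * g x).
Proof.
move=> mA [mf [M fM]] Lg; apply: integr_sqr_L2.
  by apply: measurable_funM => //; exact: Lg.1.
apply: (integr_le mA _ (integrZ (M ^+ 2) mA (L2_sqr_integr Lg))).
  by apply: measurable_funX; apply: measurable_funM => //; exact: Lg.1.
move=> x Ax; rewrite ger0_norm ?sqr_ge0// exprMn ler_wpM2r ?sqr_ge0//.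
by rewrite -[f x ^+ 2]real_normK ?num_real// ler_sqr ?nnegrE ?fM// (le_trans _ (fM x Ax)).
Qed.

Lemma L2S A B f : measurable (Phi A) -> measurable (Phi B) -> B `<=` A ->
  L2 A f -> L2 B f.
Proof.
move=> mA mB BA Lf; apply: integr_sqr_L2.
  by apply: measurable_funS Lf.1 => // t; exact: BA.
exact: integrS (L2_sqr_integr Lf).
Qed.

End integral_classes.

(** * Cauchy-Schwarz and passage to the limit under the integral *)

Section limits.
Variables (R : realType).

Lemma discriminant_le (a b c : R) : 0 <= c ->
  (forall t, 0 <= a + 2 * t * b + t ^+ 2 * c) -> b ^+ 2 <= a * c.
Proof.
move=> c0 h; have [cE|c1] := eqVneq c 0.
  have [->|b0] := eqVneq b 0; first by rewrite cE expr0n mulr0.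
  (* At this [t] the expression, affine in [t] when [c] is zero, equals -1. *)
  have := h (- (a + 1) / (2 * b)); rewrite cE mulr0 addr0.
  have -> : 2 * (- (a + 1) / (2 * b)) * b = - (a + 1) by field.
  by move=> ?; exfalso; lra.
have cp : 0 < c by rewrite lt_def c1.
(* The minimiser of the quadratic. *)
have := h (- b / c); rewrite -(pmulr_lge0 _ cp).
have -> : (a + 2 * (- b / c) * b + (- b / c) ^+ 2 * c) * c = a * c - b ^+ 2 by field.
by rewrite subr_ge0.
Qed.

Variable n : nat.
Implicit Types (A B : set 'rV[R]_n) (f g h : 'rV[R]_n -> R).
Local Notation Phi A := (@pt R n @^-1` A).

Lemma leb_int_CS A f g : measurable (Phi A) -> L2 A f -> L2 A g ->
  leb_int A (fun x => f x * g x) ^+ 2 <=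
  leb_int A (fun x => f x ^+ 2) * leb_int A (fun x => g x ^+ 2).
Proof.
move=> mA Lf Lg; have If := L2_sqr_integr Lf; have Ig := L2_sqr_integr Lg.
have Ifg := L2_integrM mA Lf Lg.
apply: discriminant_le => [|t]; first by apply: leb_int_ge0 => x _; exact: sqr_ge0.
rewrite -!leb_intZ// -leb_intD//; last exact: integrZ.
rewrite -leb_intD//; [|by apply: integrD => //; exact: integrZ|exact: integrZ].
apply: leb_int_ge0 => x _.
have -> : f x ^+ 2 + 2 * t * (f x * g x) + t ^+ 2 * g x ^+ 2 = (f x + t * g x) ^+ 2 by ring.
exact: sqr_ge0.
Qed.

Lemma L2_cvgS A B (f_ : nat -> 'rV[R]_n -> R) f : measurable (Phi A) -> measurable (Phi B) -> B `<=` A ->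
  (forall k, measurable_fun (Phi A) (f_ k \o @pt R n)) ->
  measurable_fun (Phi A) (f \o @pt R n) ->
  L2_cvg A f_ f -> L2_cvg B f_ f.
Proof.
move=> mA mB BA mf_ mf fA; apply: (squeeze_cvge _ (cvg_cst 0%E) fA).
apply: nearW => k; apply/andP; split.
  by apply: integral_ge0 => t _; rewrite lee_fin sqr_ge0.
apply: ge0_subset_integral => //.
- apply/measurable_EFinP; apply: measurable_funX; exact: (measurable_funB (mf_ k) mf).
- by move=> t _; rewrite lee_fin sqr_ge0.
- by move=> t; exact: BA.
Qed.

(** By Cauchy-Schwarz the squared error is at most the squared L^2 distance of [f_ k] to [f] times
    the squared norm of [g]. *)
Lemma L2_cvg_leb_int A (f_ : nat -> 'rV[R]_n -> R) f g : measurable (Phi A) ->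
  (forall k, L2 A (f_ k)) -> L2 A f -> L2 A g -> L2_cvg A f_ f ->
  leb_int A (fun x => f_ k x * g x) @[k --> \oo] --> leb_int A (fun x => f x * g x).
Proof.
move=> mA Lf_ Lf Lg /fine_cvg/= cf.
have {}cf : leb_int A (fun x => (f_ k x - f x) ^+ 2) @[k --> \oo] --> (0 : R) by exact: cf.
set G := leb_int A (fun x => g x ^+ 2).
have G0 : 0 <= G by apply: leb_int_ge0 => x _; exact: sqr_ge0.
apply/cvgrPdist_lt => e e0.
(* Dividing by [G + 1] instead of [G] covers the case where [g] has norm zero. *)
have : \forall k \near \oo, leb_int A (fun x => (f_ k x - f x) ^+ 2) < e ^+ 2 / (G + 1).
  move/cvgrPdist_lt: cf => /(_ (e ^+ 2 / (G + 1))) [|N _ HN].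
    by rewrite divr_gt0 ?exprn_gt0// ltr_wpDl.
  exists N => // k /HN; rewrite sub0r normrN => /le_lt_trans; apply; exact: ler_norm.
apply: filterS => k hk.
rewrite distrC -leb_intB//; [|exact: L2_integrM|exact: L2_integrM].
have -> : (fun x => f_ k x * g x - f x * g x) = (fun x => (f_ k x - f x) * g x).
  by apply/funext => x; rewrite mulrBl.
rewrite -ltr_sqr ?nnegrE ?(ltW e0)// real_normK ?num_real//.
apply: le_lt_trans (leb_int_CS mA (L2B mA (Lf_ k) Lf) Lg) _; rewrite -/G.
set a := leb_int _ _ in hk *.
have a0 : 0 <= a by apply: leb_int_ge0 => x _; exact: sqr_ge0.
have : a * (G + 1) < e ^+ 2 by rewrite -ltr_pdivlMr// ltr_wpDl.
by apply: le_lt_trans; rewrite ler_wpM2l// lerDl.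
Qed.

(** Dominated convergence with majorant [|h|]. It removes two kinds of weights: indicators of
    growing finite unions of boxes, and polynomials vanishing on two opposite faces of a box. *)
Lemma leb_int_weight0 A h (theta : nat -> 'rV[R]_n -> R) : measurable (Phi A) ->
  integr A h -> (forall m, measurable_fun (Phi A) (theta m \o @pt R n)) ->
  (forall m x, A x -> `|theta m x| <= 1) ->
  (forall x, A x -> theta m x @[m --> \oo] --> (1 : R)) ->
  (forall m, leb_int A (fun x => h x * theta m x) = 0) -> leb_int A h = 0.
Proof.
move=> mA Ah mth th1 cth th0.
have mh := integrable_measurable Ah.
have := @dominated_convergence _ _ _ (@leb R n) (Phi A) mA
  (fun m t => (h (pt t) * theta m (pt t))%:E) (fun t => (h (pt t))%:E)
  (fun t => (`|h (pt t)|)%:E).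
case.
- by move=> m; apply/measurable_EFinP; exact: (measurable_funM mh (mth _)).
- by apply/measurable_EFinP.
- apply: aeW => t At; apply: cvg_EFin.
    by apply: nearW.
  by rewrite -[X in _ --> X]mulr1; apply: cvgM; [exact: cvg_cst|exact: cth].
- by have := integrable_abse Ah.
- by apply: aeW => t m At; rewrite lee_fin normrM ler_piMr// th1.
have iz m : (\int[@leb R n]_(t in Phi A) (h (pt t) * theta m (pt t))%:E = 0)%E.
  rewrite -[LHS]fineK; first by congr (_%:E); exact: th0.
  apply: (integrable_fin_num mA).
  apply: (@integr_le _ _ A (fun x => h x * theta m x) (fun x => `|h x|)) => //.
  - exact: (measurable_funM mh (mth _)).
  - by have := integrable_abse Ah.
  - by move=> x Ax; rewrite normrM ler_piMr// th1.
case=> _ _; set u := (X in X @ \oo --> _).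
have -> : u = cst 0%E by apply/funext => m; exact: iz.
move=> /(cvg_unique (@ereal_hausdorff R) (cvg_cst 0%E)) h0.
by rewrite /leb_int /leb_eint -h0.
Qed.

End limits.

(** * From boxes to open sets *)

Section box_exhaustion.
Variables (R : realType) (n : nat).
Implicit Types (A B G Q : set 'rV[R]_n) (f g h : 'rV[R]_n -> R).
Local Notation Phi A := (@pt R n @^-1` A).

Lemma leb_int_indic A B h : B `<=` A -> leb_int A (fun x => h x * \1_B x) = leb_int B h.
Proof.
move=> BA; rewrite !leb_intE Rintegral_mkcond [RHS]Rintegral_mkcond.
apply: eq_Rintegral => t _; rewrite !patchE indicE.
have -> : (t \in Phi B) = (pt t \in B) by apply/idP/idP; rewrite !inE.
have -> : (t \in Phi A) = (pt t \in A) by apply/idP/idP; rewrite !inE.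
case: (boolP (pt t \in B)) => tB; last by rewrite mulr0; case: ifP.
by rewrite mulr1 mem_set//; apply: BA; rewrite inE in tB.
Qed.

Lemma leb_intU A B h : measurable (Phi A) -> measurable (Phi B) ->
  integr (A `|` B) h -> [disjoint A & B] -> leb_int (A `|` B) h = leb_int A h + leb_int B h.
Proof.
move=> mA mB ih dAB; rewrite !leb_intE.
rewrite (_ : Phi (A `|` B) = Phi A `|` Phi B)// Rintegral_setU//.
move: dAB; rewrite !disj_set2E => /eqP AB; apply/eqP/seteqP; split => t//= [tA tB].
by have : (A `&` B) (pt t) by []; rewrite AB.
Qed.

(* Boxes are closed under intersection, so vanishing passes to finite unions by
   inclusion-exclusion, and [G] is a countable union of boxes. *)
Lemma leb_int_open0 G h : open G -> integr G h ->
  (forall a b, obox a b `<=` G -> leb_int (obox a b) h = 0) -> leb_int G h = 0.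
Proof.
move=> oG ih box0; have [Q [Qbox GQ]] := open_cover_obox oG.
pose BB B := B `<=` G /\ (B = set0 \/ exists a b, B = obox a b).
have mBB B : BB B -> measurable (Phi B).
  move=> [_ [->|[a [b ->]]]]; first by rewrite preimage_set0.
  by rewrite pt_obox; exact: measurable_tbox.
have BB0 B : BB B -> leb_int B h = 0.
  move=> [BG [->|[a [b Bab]]]]; first by rewrite leb_intE preimage_set0 Rintegral_set0.
  by rewrite Bab; apply: box0; rewrite -Bab.
have BBI B B' : BB B -> BB B' -> BB (B `&` B').
  move=> [BG [->|[a [b ->]]]]; first by rewrite set0I; split => //; left.
  move=> [BG' [->|[a' [b' Bab']]]]; first by rewrite setI0; split => //; left.
  split; first by move=> x [_]; exact: BG'.
  by rewrite Bab' obox_setI; right; eexists; eexists.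
pose U s := \big[setU/set0]_(B <- s) (B : set 'rV[R]_n).
have mU s : (forall B, B \in s -> BB B) -> measurable (Phi (U s)) /\ U s `<=` G.
  elim: s => [_|B s IH Bs]; first by rewrite /U big_nil; split => //; rewrite preimage_set0.
  have sBB B' : B' \in s -> BB B' by move=> Hs; apply: Bs; rewrite inE Hs orbT.
  have [mU UG] := IH sBB.
  have BBB : BB B by apply: Bs; rewrite inE eqxx.
  rewrite /U big_cons -/(U s); split; first by apply: measurableU => //; exact: mBB.
  by move=> x [/BBB.1|/UG].
have U0 m s : size s = m -> (forall B, B \in s -> BB B) -> leb_int (U s) h = 0.
  elim: m s => [|m IH] [|B s]//=.
    by rewrite /U big_nil leb_intE preimage_set0 Rintegral_set0.
  move=> [sm] Bs; have sBB B' : B' \in s -> BB B' by move=> Hs; apply: Bs; rewrite inE Hs orbT.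
  have BBB : BB B by apply: Bs; rewrite inE eqxx.
  have [mUs UsG] := mU s sBB; have mB := mBB _ BBB.
  pose s' := [seq B' `&` B | B' <- s].
  have s'BB B' : B' \in s' -> BB B' by move=> /mapP[B'' /sBB ? ->]; exact: BBI.
  have Us' : U s' = U s `&` B by rewrite /U /s' big_map big_distrl.
  have mD : measurable (Phi (U s `\` B)) by apply: measurableD.
  have iS A : measurable (Phi A) -> A `<=` G -> integr A h.
    by move=> mA AG; apply: integrS ih => //; exact: measurable_pt_open.
  have E1 : leb_int (U s) h = leb_int (U s `\` B) h + leb_int (U s `&` B) h.
    rewrite -leb_intU//.
    - by rewrite setUC setUIDK.
    - exact: measurableI.
    - by rewrite setUC setUIDK; exact: iS.
    - by rewrite disj_set2E; apply/eqP/seteqP; split => // x [[_ nB] [_ xB]].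
  have D0 : leb_int (U s `\` B) h = 0.
    move: E1; rewrite -Us' (IH s)// (IH s') ?size_map//; lra.
  have -> : U (B :: s) = B `|` (U s `\` B).
    rewrite /U big_cons -/(U s); apply/seteqP; split => x [Bx|Ux]; try by left.
      by have [Bx|nBx] := pselect (B x); [left|right].
    by right; case: Ux.
  rewrite leb_intU//.
  - by rewrite BB0// D0 addr0.
  - apply: iS; first exact: measurableU.
    by move=> x [/BBB.1|[/UsG]].
  - by rewrite disj_set2E; apply/eqP/seteqP; split => // x [xB [_ nB]].
pose F m := U [seq Q k | k <- iota 0 m].
have FBB m B : B \in [seq Q k | k <- iota 0 m] -> BB B.
  by move=> /mapP[k _ ->]; split; [rewrite GQ => x Qx; exists k|exact: Qbox].
apply: (@leb_int_weight0 _ _ G h (fun m => \1_(F m))) => //.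
- exact: measurable_pt_open.
- move=> m; apply: (@measurable_funS _ _ _ _ setT) => //.
  rewrite (_ : _ \o _ = \1_(Phi (F m))).
    by apply: measurable_indic; exact: (mU _ (@FBB m)).1.
  by apply/funext => t; rewrite /= !indicE; congr (_%:R); apply/idP/idP; rewrite !inE.
- by move=> m x _; rewrite indicE normr_nat; case: (_ \in _); rewrite ?ler01.
- move=> x; rewrite GQ => -[k _ Qkx]; apply: cvg_near_cst.
  exists k.+1 => // m /= km; rewrite indicE mem_set//.
  rewrite /F /U big_map -bigcup_seq; exists k => //=.
  by rewrite mem_iota.
- move=> m; rewrite leb_int_indic; first by apply: (U0 _ _ erefl); exact: FBB.
  exact: (mU _ (@FBB m)).2.
Qed.

End box_exhaustion.

(** * Weights vanishing on the faces of a box *)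

Section box_weights.
Variables (R : realType) (n : nat).
Implicit Types (A B G Q : set 'rV[R]_n) (f g h : 'rV[R]_n -> R).
Local Notation Phi A := (@pt R n @^-1` A).

Lemma measurable_Phi_obox a b : measurable (Phi (@obox R n a b)).
Proof. by rewrite pt_obox; exact: measurable_tbox. Qed.

Lemma leb_obox_lty a b : (leb (Phi (@obox R n a b)) < +oo)%E.
Proof. by rewrite pt_obox; exact: leb_tbox_lty. Qed.

Lemma leb_int_box_partial (i : 'I_n) (a b : 'I_n -> R) F : C1 F ->
  (forall x : 'rV[R]_n, x 0 i = a i \/ x 0 i = b i -> F x = 0) ->
  leb_int (obox a b) (partial i F) = 0.
Proof.
move=> [_ CF] F0; have [dF cF] := CF i.
by rewrite /leb_int /leb_eint pt_obox (integral_box_partial dF cF F0).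
Qed.

(* Weights [1 - y^(2m)], where [y] maps [a i, b i] affinely onto [-1, 1]. *)
Lemma leb_int_box_weights (i : 'I_n) (a b : 'I_n -> R) h : integr (obox a b) h ->
  (forall theta, C1 theta ->
    (forall x : 'rV[R]_n, x 0 i = a i \/ x 0 i = b i -> theta x = 0) ->
    leb_int (obox a b) (fun x => h x * theta x) = 0) ->
  leb_int (obox a b) h = 0.
Proof.
move=> ih wh; have mab := measurable_Phi_obox a b.
have [ab|ba] := ltP (a i) (b i); last first.
  rewrite (_ : obox a b = set0) ?leb_intE ?preimage_set0 ?Rintegral_set0//.
  apply/seteqP; split => // x /(_ i) /andP[h1 h2].
  by have := lt_trans h1 h2; rewrite ltNge ba.
pose y (x : 'rV[R]_n) := (b i - a i)^-1 * (2 * x 0 i + - (a i + b i)).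
have ba0 : b i - a i != 0 by rewrite subr_eq0 gt_eqF.
have Cy : C1 y.
  apply: C1M; first exact: C1_cst.
  apply: C1D; last exact: C1_cst.
  by apply: C1M; [exact: C1_cst|exact: C1_coord].
pose theta m (x : 'rV[R]_n) : R := 1 + (-1) * (y x ^+ 2) ^+ m.
have Ctheta m : C1 (theta m).
  apply: C1D; first exact: C1_cst.
  by apply: C1M; [exact: C1_cst|apply: C1X; exact: C1X].
have y1 x : obox a b x -> 0 <= y x ^+ 2 < 1.
  move=> /(_ i) /andP[ax xb]; rewrite sqr_ge0 /= -[ltRHS](expr1n _ 2).
  rewrite -[y x ^+ 2]real_normK ?num_real// ltr_sqr ?nnegrE ?normr_ge0//.
  rewrite /y normrM normfV ltr_pdivrMl ?normr_gt0// mulr1.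
  by rewrite (gtr0_norm (_ : 0 < b i - a i)) ?subr_gt0// ltr_norml; apply/andP; split; lra.
apply: (@leb_int_weight0 _ _ _ h theta) => //.
- move=> m; apply: measurable_fun_continuous_on; first exact: open_obox.
  by move=> x _; exact: (Ctheta m).1.
- move=> m x /y1 /andP[y0 /ltW y1']; rewrite /theta mulN1r.
  have p0 : 0 <= (y x ^+ 2) ^+ m by exact: exprn_ge0.
  have p1 : (y x ^+ 2) ^+ m <= 1 by exact: exprn_ile1.
  by rewrite ler_norml; apply/andP; split; lra.
- move=> x /y1 /andP[y0 y1'].
  rewrite /theta -[X in _ --> X]addr0 -[X in _ --> _ + X](mulr0 (-1)).
  apply: cvgD; first exact: cvg_cst.
  by apply: cvgM; [exact: cvg_cst|apply: cvg_expr; rewrite ger0_norm].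
- move=> m; apply: wh; first exact: Ctheta.
  move=> x xi; have -> : theta m x = 1 - (y x ^+ 2) ^+ m by rewrite /theta mulN1r.
  have -> : y x ^+ 2 = 1; last by rewrite expr1n subrr.
  by rewrite /y; case: xi => ->; field.
Qed.

End box_weights.

(** * Weak derivatives *)

Section weak_derivative.
Variables (R : realType) (n : nat) (Omega : set 'rV[R]_n).
Hypotheses (oO : open Omega) (bO : bounded_set Omega).
Implicit Types (f g h u v w : 'rV[R]_n -> R).
Local Notation Phi A := (@pt R n @^-1` A).

Lemma bounded_sub_obox A : bounded_set A -> exists M : R, A `<=` @obox R n (fun=> - M) (fun=> M).
Proof.
move=> [M [Mr HM]]; exists (M + 2) => x Ax i.
have xM : `|x| <= M + 1 by apply: HM Ax; rewrite ltrDl.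
have : `|x 0 i| <= M + 1.
  apply: le_trans xM; rewrite [in leRHS]/Num.norm/= mx_normrE.
  exact: (le_bigmax _ (fun ij : 'I_1 * 'I_n => `|x ij.1 ij.2|) (0, i)).
by rewrite ler_norml => /andP[? ?]; apply/andP; split; lra.
Qed.

Lemma measurable_Phi_Omega : measurable (Phi Omega).
Proof. exact: measurable_pt_open. Qed.

Lemma leb_Omega_lty : (leb (Phi Omega) < +oo)%E.
Proof.
have [M OM] := bounded_sub_obox bO.
apply: le_lt_trans (leb_obox_lty (fun=> - M) (fun=> M)).
by apply: le_measure; rewrite ?inE; [exact: measurable_Phi_Omega|exact: measurable_Phi_obox|move=> t /OM].
Qed.

Definition has_weak_partial i f g := [/\ L2 Omega f, L2 Omega g &
  exists zeta : nat -> 'rV[R]_n -> R, [/\ forall k, test_function Omega (zeta k),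
    L2_cvg Omega zeta f & L2_cvg Omega (fun k => partial i (zeta k)) g]].

Lemma H10_has_weak_partial f : H10 Omega f -> forall i, exists g, has_weak_partial i f g.
Proof.
by move=> [Lf [g Lg [z [tz zf zg]]]] i; exists (g i); split => //; exists z; split.
Qed.

Lemma test_C1 f : test_function Omega f -> C1 f.
Proof. by move=> [/smooth_C1]. Qed.

Lemma test_bmeas f : test_function Omega f -> bmeas Omega f.
Proof.
by move=> /test_C1[cf _]; apply: bmeas_C1 => //; exact: measurable_Phi_Omega.
Qed.

Lemma test_partial_bmeas i f : test_function Omega f -> bmeas Omega (partial i f).
Proof.
by move=> /test_C1[_ /(_ i)[_ cf]]; apply: bmeas_C1 => //; exact: measurable_Phi_Omega.
Qed.

(** The compact set [C] is closed, so [F] is locally zero outside it and the partial derivative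
    vanishes there too. The integral over Omega is thus an integral over a large open box, whose
    bounding hyperplanes do not meet [C]. *)
Lemma test_partial_int0 i F : C1 F ->
  (exists C : set 'rV[R]_n, [/\ compact C, C `<=` Omega & forall x, ~ C x -> F x = 0]) ->
  leb_int Omega (partial i F) = 0.
Proof.
move=> CF [C [cC CO F0]]; have [M OM] := bounded_sub_obox bO.
have hs : hausdorff_space 'rV[R]_n := @norm_hausdorff _ _.
have clC : closed C := compact_closed hs cC.
have pF0 x : ~ C x -> partial i F x = 0.
  move=> nCx; rewrite /partial (@near_eq_derive _ _ _ _ (cst 0)) ?derive_cst//.
  have : nbhs x (~` C) by apply: open_nbhs_nbhs; split => //; rewrite openC.
  by apply: filterS => z; exact: F0.
rewrite -(leb_int_indic _ OM) -(@leb_int_box_partial R n i (fun=> - M) (fun=> M) F CF).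
  apply: eq_leb_int => x _; rewrite indicE.
  have [Ox|nOx] := pselect (Omega x); first by rewrite mem_set// mulr1.
  by rewrite pF0 ?mul0r// => /CO.
move=> x xi; apply: F0 => /CO /OM /(_ i) /andP[].
by case: xi => ->; rewrite ltxx.
Qed.

(** An identity that is linear in a test function and its partial derivative, with L^2 coefficients,
    is stable under the L^2 limits that define the weak derivative. *)
Lemma weak_limit i f g a b : has_weak_partial i f g -> L2 Omega a -> L2 Omega b ->
  (forall zeta, test_function Omega zeta ->
    leb_int Omega (fun x => partial i zeta x * a x) + leb_int Omega (fun x => zeta x * b x) = 0) ->
  leb_int Omega (fun x => g x * a x) + leb_int Omega (fun x => f x * b x) = 0.
Proof.
move=> [Lf Lg [zeta [tz zf zg]]] La Lb tst; have mO := measurable_Phi_Omega.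
have h1 := L2_cvg_leb_int mO (fun k => bmeas_L2 mO leb_Omega_lty (test_partial_bmeas i (tz k))) Lg La zg.
have h2 := L2_cvg_leb_int mO (fun k => bmeas_L2 mO leb_Omega_lty (test_bmeas (tz k))) Lf Lb zf.
pose s k := leb_int Omega (fun x => partial i (zeta k) x * a x) +
  leb_int Omega (fun x => zeta k x * b x).
have sE : s = cst 0 by apply/funext => k; exact: tst.
have : s @ \oo --> leb_int Omega (fun x => g x * a x) + leb_int Omega (fun x => f x * b x).
  exact: (cvgD h1 h2).
by rewrite sE => /(cvg_unique (@norm_hausdorff _ R^o) (cvg_cst 0)) <-.
Qed.

(* Test functions are substituted for [u], [w], [v] by limits in one factor at
   a time; boundedness of [v] and [w] keeps the products in L2. *)
Lemma weak_product_rule i u gu v gv w gw :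
  has_weak_partial i u gu -> has_weak_partial i v gv -> has_weak_partial i w gw ->
  bmeas Omega v -> bmeas Omega w ->
  leb_int Omega (fun x => gu x * (w x * v x)) +
  leb_int Omega (fun x => u x * (gw x * v x + w x * gv x)) = 0.
Proof.
move=> Wu Wv Ww Bv Bw; have mO := measurable_Phi_Omega; have Ofin := leb_Omega_lty.
have [_ Lgv _] := Wv; have [_ Lgw _] := Ww.
have BL f : bmeas Omega f -> L2 Omega f by exact: bmeas_L2.
have BI f : bmeas Omega f -> integr Omega f by exact: bmeas_integr.
have W1 eta zeta : test_function Omega eta -> test_function Omega zeta ->
    leb_int Omega (fun x => gv x * (eta x * zeta x)) +
    leb_int Omega (fun x => v x * (partial i eta x * zeta x + eta x * partial i zeta x)) = 0.
  move=> te tz; have Be := test_bmeas te; have Bz := test_bmeas tz.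
  have Bpe := test_partial_bmeas i te; have Bpz := test_partial_bmeas i tz.
  have Ce := test_C1 te; have Cz := test_C1 tz.
  apply: (weak_limit Wv).
  - by apply: BL; exact: bmeasM.
  - by apply: BL; apply: bmeasD; exact: bmeasM.
  move=> xi tx; have Bx := test_bmeas tx; have Bpx := test_partial_bmeas i tx.
  rewrite -leb_intD//; first last.
  - by apply: BI; apply: bmeasM => //; apply: bmeasD; exact: bmeasM.
  - by apply: BI; apply: bmeasM => //; exact: bmeasM.
  rewrite -[RHS](@test_partial_int0 i (fun x => xi x * (eta x * zeta x))).
  - apply: eq_leb_int => x _; rewrite partialM ?partialM//; first by ring.
      exact: test_C1.
    exact: C1M.
  - by apply: C1M; [exact: test_C1|exact: C1M].
  - have [_ [C [cC CO C0]]] := tx; exists C; split => // x /C0 ->; exact: mul0r.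
have W2 eta : test_function Omega eta ->
    leb_int Omega (fun x => gw x * (eta x * v x)) +
    leb_int Omega (fun x => w x * (eta x * gv x + partial i eta x * v x)) = 0.
  move=> te; have Be := test_bmeas te; have Bpe := test_partial_bmeas i te.
  have Lb : L2 Omega (fun x => eta x * gv x + partial i eta x * v x).
    by apply: L2D => //; [exact: bmeasM_L2|apply: BL; exact: bmeasM].
  apply: (weak_limit Ww) => //; first by apply: BL; exact: bmeasM.
  move=> zeta tz; have Bz := test_bmeas tz; have Bpz := test_partial_bmeas i tz.
  rewrite -(W1 _ _ te tz) -!leb_intD//.
  - by apply: eq_leb_int => x _; ring.
  - apply: L2_integrM => //; apply: BL; exact: bmeasM.
  - by apply: BI; apply: bmeasM => //; apply: bmeasD; exact: bmeasM.
  - by apply: BI; apply: bmeasM => //; exact: bmeasM.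
  - by apply: L2_integrM => //; exact: BL.
apply: (weak_limit Wu) => //.
- by apply: BL; exact: bmeasM.
- apply: L2D => //; last exact: bmeasM_L2.
  by under eq_fun do rewrite mulrC; exact: bmeasM_L2.
move=> eta te; have Be := test_bmeas te; have Bpe := test_partial_bmeas i te.
rewrite -(W2 _ te) -!leb_intD//.
- by apply: eq_leb_int => x _; ring.
- by apply: L2_integrM => //; apply: BL; exact: bmeasM.
- apply: L2_integrM => //; first exact: BL.
  by apply: L2D => //; [exact: bmeasM_L2|apply: BL; exact: bmeasM].
- by apply: BI; apply: bmeasM => //; exact: bmeasM.
- apply: L2_integrM => //; first exact: BL.
  apply: L2D => //; last exact: bmeasM_L2.
  by under eq_fun do rewrite mulrC; exact: bmeasM_L2.
Qed.

End weak_derivative.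

(** * Finite element functions *)

Section partition.
Variables (R : realType) (n N : nat) (Omega : set 'rV[R]_n) (K : 'I_N -> set 'rV[R]_n).
Hypotheses (oO : open Omega) (bO : bounded_set Omega) (hK : fe_partition Omega K).
Implicit Types (f g h u v w : 'rV[R]_n -> R).
Local Notation Phi A := (@pt R n @^-1` A).

(** For every product [r] of [q] with a weight vanishing on the hyperplanes, [g] and the partial
    derivative of [P] have the same integral against [r], namely minus the integral of [P] times the
    partial derivative of [r]. For [g] this comes from the approximating test functions, integrated
    by parts on the box itself. *)
Lemma weak_box_identify i f g P q a b : has_weak_partial Omega i f g ->
  obox a b `<=` Omega -> C1 P -> C1 q -> (forall x, obox a b x -> f x = P x) ->
  leb_int (obox a b) (fun x => g x * q x) =
  leb_int (obox a b) (fun x => partial i P x * q x).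
Proof.
move=> [Lf Lg [zeta [tz zf zg]]] abO CP Cq fP.
have mO := measurable_Phi_Omega oO; have mab := @measurable_Phi_obox R n a b.
have abfin := @leb_obox_lty R n a b.
have bab := @bounded_obox R n a b.
have Bc r : continuous r -> bmeas (obox a b) r by exact: bmeas_C1.
have Lc r : continuous r -> L2 (obox a b) r by move=> /Bc; exact: bmeas_L2.
have Ic r : continuous r -> integr (obox a b) r by move=> /Bc; exact: bmeas_integr.
have pc (r : 'rV[R]_n -> R) : C1 r -> continuous (partial i r) by move=> [_ /(_ i)[]].
have cc (r : 'rV[R]_n -> R) : C1 r -> continuous r by case.
have zC k : C1 (zeta k) := test_C1 (tz k).
have Lfab : L2 (obox a b) f := L2S mO mab abO Lf.
have Lgab : L2 (obox a b) g := L2S mO mab abO Lg.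
have Igq : integr (obox a b) (fun x => g x * q x).
  by apply: L2_integrM => //; apply: Lc; exact: cc.
have IPq : integr (obox a b) (fun x => partial i P x * q x).
  by apply: L2_integrM => //; apply: Lc; [exact: pc|exact: cc].
apply/eqP; rewrite -subr_eq0 -leb_intB//; apply/eqP.
apply: (@leb_int_box_weights _ _ i); first exact: integrB.
(* [r] inherits from [theta] the vanishing on both hyperplanes, so no boundary term appears. *)
move=> theta Ct t0; pose r x := q x * theta x.
have Cr : C1 r by exact: C1M.
have ibp F : C1 F -> leb_int (obox a b) (fun x => partial i F x * r x) +
    leb_int (obox a b) (fun x => F x * partial i r x) = 0.
  move=> CF; rewrite -leb_intD//; first last.
  - by apply: L2_integrM => //; apply: Lc; [exact: cc|exact: pc].
  - by apply: L2_integrM => //; apply: Lc; [exact: pc|exact: cc].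
  rewrite -[RHS](@leb_int_box_partial R n i a b (fun x => F x * r x)).
  - by apply: eq_leb_int => x _; rewrite partialM//; ring.
  - exact: C1M.
  - by move=> x /t0 tx; rewrite /r tx !mulr0.
have gr : leb_int (obox a b) (fun x => g x * r x) +
    leb_int (obox a b) (fun x => P x * partial i r x) = 0.
  have zf' : L2_cvg (obox a b) zeta f.
    apply: L2_cvgS zf => //; last exact: Lf.1.
    by move=> k; exact: (test_bmeas oO bO (tz k)).1.
  have zg' : L2_cvg (obox a b) (fun k => partial i (zeta k)) g.
    apply: L2_cvgS zg => //; last exact: Lg.1.
    by move=> k; exact: (test_partial_bmeas oO bO i (tz k)).1.
  have h1 := L2_cvg_leb_int mab (fun k => Lc _ (pc _ (zC k))) Lgab (Lc _ (cc _ Cr)) zg'.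
  have h2 := L2_cvg_leb_int mab (fun k => Lc _ (cc _ (zC k))) Lfab (Lc _ (pc _ Cr)) zf'.
  (* On the box [P] is [f], which is the limit that the approximating sequence provides. *)
  have -> : leb_int (obox a b) (fun x => P x * partial i r x) =
      leb_int (obox a b) (fun x => f x * partial i r x).
    by apply: eq_leb_int => x abx; rewrite fP.
  pose s k := leb_int (obox a b) (fun x => partial i (zeta k) x * r x) +
    leb_int (obox a b) (fun x => zeta k x * partial i r x).
  have sE : s = cst 0 by apply/funext => k; exact: ibp.
  have : s @ \oo --> leb_int (obox a b) (fun x => g x * r x) +
      leb_int (obox a b) (fun x => f x * partial i r x).
    exact: (cvgD h1 h2).
  by rewrite sE => /(cvg_unique (@norm_hausdorff _ R^o) (cvg_cst 0)) <-.
have := ibp _ CP; move: gr.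
have -> : (fun x => (g x * q x - partial i P x * q x) * theta x) =
    (fun x => g x * r x - partial i P x * r x) by apply/funext => x; rewrite /r; ring.
rewrite leb_intB//; first lra.
- by apply: L2_integrM => //; apply: Lc; exact: cc.
- by apply: L2_integrM => //; apply: Lc; [exact: pc|exact: cc].
Qed.

Definition piece j : set 'rV[R]_n := Omega `&` interior (K j).

(* Only interiors are kept: nothing prevents [K j] from having stray points
   inside another element. *)
Definition pieces : set 'rV[R]_n := \bigcup_j piece j.

Lemma open_piece j : open (piece j).
Proof. by apply: openI => //; exact: open_interior. Qed.

Lemma piece_sub j : piece j `<=` K j.
Proof. by move=> x [_ /interior_subset]. Qed.

Lemma open_pieces : open pieces.
Proof. by apply: bigcup_open => j _; exact: open_piece. Qed.

Lemma pieces_sub : pieces `<=` Omega.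
Proof. by move=> x [j _ []]. Qed.

Lemma measurable_Phi_pieces : measurable (Phi pieces).
Proof. by apply: measurable_pt_open; exact: open_pieces. Qed.

Lemma leb_pieces_lty : (leb (Phi pieces) < +oo)%E.
Proof.
apply: le_lt_trans (leb_Omega_lty oO bO); apply: le_measure; rewrite ?inE.
- exact: measurable_Phi_pieces.
- exact: measurable_Phi_Omega.
- by move=> t; exact: pieces_sub.
Qed.

(** The elements cover the closure of Omega, so a point of Omega in no interior lies in some [K j]
    minus its interior; these are finitely many null sets. *)
Lemma pieces_null : measurable (Phi (Omega `\` pieces)) /\ Defs.null_set (Omega `\` pieces).
Proof.
have mD : measurable (Phi (Omega `\` pieces)).
  rewrite (_ : Phi _ = Phi Omega `\` Phi pieces)//.
  by apply: measurableD; [exact: measurable_Phi_Omega|exact: measurable_Phi_pieces].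
split => //; have [Kj clO _] := hK.
pose S : set 'rV[R]_n := \big[setU/set0]_(j < N) (K j `\` interior (K j)).
have [mS S0] : measurable (Phi S) /\ leb (Phi S) = 0%E.
  apply: (big_ind (fun A : set 'rV[R]_n => measurable (Phi A) /\ leb (Phi A) = 0%E)).
  - by rewrite preimage_set0.
  - move=> A B [mA A0] [mB B0]; split; first exact: measurableU.
    by rewrite preimage_setU null_set_setU.
  - move=> j _; have [cK _ _ K0] := Kj j; split => //.
    rewrite (_ : Phi _ = Phi (K j) `\` Phi (interior (K j)))//.
    apply: measurableD; first exact: measurable_pt_compact.
    by apply: measurable_pt_open; exact: open_interior.
have DS : Omega `\` pieces `<=` S.
  move=> x [Ox npx]; have : closure Omega x by exact: subset_closure.
  rewrite clO => -[j _ Kjx]; rewrite /S -bigcup_seq; exists j => /=.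
    by rewrite mem_index_enum.
  by split => // Kix; apply: npx; exists j.
apply/eqP; rewrite -measure_le0 -S0; apply: le_measure; rewrite ?inE//.
by move=> t; exact: DS.
Qed.

(** No regularity of [h] is asked, since a measurable null set can be removed from the integral of
    any function. This gives access to integrands with pointwise derivatives, which are controlled
    in the element interiors only. *)
Lemma leb_int_pieces h : leb_int Omega h = leb_int pieces h.
Proof.
have [mZ Z0] := pieces_null; rewrite (leb_int_setD_null _ _ mZ Z0).
by rewrite setDD setIidr//; exact: pieces_sub.
Qed.

Lemma sum_piece (F : 'I_N -> R) j x : piece j x -> \sum_k F k * \1_(piece k) x = F j.
Proof.
move=> pjx; rewrite (bigD1 j)//= indicE mem_set// mulr1 big1 ?addr0// => k kj.
rewrite indicE memNset ?mulr0// => pkx; have [_ _ /(_ k j kj) kj0] := hK.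
have : (interior (K k) `&` interior (K j)) x by split; [case: pkx|case: pjx].
by rewrite kj0.
Qed.

Lemma bmeas_indic_piece j : bmeas pieces (\1_(piece j) : 'rV[R]_n -> R).
Proof.
split; last by exists 1 => x _; rewrite indicE normr_nat; case: (_ \in _); rewrite ?ler01.
apply: (@measurable_funS _ _ _ _ setT) => //.
rewrite (_ : _ \o _ = \1_(Phi (piece j))).
  by apply: measurable_indic; apply: measurable_pt_open; exact: open_piece.
by apply/funext => t; rewrite /= !indicE; congr (_%:R); apply/idP/idP; rewrite !inE.
Qed.

Lemma leb_int_piece0 h : integr pieces h ->
  (forall j, leb_int (piece j) h = 0) -> leb_int pieces h = 0.
Proof.
move=> ihD h0; have mD := measurable_Phi_pieces.
rewrite (@eq_leb_int _ _ _ _ (fun x => \sum_j h x * \1_(piece j) x)); last first.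
  by move=> x [j _ pjx]; rewrite (sum_piece (fun=> h x) pjx).
rewrite leb_int_sum//.
  by rewrite big1// => j _; rewrite leb_int_indic// => x pjx; exists j.
move=> j; have [m1 _] := bmeas_indic_piece j.
apply: (@integr_le _ _ _ _ (fun x => `|h x|)) => //; last 2 first.
  by have := integrable_abse ihD.
  move=> x _; rewrite normrM ler_piMr// indicE normr_nat.
  by case: (_ \in _); rewrite ?ler01.
exact: (measurable_funM (integrable_measurable ihD) m1).
Qed.

Definition P_rep k (c : 'I_N -> {ffun 'I_n -> 'I_k.+1} -> R) j : 'rV[R]_n -> R :=
  fun x => \sum_(a : {ffun 'I_n -> 'I_k.+1} | (\sum_i a i <= k)%N)
    c j a * \prod_i x 0 i ^+ a i.

Lemma P_repP k f : (forall j, P_ k (K j) f) ->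
  exists c, forall j x, K j x -> f x = @P_rep k c j x.
Proof. by move=> /choice[c cf]; exists c. Qed.

Lemma partial_piece i j f P x : piece j x -> (forall x, K j x -> f x = P x) ->
  partial i f x = partial i P x.
Proof.
move=> pjx fP; apply: near_eq_derive.
have : nbhs x (piece j) by apply: open_nbhs_nbhs; split => //; exact: open_piece.
by apply: filterS => y /piece_sub; exact: fP.
Qed.

(** In the element interiors the pointwise derivative is a finite sum of derivatives of polynomials
    multiplied by indicators. *)
Lemma bmeas_partial k f i : (forall j, P_ k (K j) f) -> bmeas pieces (partial i f).
Proof.
move=> /P_repP[c fc].
apply: (@eq_bmeas _ _ _ (fun x => \sum_j partial i (P_rep c j) x * \1_(piece j) x)).
  move=> x [j _ pjx]; rewrite (sum_piece (fun j => partial i (P_rep c j) x) pjx).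
  by rewrite (partial_piece i pjx (fc j)).
apply: bmeas_sum => j; apply: bmeasM; last exact: bmeas_indic_piece.
have [_ /(_ i)[_ cP]] : C1 (P_rep c j) by exact: C1_poly.
apply: bmeas_C1 => //; last exact: measurable_Phi_pieces.
by case: bO => M [Mr HM]; exists M; split => // M' /HM h x /pieces_sub; exact: h.
Qed.

(** The two derivatives are compared through their integrals against an elementwise C^1 weight
    [psi], which is the form in which they enter the trilinear identity. The difference is
    integrable on each piece and has zero integral on every box inside it, hence on the piece. *)
Lemma weak_partial_identify k i f g psi :
  (forall j, P_ k (K j) f) -> has_weak_partial Omega i f g ->
  bmeas Omega psi -> (forall j, exists2 q, C1 q & forall x, K j x -> psi x = q x) ->
  leb_int Omega (fun x => g x * psi x) = leb_int Omega (fun x => partial i f x * psi x).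
Proof.
move=> Pf Wf Bpsi Cpsi; have [c fc] := P_repP Pf.
have mO := measurable_Phi_Omega oO; have mD := measurable_Phi_pieces.
have Ofin := leb_Omega_lty oO bO; have [_ Lg _] := Wf.
have Bp := bmeas_partial i Pf.
have Bpsi' : bmeas pieces psi := bmeasS mO mD pieces_sub Bpsi.
rewrite !leb_int_pieces; apply/eqP; rewrite -subr_eq0.
have Ig : integr pieces (fun x => g x * psi x).
  apply: L2_integrM => //; first exact: (L2S mO mD pieces_sub Lg).
  by apply: bmeas_L2 => //; exact: leb_pieces_lty.
have Ip : integr pieces (fun x => partial i f x * psi x).
  by apply: bmeas_integr => //; [exact: leb_pieces_lty|exact: bmeasM].
rewrite -leb_intB//; apply/eqP; apply: leb_int_piece0; first exact: integrB.
move=> j; have mj := measurable_pt_open (@open_piece j).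
have jD : piece j `<=` pieces by move=> x jx; exists j.
have [q Cq psiq] := Cpsi j.
apply: leb_int_open0; first exact: open_piece.
  by apply: (integrS mD mj jD); exact: integrB.
move=> a b abj; have mab := @measurable_Phi_obox R n a b.
have abD : obox a b `<=` pieces := subset_trans abj jD.
have abO : obox a b `<=` Omega := subset_trans abD pieces_sub.
have abK : obox a b `<=` K j := subset_trans abj (fun x => @piece_sub j x).
rewrite leb_intB//; [|exact: integrS Ig|exact: integrS Ip].
apply/eqP; rewrite subr_eq0; apply/eqP.
have CP : C1 (P_rep c j) by exact: C1_poly.
have := weak_box_identify Wf abO CP Cq (fun x abx => fc j x (abK x abx)).
rewrite (@eq_leb_int _ _ _ _ (fun x => g x * psi x)); last first.
  by move=> x /abK /psiq ->.
move=> ->; apply: eq_leb_int => x abx; rewrite (psiq _ (abK _ abx)).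
by rewrite (partial_piece i (abj _ abx) (fc j)).
Qed.

(** The weak form of the identity that the derivative of u v^2 integrates to zero: the weak product
    rule with [v] taken twice, then weak derivatives exchanged for pointwise ones. The weights
    [v * v] and [u * v] are polynomial on each element, as this exchange requires. *)
Lemma convection_trilinear0 k i u v : (forall j, P_ k (K j) u) -> (forall j, P_ k (K j) v) ->
  C0 Omega u -> C0 Omega v -> H10 Omega u -> H10 Omega v ->
  leb_int Omega (fun x => partial i u x * v x * v x + 2 * (u x * partial i v x * v x)) = 0.
Proof.
move=> Pu Pv Cu Cv Hu Hv.
have [gu Wu] := H10_has_weak_partial Hu i; have [gv Wv] := H10_has_weak_partial Hv i.
have mO := measurable_Phi_Omega oO; have mD := measurable_Phi_pieces.
have Ofin := leb_Omega_lty oO bO.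
have BC f : C0 Omega f -> bmeas Omega f.
  move=> Cf; split; first exact: measurable_fun_C0.
  by have [M HM] := C0_bounded bO Cf; exists M => x Ox; apply: HM; exact: subset_closure.
have Bu := BC _ Cu; have Bv := BC _ Cv.
have BuD := bmeasS mO mD pieces_sub Bu; have BvD := bmeasS mO mD pieces_sub Bv.
have Bpu := bmeas_partial i Pu; have Bpv := bmeas_partial i Pv.
have [cu fu] := P_repP Pu; have [cv fv] := P_repP Pv.
have CPu j : C1 (P_rep cu j) by exact: C1_poly.
have CPv j : C1 (P_rep cv j) by exact: C1_poly.
have E1 : leb_int Omega (fun x => gu x * (v x * v x)) =
    leb_int Omega (fun x => partial i u x * (v x * v x)).
  apply: (weak_partial_identify Pu Wu (bmeasM Bv Bv)) => j.
  exists (fun x => P_rep cv j x * P_rep cv j x); first exact: C1M.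
  by move=> x Kx; rewrite (fv j x Kx).
have E2 : leb_int Omega (fun x => gv x * (u x * v x)) =
    leb_int Omega (fun x => partial i v x * (u x * v x)).
  apply: (weak_partial_identify Pv Wv (bmeasM Bu Bv)) => j.
  exists (fun x => P_rep cu j x * P_rep cv j x); first exact: C1M.
  by move=> x Kx; rewrite (fv j x Kx) (fu j x Kx).
have := weak_product_rule oO bO Wu Wv Wv Bv Bv; rewrite E1.
have -> : (fun x => u x * (gv x * v x + v x * gv x)) = (fun x => 2 * (gv x * (u x * v x))).
  by apply/funext => x; ring.
have Lgv : L2 Omega gv by case: Wv.
rewrite leb_intZ//; last first.
  by apply: L2_integrM => //; apply: bmeas_L2 => //; exact: bmeasM.
have IB h : bmeas pieces h -> integr pieces h.
  by apply: bmeas_integr => //; exact: leb_pieces_lty.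
rewrite E2 !leb_int_pieces -leb_intZ//; last by apply: IB; apply: bmeasM => //; exact: bmeasM.
rewrite -leb_intD//.
- by move=> <-; apply: eq_leb_int => x _; ring.
- by apply: IB; apply: bmeasM => //; exact: bmeasM.
- by apply: integrZ => //; apply: IB; apply: bmeasM => //; exact: bmeasM.
Qed.

End partition.

(** * Integrals over Omega computed in the element interiors *)

Section finite_element.
Variables (R : realType) (d N : nat) (Omega : set 'rV[R]_d) (K : 'I_N -> set 'rV[R]_d).
Hypotheses (oO : open Omega) (bO : bounded_set Omega) (hK : fe_partition Omega K).
Implicit Types (f g h : 'rV[R]_d -> R) (u v : 'rV[R]_d -> 'rV[R]_d).
Local Notation Phi A := (@pt R d @^-1` A).
Local Notation D := (pieces Omega K).

Lemma leb_int_ae f g : ae_on Omega (fun x => f x = g x) -> leb_int Omega f = leb_int Omega g.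
Proof.
move=> [Z [mZ Z0] fg]; rewrite (leb_int_setD_null _ _ mZ Z0) [RHS](leb_int_setD_null _ _ mZ Z0).
by apply: eq_leb_int => x []; exact: fg.
Qed.

Lemma eq_leb_int_pieces f g : (forall x, D x -> f x = g x) -> leb_int Omega f = leb_int Omega g.
Proof. by move=> fg; rewrite !(leb_int_pieces oO hK); exact: eq_leb_int. Qed.

Lemma le_leb_int A f g : measurable (Phi A) -> integr A f -> integr A g ->
  (forall x, A x -> f x <= g x) -> leb_int A f <= leb_int A g.
Proof. by move=> mA If Ig fg; rewrite !leb_intE; apply: le_Rintegral => // t; exact: fg. Qed.

Let mD := measurable_Phi_pieces K oO.
Let Doo := leb_pieces_lty K oO bO.

Lemma bmeas_pieces_integr f : bmeas D f -> integr D f.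
Proof. exact: bmeas_integr. Qed.

Lemma add_leb_int f g : bmeas D f -> bmeas D g ->
  leb_int Omega f + leb_int Omega g = leb_int Omega (fun x => f x + g x).
Proof.
move=> Bf Bg; rewrite !(leb_int_pieces oO hK) leb_intD//; exact: bmeas_pieces_integr.
Qed.

Lemma sub_leb_int f g : bmeas D f -> bmeas D g ->
  leb_int Omega f - leb_int Omega g = leb_int Omega (fun x => f x - g x).
Proof.
move=> Bf Bg; rewrite !(leb_int_pieces oO hK) leb_intB//; exact: bmeas_pieces_integr.
Qed.

Lemma scale_leb_int k f : bmeas D f -> k * leb_int Omega f = leb_int Omega (fun x => k * f x).
Proof.
move=> Bf; rewrite !(leb_int_pieces oO hK) leb_intZ//; exact: bmeas_pieces_integr.
Qed.

Lemma leb_int_pieces_ge0 f : (forall x, D x -> 0 <= f x) -> 0 <= leb_int Omega f.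
Proof. by move=> f0; rewrite (leb_int_pieces oO hK); exact: leb_int_ge0. Qed.

Lemma leb_int_pieces_eq0 f : (forall x, D x -> f x = 0) -> leb_int Omega f = 0.
Proof. by move=> f0; rewrite (eq_leb_int_pieces f0) leb_int0. Qed.

(** Linearity of the integrand is asked only in the element interiors, because pointwise partial
    derivatives are additive only where the functions are differentiable. *)
Lemma linear_on_int (E : lmodType R) (S : set E) (h : E -> 'rV[R]_d -> R) :
  linear_subspace S -> (forall x, S x -> bmeas D (h x)) ->
  (forall a x y, S x -> S y -> forall t, D t -> h (a *: x + y) t = a * h x t + h y t) ->
  linear_on S (fun x => leb_int Omega (h x)).
Proof.
move=> [_ Ssub] Sh hl a x y Sx Sy; have Bx := Sh _ Sx; have By := Sh _ Sy.
by rewrite scale_leb_int// add_leb_int//; [apply: eq_leb_int_pieces => t; exact: hl|exact: bmeasZ].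
Qed.

Lemma C0_bmeas f : C0 Omega f -> bmeas Omega f.
Proof.
move=> Cf; split; first exact: measurable_fun_C0.
by have [M HM] := C0_bounded bO Cf; exists M => x Ox; apply: HM; exact: subset_closure.
Qed.

Lemma C0_bmeas_pieces f : C0 Omega f -> bmeas D f.
Proof.
by move=> /C0_bmeas; apply: bmeasS => //; [exact: measurable_Phi_Omega|exact: pieces_sub].
Qed.

(** If [f x] were nonzero at a point of Omega, then [|f|] would be at least half of [|f x|] on a
    small box around [x], which has positive measure, and the integral of the square would be
    positive. *)
Lemma eq_C0_sqr0 f : C0 Omega f -> leb_int Omega (fun x => f x ^+ 2) = 0 ->
  forall x, closure Omega x -> f x = 0.
Proof.
move=> Cf f0; have mO := measurable_Phi_Omega oO; have Ooo := leb_Omega_lty oO bO.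
have Bf := C0_bmeas Cf.
have fO x : Omega x -> f x = 0.
  move=> Ox; apply/eqP/negPn/negP => fx0.
  have cfx : {for x, continuous f}.
    have /continuous_subspaceW/(_ Cf) : Omega `<=` closure Omega by exact: subset_closure.
    by rewrite continuous_open_subspace// => /(_ x); apply; rewrite inE.
  have e0 : 0 < `|f x| / 2 by rewrite divr_gt0 ?normr_gt0.
  pose G := Omega `&` [set y | `|f x - f y| < `|f x| / 2].
  have Gx : nbhs x G.
    apply: filterI; first exact: open_nbhs_nbhs.
    by move/cvgrPdist_lt: cfx => /(_ _ e0).
  have [e e1 eG] : exists2 e : R, 0 < e & forall y : 'rV[R]_d, (forall i, `|x 0 i - y 0 i| < e) -> G y.
    have [e e1 eG] := open_rV_ball (open_interior G) Gx.
    by exists e => // y /eG /interior_subset.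
  pose a i := x 0 i - e; pose b i := x 0 i + e.
  have abG : obox a b `<=` G.
    move=> y aby; apply: eG => i; have /andP[h1 h2] := aby i.
    by rewrite ltr_norml; apply/andP; split; rewrite /a /b in h1 h2; lra.
  have abO : obox a b `<=` Omega by move=> y /abG[].
  have leb_pos : 0 < fine (leb (Phi (obox a b))).
    rewrite fine_gt0//; apply/andP; split; last exact: leb_obox_lty.
    by rewrite pt_obox; apply: leb_tbox_gt0 => i; rewrite /a /b; lra.
  have mab := @measurable_Phi_obox R d a b.
  have : leb_int (obox a b) (fun=> (`|f x| / 2) ^+ 2) <= leb_int (obox a b) (fun y => f y ^+ 2).
    apply: le_leb_int => //.
    - apply: bmeas_integr => //; [exact: leb_obox_lty|exact: bmeas_cst].
    - apply: bmeas_integr => //; first exact: leb_obox_lty.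
      by apply: (bmeasS mO mab abO); under eq_fun do rewrite expr2; exact: bmeasM.
    - move=> y aby; rewrite -[leRHS]real_normK ?num_real// ler_sqr ?nnegrE ?normr_ge0 ?(ltW e0)//.
      have [_ /= fy] := abG _ aby.
      have := ler_normD (f x - f y) (f y); rewrite subrK; lra.
  have : leb_int (obox a b) (fun y => f y ^+ 2) <= leb_int Omega (fun y => f y ^+ 2).
    rewrite -(leb_int_indic _ abO); apply: le_leb_int => //.
    - apply: bmeas_integr => //; apply: bmeasM; first by under eq_fun do rewrite expr2; exact: bmeasM.
      split; last by exists 1 => y _; rewrite indicE normr_nat; case: (_ \in _); rewrite ?ler01.
      apply: (@measurable_funS _ _ _ _ setT) => //.
      rewrite (_ : _ \o _ = \1_(Phi (obox a b))); first exact: measurable_indic.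
      by apply/funext => t; rewrite /= !indicE; congr (_%:R); apply/idP/idP; rewrite !inE.
    - by apply: bmeas_integr => //; under eq_fun do rewrite expr2; exact: bmeasM.
    - move=> t _; rewrite ler_piMr ?sqr_ge0// indicE; by case: (_ \in _).
  rewrite f0 => h1 h2; have := le_trans h2 h1; apply/negP; rewrite -ltNge.
  by rewrite leb_intE Rintegral_cst// mulr_gt0 ?exprn_gt0.
(* Points of the closure: a nonzero value would persist at nearby points of Omega, where [f] is
   already known to vanish. *)
move=> x clx; apply/eqP/negPn/negP => fx0.
have /cvgrPdist_lt/(_ `|f x|) := Cf x; rewrite normr_gt0 => /(_ fx0).
move=> h; have nx : nbhs x [set y | closure Omega y -> `|f x - f y| < `|f x|].
  have {}h : nbhs (x : subspace (closure Omega)) [set y | `|f x - f y| < `|f x|] by exact: h.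
  by move: h; rewrite /nbhs/= -nbhs_subspace_in.
have [y [Oy /(_ (subset_closure Oy))]] := clx _ nx.
by rewrite (fO _ Oy) subr0 ltxx.
Qed.

End finite_element.

(** * The finite element spaces as finite-dimensional subspaces *)

Section function_spaces.
Variables (R : realType) (d N : nat) (Omega : set 'rV[R]_d) (K : 'I_N -> set 'rV[R]_d).
Hypotheses (oO : open Omega) (bO : bounded_set Omega) (hK : fe_partition Omega K).
Implicit Types (f g h : 'rV[R]_d -> R) (u v : 'rV[R]_d -> 'rV[R]_d) (a : R).
Local Notation Phi A := (@pt R d @^-1` A).

Let mO := measurable_Phi_Omega oO.

Lemma C0_lin a f g : C0 Omega f -> C0 Omega g -> C0 Omega (a *: f + g).
Proof.
move=> Cf Cg x; apply: (@cvgD _ R^o); last exact: Cg.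
by apply: (@cvgZr _ R^o); exact: Cf.
Qed.

Lemma C0_0 : C0 Omega 0.
Proof. by move=> x; exact: cvg_cst. Qed.

Lemma P_lin k (A : set 'rV[R]_d) a f g : P_ k A f -> P_ k A g -> P_ k A (a *: f + g).
Proof.
move=> [c fc] [c' gc']; exists (fun al => a * c al + c' al) => x Ax.
rewrite -[LHS]/(a * f x + g x) fc// gc'// mulr_sumr -big_split.
by apply: eq_bigr => al _; rewrite /= mulrDl mulrA.
Qed.

Lemma P_0 k (A : set 'rV[R]_d) : P_ k A 0.
Proof. by exists (fun=> 0) => x _; rewrite big1// => al _; rewrite mul0r. Qed.

Lemma derivable_lin a f g (x v : 'rV[R]_d) :
  derivable f x v -> derivable g x v -> derivable (a *: f + g) x v.
Proof. by move=> df dg; apply: (@derivableD _ _ _ (a *: f)) => //; exact: derivableZ. Qed.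

Lemma partial_lin i a f g x : derivable f x (delta_mx 0 i) -> derivable g x (delta_mx 0 i) ->
  partial i (a *: f + g) x = a * partial i f x + partial i g x.
Proof.
move=> df dg; rewrite /partial deriveD//; last exact: derivableZ.
by rewrite deriveZ.
Qed.

Lemma smooth_lin a f g : smooth f -> smooth g -> smooth (a *: f + g).
Proof.
move=> sf sg.
have fE s : foldr (@partial R d) (a *: f + g) s =
    a *: foldr (@partial R d) f s + foldr (@partial R d) g s.
  elim: s => [//|i s IH]; rewrite /= IH; apply/funext => x.
  by rewrite partial_lin//; [exact: (sf s).2|exact: (sg s).2].
move=> s; rewrite fE; split.
  by move=> x; exact: (cvgD (cvgZr ((sf s).1 x)) ((sg s).1 x)).
by move=> i x; apply: derivable_lin; [exact: (sf s).2|exact: (sg s).2].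
Qed.

Lemma smooth0 : smooth (0 : 'rV[R]_d -> R).
Proof.
have fE s : foldr (@partial R d) 0 s = 0.
  by elim: s => [//|i s IH]; rewrite /= IH; apply/funext => x; exact: derive_cst.
by move=> s; rewrite fE; split; [exact: cst_continuous|move=> i x; exact: derivable_cst].
Qed.

Lemma test_function_lin a f g : test_function Omega f -> test_function Omega g ->
  test_function Omega (a *: f + g).
Proof.
move=> [sf [C [cC CO f0]]] [sg [C' [cC' CO' g0]]]; split; first exact: smooth_lin.
exists (C `|` C'); split; first exact: compactU.
  by move=> x [/CO|/CO'].
move=> x nC; rewrite -[LHS]/(a * f x + g x) f0 ?g0 ?mulr0 ?addr0// => Cx; apply: nC;
  by [left|right].
Qed.

Lemma test_function0 : test_function Omega 0.
Proof. by split; [exact: smooth0|exists set0; split => //; exact: compact0]. Qed.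

Lemma L2_lin a f g : L2 Omega f -> L2 Omega g -> L2 Omega (a *: f + g).
Proof. by move=> Lf Lg; exact: (L2D mO (L2Z a mO Lf) Lg). Qed.

Lemma L2_0 : L2 Omega 0.
Proof. by apply: bmeas_L2 => //; [exact: leb_Omega_lty|exact: bmeas_cst]. Qed.

Lemma L2_cvg_lin a (f_ g_ : nat -> 'rV[R]_d -> R) f g :
  (forall k, measurable_fun (Phi Omega) (f_ k \o @pt R d)) ->
  (forall k, measurable_fun (Phi Omega) (g_ k \o @pt R d)) ->
  measurable_fun (Phi Omega) (f \o @pt R d) -> measurable_fun (Phi Omega) (g \o @pt R d) ->
  L2_cvg Omega f_ f -> L2_cvg Omega g_ g ->
  L2_cvg Omega (fun k => a *: f_ k + g_ k) (a *: f + g).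
Proof.
move=> mf_ mg_ mf mg cf cg.
have h0 : ((2 * a ^+ 2)%:E * leb_eint Omega (fun x => ((f_ k x - f x) ^+ 2)%:E) +
    2%:E * leb_eint Omega (fun x => ((g_ k x - g x) ^+ 2)%:E))%E @[k --> \oo] --> 0%E.
  rewrite -[X in _ --> X](adde0 0%E) -[X in _ --> (X + _)%E](mule0 (2 * a ^+ 2)%:E).
  rewrite -[X in _ --> (_ + X)%E](mule0 2%:E).
  by apply: cvgeD; [rewrite !mule0|exact: cvgeZl|exact: cvgeZl].
apply: (squeeze_cvge _ (cvg_cst 0%E) h0).
have mq (p_ : nat -> 'rV[R]_d -> R) (p : 'rV[R]_d -> R) k : (forall k, measurable_fun (Phi Omega) (p_ k \o @pt R d)) ->
    measurable_fun (Phi Omega) (p \o @pt R d) ->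
    measurable_fun (Phi Omega) (fun t => ((p_ k (pt t) - p (pt t)) ^+ 2)%:E).
  move=> mp_ mp; apply/measurable_EFinP; apply: measurable_funX.
  exact: (measurable_funB (mp_ k) mp).
apply: nearW => k; apply/andP; split; first by apply: integral_ge0 => t _; rewrite lee_fin sqr_ge0.
have a0 : 0 <= 2 * a ^+ 2 by rewrite mulr_ge0 ?sqr_ge0.
rewrite /leb_eint -!ge0_integralZl//; first last.
- by move=> t _; rewrite lee_fin sqr_ge0.
- exact: mq.
- by move=> t _; rewrite lee_fin sqr_ge0.
- exact: mq.
rewrite -ge0_integralD//; first last.
- by apply: measurable_funeM; exact: mq.
- by move=> t _; rewrite -EFinM lee_fin mulr_ge0// sqr_ge0.
- by apply: measurable_funeM; exact: mq.
- by move=> t _; rewrite -EFinM lee_fin mulr_ge0// sqr_ge0.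
apply: ge0_le_integral => //.
- by move=> t _; rewrite lee_fin sqr_ge0.
- apply: (mq (fun k => a *: f_ k + g_ k) (a *: f + g)) => [k'|].
    exact: (measurable_funD (measurable_funM (measurable_cst a) (mf_ k')) (mg_ k')).
  exact: (measurable_funD (measurable_funM (measurable_cst a) mf) mg).
- by apply: emeasurable_funD; apply: measurable_funeM; exact: mq.
move=> t _; rewrite -!EFinM -EFinD lee_fin.
rewrite -[(a *: f_ k + g_ k) (pt t)]/(a * f_ k (pt t) + g_ k (pt t)).
rewrite -[(a *: f + g) (pt t)]/(a * f (pt t) + g (pt t)).
(* With x and y the two errors, (a x + y)^2 <= 2 a^2 x^2 + 2 y^2 is the nonnegativity of (a x -
   y)^2. *)
by have := sqr_ge0 (a * (f_ k (pt t) - f (pt t)) - (g_ k (pt t) - g (pt t))); nra.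
Qed.

Lemma H10_lin a f g : H10 Omega f -> H10 Omega g -> H10 Omega (a *: f + g).
Proof.
move=> [Lf [df Ldf [zf [tzf zff zfd]]]] [Lg [dg Ldg [zg [tzg zgg zgd]]]].
split; first exact: L2_lin.
exists (fun i => a *: df i + dg i); first by move=> i; exact: L2_lin.
exists (fun k => a *: zf k + zg k); split.
- by move=> k; exact: test_function_lin.
- apply: L2_cvg_lin => //; [| |exact: Lf.1|exact: Lg.1] => k.
    exact: (test_bmeas oO bO (tzf k)).1.
  exact: (test_bmeas oO bO (tzg k)).1.
move=> i; rewrite (_ : (fun k => _) = fun k => a *: partial i (zf k) + partial i (zg k)); last first.
  apply/funext => k; apply/funext => x; rewrite partial_lin//.
    exact: ((test_C1 (tzf k)).2 i).1.
  exact: ((test_C1 (tzg k)).2 i).1.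
apply: L2_cvg_lin => //; [| |exact: (Ldf i).1|exact: (Ldg i).1] => k.
  exact: (test_partial_bmeas oO bO i (tzf k)).1.
exact: (test_partial_bmeas oO bO i (tzg k)).1.
Qed.

Lemma L2_cvg_cst0 : L2_cvg Omega (fun=> 0) 0.
Proof.
rewrite /L2_cvg (_ : (fun k : nat => _) = cst 0%E); first exact: cvg_cst.
by apply/funext => k; apply: integral0_eq => t _; rewrite subrr expr0n.
Qed.

Lemma H10_0 : H10 Omega 0.
Proof.
split; first exact: L2_0.
exists (fun=> 0) => [i|]; first exact: L2_0.
exists (fun=> 0); split => [k||i]; [exact: test_function0|exact: L2_cvg_cst0|].
rewrite (_ : (fun k : nat => _) = fun=> 0); first exact: L2_cvg_cst0.
by apply/funext => k; apply/funext => x; exact: derive_cst.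
Qed.

Lemma L20_lin a f g : L20 Omega f -> L20 Omega g -> L20 Omega (a *: f + g).
Proof.
move=> [Lf f0] [Lg g0]; split; first exact: L2_lin.
have Lint h : L2 Omega h -> integr Omega h.
  move=> Lh; have B1 := bmeas_L2 mO (leb_Omega_lty oO bO) (bmeas_cst Omega 1).
  by have := L2_integrM mO Lh B1; under eq_fun do rewrite mulr1.
have -> : leb_int Omega (a *: f + g) = leb_int Omega (fun x => a * f x + g x) by [].
rewrite leb_intD ?leb_intZ ?f0 ?g0 ?mulr0 ?addr0//; try exact: Lint.
by apply: integrZ => //; exact: Lint.
Qed.

Lemma L20_0 : L20 Omega 0.
Proof. by split; [exact: L2_0|exact: leb_int0]. Qed.

Lemma Yh_subspace : linear_subspace (Yh Omega K).
Proof.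
split; first by split; [exact: C0_0|move=> j; exact: P_0].
by move=> a f g [Cf Pf] [Cg Pg]; split; [exact: C0_lin|move=> j; exact: P_lin].
Qed.

Lemma coor_lin a u v i : coor (a *: u + v) i = a *: coor u i + coor v i.
Proof. by apply/funext => x; rewrite /coor !mxE. Qed.

Lemma coor0 i : coor (0 : 'rV[R]_d -> 'rV[R]_d) i = 0.
Proof. by apply/funext => x; rewrite /coor mxE. Qed.

Lemma Xh_subspace : linear_subspace (Xh Omega K).
Proof.
split; first by move=> i; rewrite coor0; split; [exact: C0_0|exact: H10_0|move=> j; exact: P_0].
move=> a u v Xu Xv i; have [Cu Hu Pu] := Xu i; have [Cv Hv Pv] := Xv i.
by rewrite coor_lin; split; [exact: C0_lin|exact: H10_lin|move=> j; exact: P_lin].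
Qed.

Lemma Mh_subspace : linear_subspace (Mh Omega K).
Proof.
split; first by split; [exact: C0_0|exact: L20_0|move=> j; exact: P_0].
move=> a f g [Cf Lf Pf] [Cg Lg Pg].
by split; [exact: C0_lin|exact: L20_lin|move=> j; exact: P_lin].
Qed.

Definition vanish (T : zmodType) : set ('rV[R]_d -> T) :=
  [set f | forall x, closure Omega x -> f x = 0].

Lemma vanish_subspace (T : lmodType R) : linear_subspace (@vanish T).
Proof.
split => // a f g f0 g0 x Ox; rewrite -[LHS]/(a *: f x + g x).
by rewrite f0// g0// scaler0 addr0.
Qed.

(** Only an upper bound on the dimension matters, so the coefficients on each element are listed
    independently. Zero coefficients make a function vanish on all elements, which cover the closure
    of Omega. *)
Lemma P_finite_dim k (S : set ('rV[R]_d -> R)) :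
  (forall f, S f -> forall j, P_ k (K j) f) -> finite_dim S (@vanish R).
Proof.
move=> SP; have [_ clO _] := hK.
pose I := ('I_N * {ffun 'I_d -> 'I_k.+1})%type.
exists I, (fun f c => forall j x, K j x -> f x = P_rep (fun j al => c (j, al)) j x).
split.
- by move=> f /SP /P_repP[c fc]; exists (fun jal => c jal.1 jal.2).
- by move=> j x _; rewrite /P_rep big1// => al _; rewrite mul0r.
- move=> a f g c c' fc gc j x Kx; rewrite -[LHS]/(a * f x + g x) (fc j)// (gc j)//.
  rewrite /P_rep mulr_sumr -big_split; apply: eq_bigr => al _ /=.
  by rewrite mulrDl mulrA.
- move=> f _ f0 x; rewrite clO => -[j _ Kx].
  by rewrite (f0 j)// /P_rep big1// => al _; rewrite mul0r.
Qed.

Lemma Yh_finite_dim : finite_dim (Yh Omega K) (@vanish R).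
Proof. by apply: (@P_finite_dim 2) => f []. Qed.

Lemma Mh_finite_dim : finite_dim (Mh Omega K) (@vanish R).
Proof. by apply: (@P_finite_dim 1) => f []. Qed.

Lemma Xh_finite_dim : finite_dim (Xh Omega K) (@vanish 'rV[R]_d).
Proof.
have [_ clO _] := hK.
(* ['I_3] holds the exponents 0, 1 and 2 of a quadratic polynomial. *)
pose I := ('I_d * ('I_N * {ffun 'I_d -> 'I_3}))%type.
exists I, (fun u c => forall i j x, K j x ->
  coor u i x = P_rep (fun j al => c (i, (j, al))) j x).
split.
- move=> u Xu.
  have /choice[c uc] : forall i, exists c, forall j x, K j x -> coor u i x = @P_rep R d N 2 c j x.
    by move=> i; apply: P_repP; have [] := Xu i.
  by exists (fun ijal => c ijal.1 ijal.2.1 ijal.2.2).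
- by move=> i j x _; rewrite coor0 /P_rep big1// => al _; rewrite mul0r.
- move=> a f g c c' fc gc i j x Kx; rewrite coor_lin -[LHS]/(a * coor f i x + coor g i x).
  rewrite (fc i j)// (gc i j)// /P_rep mulr_sumr -big_split; apply: eq_bigr => al _ /=.
  by rewrite mulrDl mulrA.
- move=> f _ f0 x; rewrite clO => -[j _ Kx]; apply/rowP => i.
  by rewrite -[LHS]/(coor f i x) (f0 i j)// mxE /P_rep big1// => al _; rewrite mul0r.
Qed.

End function_spaces.

(** * Products, for the coupled systems *)

Section product_space.
Variables (R : fieldType) (E E' : lmodType R) (S Nl : set E) (S' Nl' : set E').

Lemma prod_subspace : linear_subspace S -> linear_subspace S' ->
  linear_subspace (S `*` S').
Proof.
move=> [S0 SD] [S'0 S'D]; split => // a x y [Sx S'x] [Sy S'y].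
by split; [exact: SD|exact: S'D].
Qed.

Lemma prod_finite_dim : finite_dim S Nl -> finite_dim S' Nl' ->
  finite_dim (S `*` S') (Nl `*` Nl').
Proof.
move=> [I [co [Sc c0 cD cN]]] [I' [co' [Sc' c0' cD' cN']]].
exists (I + I')%type, (fun x c => co x.1 (c \o inl) /\ co' x.2 (c \o inr)); split => //.
- move=> x [/Sc[c xc] /Sc'[c' xc']].
  by exists (fun i => match i with inl j => c j | inr j => c' j end).
- by move=> a x y c c' [? ?] [? ?]; split; [exact: cD|exact: cD'].
- by move=> x [Sx S'x] [? ?]; split; [exact: cN|exact: cN'].
Qed.

End product_space.

(* Leaves are matched syntactically, since unification would unfold [partial]. *)
Ltac bmeas_auto := repeat match goal with
  | |- bmeas _ (fun=> _) => apply: bmeas_cst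
  | |- bmeas _ (fun x => \sum_(i <- _ | _) _) => apply: bmeas_sum => ?
  | |- bmeas _ (fun x => _ + _) => apply: bmeasD
  | |- bmeas _ (fun x => _ * _) => apply: bmeasM
  | |- bmeas _ (fun x => _ ^+ 2) => apply: bmeasM
  | |- bmeas _ (fun x => - _) => apply: bmeasN
  | H : bmeas ?A ?f |- bmeas ?A ?f => exact H
  | H : bmeas ?A ?f |- bmeas ?A (fun x => ?f x) => exact H
  | H : forall i, bmeas ?A (fun x => fun_of_matrix (?u x) _ _)
    |- bmeas ?A (fun x => fun_of_matrix (?u x) _ _) => exact (H _)
  | H : forall i, bmeas ?A (fun x => fun_of_matrix (?u x) _ _)
    |- bmeas ?A (coor ?u _) => exact (H _)
  | H : forall i, bmeas ?A (partial i ?f) |- bmeas ?A (partial _ ?f) => exact (H _)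
  | H : forall i, bmeas ?A (partial i ?f) |- bmeas ?A (fun x => partial _ ?f x) => exact (H _)
  | H : forall i j, bmeas ?A (partial j (coor ?u i)) |- bmeas ?A (partial _ (coor ?u _)) =>
    exact (H _ _)
  | H : forall i j, bmeas ?A (partial j (coor ?u i)) |- bmeas ?A (fun x => partial _ (coor ?u _) x) =>
    exact (H _ _)
  end.

(** * The scheme *)

Section scheme_forms.
Variables (R : realType) (d N : nat) (Omega : set 'rV[R]_d) (K : 'I_N -> set 'rV[R]_d).
Hypotheses (oO : open Omega) (bO : bounded_set Omega) (hK : fe_partition Omega K).
Variables (gamma lambda mu tau : R).
Hypotheses (hgamma : 0 < gamma) (hlambda : 0 < lambda) (hmu : 0 < mu) (htau : 0 < tau).
Variables (F : R -> R) (B : R).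
Hypotheses (hF : potential F) (hB : forall s, 0 < F s + B).
Variables (phi0 : 'rV[R]_d -> R) (u0 : 'rV[R]_d -> 'rV[R]_d) (p0 U0 : 'rV[R]_d -> R).
Hypotheses (hphi0 : Yh Omega K phi0) (hu0 : Vh Omega K u0) (hp0 : Mh Omega K p0)
  (hU0 : C0 Omega U0).
Local Notation D := (pieces Omega K).
Local Notation Phi A := (@pt R d @^-1` A).
Local Notation I := (leb_int Omega).
Local Notation Y := (Yh Omega K).
Local Notation X := (Xh Omega K).
Local Notation M := (Mh Omega K).
Implicit Types (f g q psi phi w p U : 'rV[R]_d -> R) (u v : 'rV[R]_d -> 'rV[R]_d).

Lemma C0_Hfun : C0 Omega (fun x => Hfun F B (phi0 x)).
Proof.
have [dF cF' _] := hF.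
have cF : continuous F by move=> s; apply/differentiable_continuous/derivable1_diffP.
have cH : continuous (Hfun F B).
  move=> s; apply: cvgM; first exact: cF'.
  apply: cvgV; first by rewrite gt_eqF// sqrtr_gt0.
  apply: continuous_comp; last exact: sqrt_continuous.
  by apply: cvgD; [exact: cF|exact: cvg_cst].
have [Cphi _] := hphi0.
by move=> x; apply: (@continuous_comp (subspace (closure Omega)) R R phi0 (Hfun F B));
  [exact: Cphi|exact: cH].
Qed.

Lemma Y_bmeas f : Y f -> bmeas D f.
Proof. by move=> [Cf _]; exact: C0_bmeas_pieces. Qed.

Lemma Y_partial_bmeas f i : Y f -> bmeas D (partial i f).
Proof. by move=> [_ Pf]; exact: (bmeas_partial oO bO hK i Pf). Qed.

Lemma M_bmeas f : M f -> bmeas D f.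
Proof. by move=> [Cf _ _]; exact: C0_bmeas_pieces. Qed.

Lemma X_bmeas u i : X u -> bmeas D (fun x => u x 0 i).
Proof. by move=> /(_ i)[Cf _ _]; exact: C0_bmeas_pieces Cf. Qed.

Lemma X_partial_bmeas u i j : X u -> bmeas D (partial j (coor u i)).
Proof. by move=> /(_ i)[_ _ Pf]; exact: (bmeas_partial oO bO hK j Pf). Qed.

(** Additivity of the pointwise derivative needs differentiability, which an elementwise polynomial
    has in the element interiors. *)
Lemma P_derivable k f i x : (forall j, P_ k (K j) f) -> D x ->
  derivable f x (delta_mx 0 i).
Proof.
move=> /P_repP[c fc] [j _ pjx].
have C1P : C1 (P_rep c j) by exact: C1_poly.
apply: near_eq_derivable ((C1P.2 i).1 x).
have : nbhs x (piece Omega K j) by apply: open_nbhs_nbhs; split => //; exact: open_piece.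
by apply: filterS => y /piece_sub Ky; rewrite (fc j).
Qed.

Lemma partial_lin_Y i a f g x : Y f -> Y g -> D x ->
  partial i (a *: f + g) x = a * partial i f x + partial i g x.
Proof.
move=> [_ Pf] [_ Pg] Dx; have df := @P_derivable 2 _ i _ Pf Dx; have dg := @P_derivable 2 _ i _ Pg Dx.
exact: partial_lin.
Qed.

Lemma partial_lin_X i j a u v x : X u -> X v -> D x ->
  partial j (coor (a *: u + v) i) x = a * partial j (coor u i) x + partial j (coor v i) x.
Proof.
move=> /(_ i)[_ _ Pf] /(_ i)[_ _ Pg] Dx; rewrite coor_lin.
have df := @P_derivable 2 _ j _ Pf Dx; have dg := @P_derivable 2 _ j _ Pg Dx.
exact: partial_lin.
Qed.

Lemma vanish_pieces (T : zmodType) (f : 'rV[R]_d -> T) x : vanish Omega f -> D x -> f x = 0.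
Proof. by move=> f0 /pieces_sub Ox; apply: f0; exact: subset_closure. Qed.

Lemma vanish_partial f i x : vanish Omega f -> D x -> partial i f x = 0.
Proof.
move=> f0 /pieces_sub Ox; rewrite /partial (@near_eq_derive _ _ _ _ (cst 0)) ?derive_cst//.
have : nbhs x Omega by exact: open_nbhs_nbhs.
by apply: filterS => y Oy; apply: f0; exact: subset_closure.
Qed.

Lemma vanish_coor u i : vanish Omega u -> vanish Omega (coor u i).
Proof. by move=> u0' x Ox; rewrite /coor u0'// mxE. Qed.

Lemma partial0 i x : partial i (0 : 'rV[R]_d -> R) x = 0.
Proof. exact: derive_cst. Qed.

Lemma vanish_sqr f : C0 Omega f -> I (fun x => f x ^+ 2) = 0 -> vanish Omega f.
Proof. exact: eq_C0_sqr0. Qed.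

Lemma le_leb_int_pieces f g : bmeas D f -> bmeas D g -> (forall x, D x -> f x <= g x) -> I f <= I g.
Proof.
move=> Bf Bg fg; rewrite -subr_ge0 (sub_leb_int oO bO hK)//.
by apply: (leb_int_pieces_ge0 oO hK) => x Dx; rewrite subr_ge0 fg.
Qed.

(** Forms are given by their integrands [h] and [l], so that linearity and invariance are checked
    pointwise in the element interiors and each system is a single integral. Uniqueness modulo [Nl]
    is injectivity applied to the difference of two solutions. *)
Lemma galerkin_unique_solve (E : lmodType R) (S Nl : set E) (h : E -> E -> 'rV[R]_d -> R)
    (l : E -> 'rV[R]_d -> R) :
  linear_subspace S -> linear_subspace Nl -> finite_dim S Nl ->
  (forall x y, S x -> S y -> bmeas D (h x y)) -> (forall y, S y -> bmeas D (l y)) ->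
  (forall a x x' y, S x -> S x' -> S y -> forall t, D t ->
    h (a *: x + x') y t = a * h x y t + h x' y t) ->
  (forall a x y y', S x -> S y -> S y' -> forall t, D t ->
    h x (a *: y + y') t = a * h x y t + h x y' t) ->
  (forall a y y', S y -> S y' -> forall t, D t -> l (a *: y + y') t = a * l y t + l y' t) ->
  (forall x y t, S x -> S y -> Nl y -> D t -> h x y t = 0) ->
  (forall y t, S y -> Nl y -> D t -> l y t = 0) ->
  (forall x, S x -> (forall y, S y -> I (h x y) = 0) -> Nl x) ->
  exists x, [/\ S x, forall y, S y -> I (h x y) = I (l y) &
    forall x', S x' -> (forall y, S y -> I (h x' y) = I (l y)) -> Nl (x' - x)].
Proof.
move=> Ss Ns fS Bh Bl hl hr ll hN lN inj.
have hlin y : S y -> linear_on S (fun x => I (h x y)).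
  move=> Sy; apply: (linear_on_int oO bO hK (h := h^~ y)) => // [x Sx|a x x' Sx Sx' t Dt].
    exact: Bh.
  exact: hl.
have hrin x : S x -> linear_on S (fun y => I (h x y)).
  move=> Sx; apply: (linear_on_int oO bO hK) => // [y Sy|a y y' Sy Sy' t Dt].
    exact: Bh.
  exact: hr.
have [x Sx xl] : exists2 x, S x & forall y, S y -> I (h x y) = I (l y).
  apply: (finite_dim_solve Ss Ns fS hrin hlin) => //.
  - exact: (linear_on_int oO bO hK).
  - by move=> x y Sx Sy Ny; apply: (leb_int_pieces_eq0 oO hK) => t; exact: hN.
  - by move=> y Sy Ny; apply: (leb_int_pieces_eq0 oO hK) => t; exact: lN.
exists x; split => // x' Sx' x'l.
have -> : x' - x = (-1) *: x + x' by rewrite scaleN1r addrC.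
apply: inj => [|y Sy]; first by apply: Ss.2.
by rewrite (hlin y Sy)// xl// x'l//; ring.
Qed.

Lemma vanish_int_sqr u : X u -> I (fun x => \sum_i u x 0 i ^+ 2) = 0 -> vanish Omega u.
Proof.
move=> Xu u20; suff ui i : vanish Omega (coor u i).
  by move=> x Ox; apply/rowP => i; rewrite mxE; exact: (ui i x Ox).
have [Ci _ _] := Xu i; apply: vanish_sqr => //; apply/eqP; rewrite eq_le; apply/andP; split.
  rewrite -u20; apply: le_leb_int_pieces.
  - by have := X_bmeas i Xu => Bi; bmeas_auto.
  - by have := fun i => X_bmeas i Xu => Bi; bmeas_auto.
  - move=> x Dx; rewrite (bigD1 i)//= lerDl; apply: sumr_ge0 => j _; exact: sqr_ge0.
by apply: (leb_int_pieces_ge0 oO hK) => x _; exact: sqr_ge0.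
Qed.

Lemma projection_solve : exists U0h, [/\ Y U0h,
  forall m, Y m -> inner Omega U0h m = inner Omega U0 m &
  forall U0h', Y U0h' -> (forall m, Y m -> inner Omega U0h' m = inner Omega U0 m) ->
    vanish Omega (U0h' - U0h)].
Proof.
have BU0 : bmeas D U0 by exact: C0_bmeas_pieces.
apply: (galerkin_unique_solve (h := fun f g x => f x * g x) (l := fun g x => U0 x * g x)
  (Yh_subspace Omega K) (vanish_subspace Omega _) (Yh_finite_dim hK)).
- by move=> f g /Y_bmeas Bf /Y_bmeas Bg; bmeas_auto.
- by move=> g /Y_bmeas Bg; bmeas_auto.
- by move=> a f f' g _ _ _ t _; rewrite -[(a *: f + f') t]/(a * f t + f' t); ring.
- by move=> a f g g' _ _ _ t _; rewrite -[(a *: g + g') t]/(a * g t + g' t); ring.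
- by move=> a g g' _ _ t _; rewrite -[(a *: g + g') t]/(a * g t + g' t); ring.
- by move=> f g t _ _ Ng Dt; rewrite (vanish_pieces Ng Dt) mulr0.
- by move=> g t _ Ng Dt; rewrite (vanish_pieces Ng Dt) mulr0.
- by move=> f Yf /(_ f Yf) f0; apply: vanish_sqr => //; case: Yf.
Qed.

(** * The velocity-pressure system *)

Lemma X_dvg_bmeas u : X u -> bmeas D (dvg u).
Proof. by move=> Xu; rewrite /dvg; apply: bmeas_sum => i; exact: X_partial_bmeas. Qed.

Lemma dvg_lin a u v x : X u -> X v -> D x -> dvg (a *: u + v) x = a * dvg u x + dvg v x.
Proof.
move=> Xu Xv Dx; rewrite /dvg mulr_sumr -big_split; apply: eq_bigr => i _.
exact: partial_lin_X.
Qed.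

Lemma vanish_dvg u x : vanish Omega u -> D x -> dvg u x = 0.
Proof.
by move=> Nu Dx; rewrite /dvg big1// => i _; apply: vanish_partial => //; exact: vanish_coor.
Qed.

Lemma entry_lin a u v x i : (a *: u + v) x 0 i = a * u x 0 i + v x 0 i.
Proof. by rewrite -[(a *: u + v) x]/(a *: u x + v x) !mxE. Qed.

(** The divergence constraint is added with the sign that makes the two pressure terms cancel when
    the pair is tested with itself. *)
Definition pressure_form (x y : ('rV[R]_d -> 'rV[R]_d) * ('rV[R]_d -> R)) : 'rV[R]_d -> R :=
  fun t => \sum_i tau^-1 * (x.1 t 0 i * y.1 t 0 i) - x.2 t * dvg y.1 t + dvg x.1 t * y.2 t.

Definition pressure_rhs (ut : 'rV[R]_d -> 'rV[R]_d)
    (y : ('rV[R]_d -> 'rV[R]_d) * ('rV[R]_d -> R)) : 'rV[R]_d -> R :=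
  fun t => \sum_i tau^-1 * (ut t 0 i * y.1 t 0 i) - p0 t * dvg y.1 t.

(** If [p] did not vanish, it would compete in the infimum with all its quotients equal to zero,
    whatever their denominators, and the positive constant would be at most zero. *)
Lemma inf_sup_vanish p : inf_sup Omega K -> M p ->
  (forall chi, X chi -> I (fun x => dvg chi x * p x) = 0) -> vanish Omega p.
Proof.
move=> [beta beta0 hb] Mp p_dvg; apply: contrapT => np.
have : (beta%:E <= 0)%E.
  apply: le_trans hb _; apply: le_trans.
    by apply: ereal_inf_lbound; exists p => //; split => // p00; apply: np.
  apply: ge_ereal_sup => _ [v [Xv _] <-].
  by rewrite /inner p_dvg// oppr0 mul0r.
by rewrite lee_fin leNgt beta0.
Qed.

Lemma pressure_solve ut : inf_sup Omega K -> X ut -> exists x, [/\ (X `*` M) x,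
  forall y, (X `*` M) y -> I (pressure_form x y) = I (pressure_rhs ut y) &
  forall x', (X `*` M) x' ->
    (forall y, (X `*` M) y -> I (pressure_form x' y) = I (pressure_rhs ut y)) ->
    (@vanish R d Omega 'rV[R]_d `*` @vanish R d Omega R) (x' - x)].
Proof.
move=> hinfsup Xut.
have Bp0 : bmeas D p0 by exact: M_bmeas.
have BX v : X v -> forall i, bmeas D (fun x => v x 0 i) by move=> Xv i; exact: X_bmeas.
have BXut := BX ut Xut.
have Xs := @Xh_subspace R d N Omega K oO bO; have Ms := @Mh_subspace R d N Omega K oO bO.
have Ps := prod_subspace Xs Ms.
apply: galerkin_unique_solve => //.
- exact: prod_subspace (vanish_subspace Omega _) (vanish_subspace Omega _).
- exact: prod_finite_dim (Xh_finite_dim hK) (Mh_finite_dim hK).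
- move=> [u p] [v q] [/= Xu Mp] [/= Xv Mq]; rewrite /pressure_form /=.
  have Bu := BX u Xu; have Bv := BX v Xv; have Bp := M_bmeas Mp; have Bq := M_bmeas Mq.
  have Bdu := X_dvg_bmeas Xu; have Bdv := X_dvg_bmeas Xv.
  bmeas_auto.
- move=> [v q] [/= Xv Mq]; rewrite /pressure_rhs /=.
  have Bv := BX v Xv; have Bdv := X_dvg_bmeas Xv.
  bmeas_auto.
- move=> a [u p] [u' p'] [v q] [/= Xu Mp] [/= Xu' Mp'] [/= Xv Mq] t Dt.
  rewrite /pressure_form /= dvg_lin// -[(a *: p + p') t]/(a * p t + p' t).
  rewrite (eq_bigr (fun i => a * (tau^-1 * (u t 0 i * v t 0 i)) + tau^-1 * (u' t 0 i * v t 0 i))).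
    by rewrite big_split/= -mulr_sumr; ring.
  by move=> i _; rewrite entry_lin; ring.
- move=> a [u p] [v q] [v' q'] [/= Xu Mp] [/= Xv Mq] [/= Xv' Mq'] t Dt.
  rewrite /pressure_form /= dvg_lin// -[(a *: q + q') t]/(a * q t + q' t).
  rewrite (eq_bigr (fun i => a * (tau^-1 * (u t 0 i * v t 0 i)) + tau^-1 * (u t 0 i * v' t 0 i))).
    by rewrite big_split/= -mulr_sumr; ring.
  by move=> i _; rewrite entry_lin; ring.
- move=> a [v q] [v' q'] [/= Xv Mq] [/= Xv' Mq'] t Dt.
  rewrite /pressure_rhs /= dvg_lin//.
  rewrite (eq_bigr (fun i => a * (tau^-1 * (ut t 0 i * v t 0 i)) + tau^-1 * (ut t 0 i * v' t 0 i))).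
    by rewrite big_split/= -mulr_sumr; ring.
  by move=> i _; rewrite entry_lin; ring.
- move=> [u p] [v q] t _ _ [/= Nv Nq] Dt; rewrite /pressure_form /= (vanish_dvg Nv Dt).
  rewrite (vanish_pieces Nq Dt) !mulr0 subr0 addr0 big1// => i _.
  by rewrite (vanish_pieces Nv Dt) mxE !mulr0.
- move=> [v q] t _ [/= Nv Nq] Dt; rewrite /pressure_rhs /= (vanish_dvg Nv Dt) mulr0 subr0.
  by rewrite big1// => i _; rewrite (vanish_pieces Nv Dt) mxE !mulr0.
move=> [u p] [/= Xu Mp] h0.
have Bu := BX u Xu; have Bp := M_bmeas Mp.
have Nu : vanish Omega u.
  apply: vanish_int_sqr => //; have := h0 (u, p) (conj Xu Mp).
  rewrite (_ : I _ = tau^-1 * I (fun t => \sum_i u t 0 i ^+ 2)).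
    by move/eqP; rewrite mulf_eq0 invr_eq0 gt_eqF//= => /eqP.
  rewrite (scale_leb_int oO bO hK); last by bmeas_auto.
  apply: (eq_leb_int_pieces oO hK) => t Dt; rewrite /pressure_form /= (mulrC (p t)) subrK mulr_sumr.
  by apply: eq_bigr => i _; rewrite expr2.
split => //; apply: inf_sup_vanish => // chi Xchi.
have Bdc := X_dvg_bmeas Xchi.
(* Since [u] vanishes already, this test leaves minus the integral of [p] times the divergence of
   [chi]. *)
have := h0 (chi, 0) (conj Xchi Ms.1).
rewrite (_ : I _ = -1 * I (fun t => dvg chi t * p t)).
  by move/eqP; rewrite mulf_eq0 oppr_eq0 oner_eq0/= => /eqP.
rewrite (scale_leb_int oO bO hK); last by bmeas_auto.
apply: (eq_leb_int_pieces oO hK) => t Dt; rewrite /pressure_form /= mulr0 addr0 big1 => [|i _]; first by ring.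
by rewrite (vanish_pieces Nu Dt) mxE mul0r mulr0.
Qed.

(** * The intermediate velocity *)

Lemma leb_int_pieces_sum (J : Type) (r : seq J) (P : pred J) (G : J -> 'rV[R]_d -> R) :
  (forall i, bmeas D (G i)) ->
  I (fun x => \sum_(i <- r | P i) G i x) = \sum_(i <- r | P i) I (G i).
Proof.
move=> BG; rewrite (leb_int_pieces oO hK) leb_int_sum.
- by apply: eq_bigr => i _; rewrite (leb_int_pieces oO hK).
- exact: measurable_Phi_pieces.
- by move=> i; exact: (bmeas_pieces_integr oO bO).
Qed.

Definition velocity_form u v : 'rV[R]_d -> R := fun t =>
  \sum_i (tau^-1 * (u t 0 i * v t 0 i) +
    mu * (\sum_j partial j (coor u i) t * partial j (coor v i) t) +
    (\sum_j u0 t 0 j * partial j (coor u i) t) * v t 0 i +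
    2^-1 * (dvg u0 t * u t 0 i * v t 0 i)).

Definition velocity_rhs w v : 'rV[R]_d -> R := fun t =>
  \sum_i (tau^-1 * (u0 t 0 i * v t 0 i) - phi0 t * partial i w t * v t 0 i) +
  p0 t * dvg v t.

(** The divergence of [u0] need not vanish pointwise; the half-divergence term of b compensates for
    it. For each pair of indices, half of the trilinear identity gathers one convective term and one
    divergence term. *)
Lemma convection_skew u : X u ->
  I (fun t => \sum_i ((\sum_j u0 t 0 j * partial j (coor u i) t) * u t 0 i +
    2^-1 * (dvg u0 t * u t 0 i * u t 0 i))) = 0.
Proof.
move=> Xu.
have Bu i : bmeas D (fun x => u x 0 i) by exact: X_bmeas.
have Bu0 i : bmeas D (fun x => u0 x 0 i) by exact: X_bmeas.
have Bpu i j : bmeas D (partial j (coor u i)) by exact: X_partial_bmeas.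
have Bpu0 i j : bmeas D (partial j (coor u0 i)) by exact: X_partial_bmeas.
rewrite (_ : I _ = I (fun t => \sum_i \sum_j 2^-1 *
    (partial j (coor u0 j) t * coor u i t * coor u i t +
     2 * (coor u0 j t * partial j (coor u i) t * coor u i t)))); last first.
  apply: (eq_leb_int_pieces oO hK) => t Dt; apply: eq_bigr => i _.
  rewrite /dvg !mulr_suml mulr_sumr -big_split; apply: eq_bigr => j _ /=.
  by rewrite /coor; field.
rewrite leb_int_pieces_sum => [|i]; last by bmeas_auto.
rewrite big1// => i _; rewrite leb_int_pieces_sum => [|j]; last by bmeas_auto.
rewrite big1// => j _; rewrite -(scale_leb_int oO bO hK); last by bmeas_auto.
have [Cu Hu Pu] := Xu i; have [Cu0 Hu0 Pu0] := hu0 j.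
by rewrite (convection_trilinear0 oO bO hK j Pu0 Pu Cu0 Cu Hu0 Hu) mulr0.
Qed.

Lemma velocity_gradient_lin a u u' v i t : X u -> X u' -> D t ->
  \sum_j partial j (coor (a *: u + u') i) t * partial j (coor v i) t =
  a * (\sum_j partial j (coor u i) t * partial j (coor v i) t) +
  \sum_j partial j (coor u' i) t * partial j (coor v i) t.
Proof.
move=> Xu Xu' Dt; rewrite mulr_sumr -big_split; apply: eq_bigr => j _ /=.
by rewrite partial_lin_X//; ring.
Qed.

Lemma velocity_gradient_linr a u v v' i t : X v -> X v' -> D t ->
  \sum_j partial j (coor u i) t * partial j (coor (a *: v + v') i) t =
  a * (\sum_j partial j (coor u i) t * partial j (coor v i) t) +
  \sum_j partial j (coor u i) t * partial j (coor v' i) t.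
Proof.
move=> Xv Xv' Dt; rewrite mulr_sumr -big_split; apply: eq_bigr => j _ /=.
by rewrite partial_lin_X//; ring.
Qed.

Lemma convection_lin a u u' i t : X u -> X u' -> D t ->
  \sum_j u0 t 0 j * partial j (coor (a *: u + u') i) t =
  a * (\sum_j u0 t 0 j * partial j (coor u i) t) +
  \sum_j u0 t 0 j * partial j (coor u' i) t.
Proof.
move=> Xu Xu' Dt; rewrite mulr_sumr -big_split; apply: eq_bigr => j _ /=.
by rewrite partial_lin_X//; ring.
Qed.

Lemma velocity_solve w : Y w -> exists ut, [/\ X ut,
  forall v, X v -> I (velocity_form ut v) = I (velocity_rhs w v) &
  forall ut', X ut' -> (forall v, X v -> I (velocity_form ut' v) = I (velocity_rhs w v)) ->
    vanish Omega (ut' - ut)].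
Proof.
move=> Yw.
have Bp0 : bmeas D p0 by exact: M_bmeas.
have Bphi0 : bmeas D phi0 by exact: Y_bmeas.
have BX v : X v -> forall i, bmeas D (fun x => v x 0 i) by move=> Xv i; exact: X_bmeas.
have Bu0 := BX u0 hu0; have Bdu0 := X_dvg_bmeas hu0.
have Bpw i : bmeas D (partial i w) by exact: Y_partial_bmeas.
have BpX v : X v -> forall i j, bmeas D (partial j (coor v i)).
  by move=> Xv i j; exact: X_partial_bmeas.
apply: (galerkin_unique_solve (@Xh_subspace R d N Omega K oO bO) (vanish_subspace Omega _)
  (Xh_finite_dim hK)).
- move=> u v Xu Xv; rewrite /velocity_form.
  have Bu := BX u Xu; have Bv := BX v Xv; have Bpu := BpX u Xu; have Bpv := BpX v Xv.
  bmeas_auto.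
- move=> v Xv; rewrite /velocity_rhs.
  have Bv := BX v Xv; have Bdv := X_dvg_bmeas Xv.
  bmeas_auto.
- move=> a u u' v Xu Xu' Xv t Dt; rewrite /velocity_form mulr_sumr -big_split.
  apply: eq_bigr => i _ /=; rewrite entry_lin.
  by rewrite velocity_gradient_lin// convection_lin//; ring.
- move=> a u v v' Xu Xv Xv' t Dt; rewrite /velocity_form mulr_sumr -big_split.
  apply: eq_bigr => i _ /=; rewrite entry_lin.
  by rewrite velocity_gradient_linr//; ring.
- move=> a v v' Xv Xv' t Dt; rewrite /velocity_rhs dvg_lin//.
  rewrite (eq_bigr (fun i => a * (tau^-1 * (u0 t 0 i * v t 0 i) - phi0 t * partial i w t * v t 0 i) +
    (tau^-1 * (u0 t 0 i * v' t 0 i) - phi0 t * partial i w t * v' t 0 i))) => [|i _].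
    by rewrite big_split/= -mulr_sumr; ring.
  by rewrite entry_lin; ring.
- move=> u v t _ _ Nv Dt; rewrite /velocity_form big1// => i _.
  rewrite (vanish_pieces Nv Dt) mxE !mulr0 !addr0 add0r big1 ?mulr0// => j _.
  by rewrite (vanish_partial j (vanish_coor i Nv) Dt) mulr0.
- move=> v t _ Nv Dt; rewrite /velocity_rhs (vanish_dvg Nv Dt) mulr0 addr0 big1// => i _.
  by rewrite (vanish_pieces Nv Dt) mxE !mulr0 subr0.
move=> u Xu /(_ u Xu) uu0.
have Bu := BX u Xu; have Bpu := BpX u Xu.
apply: vanish_int_sqr => //; apply/eqP; rewrite eq_le; apply/andP; split; last first.
  by apply: (leb_int_pieces_ge0 oO hK) => t _; apply: sumr_ge0 => i _; exact: sqr_ge0.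
have ti0 : 0 < tau^-1 by rewrite invr_gt0.
rewrite -(pmulr_rle0 _ ti0) (scale_leb_int oO bO hK); last by bmeas_auto.
have Bform : bmeas D (velocity_form u u) by rewrite /velocity_form; bmeas_auto.
(* [c] is the convective part of the form, of zero integral. Subtracting it leaves tau^-1 |u|^2 plus
   the viscous term, which is nonnegative. *)
have := convection_skew Xu; set c := (X in I X) => c0.
have Bc : bmeas D c by rewrite /c; bmeas_auto.
have E : I (fun t => velocity_form u u t - c t) = 0 by rewrite -(sub_leb_int oO bO hK)// uu0 c0 subrr.
rewrite -[leRHS]E; apply: le_leb_int_pieces => [||t Dt]; [by bmeas_auto|by bmeas_auto|].
rewrite /velocity_form /c -sumrB mulr_sumr; apply: ler_sum => i _.
have : 0 <= mu * (\sum_j partial j (coor u i) t * partial j (coor u i) t).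
  by rewrite mulr_ge0 ?(ltW hmu)// sumr_ge0// => j _; rewrite -expr2 sqr_ge0.
rewrite expr2; lra.
Qed.

(** * The phase field and the chemical potential *)

Definition phase_form (x y : ('rV[R]_d -> R) * ('rV[R]_d -> R)) : 'rV[R]_d -> R := fun t =>
  tau^-1 * (x.1 t * y.1 t) +
  (gamma + tau * phi0 t ^+ 2) * (\sum_i partial i x.2 t * partial i y.1 t) +
  x.2 t * y.2 t - lambda * (\sum_i partial i x.1 t * partial i y.2 t) -
  lambda * 2^-1 * Hfun F B (phi0 t) ^+ 2 * (x.1 t * y.2 t).

(** Together with [phase_form], the first two equations after both eliminations. The convective flux
    leaves u0 phi0 here and puts tau phi0^2 into the weight; the auxiliary variable leaves its known
    part here and puts (1/2) H^2 phi into the form. *)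
Definition phase_rhs U0h (y : ('rV[R]_d -> R) * ('rV[R]_d -> R)) : 'rV[R]_d -> R := fun t =>
  tau^-1 * (phi0 t * y.1 t) + phi0 t * (\sum_i u0 t 0 i * partial i y.1 t) +
  lambda * Hfun F B (phi0 t) * (U0h t - 2^-1 * Hfun F B (phi0 t) * phi0 t) * y.2 t.

Lemma gradient_lin a f f' g t : Y f -> Y f' -> D t ->
  \sum_i partial i (a *: f + f') t * partial i g t =
  a * (\sum_i partial i f t * partial i g t) + \sum_i partial i f' t * partial i g t.
Proof.
move=> Yf Yf' Dt; rewrite mulr_sumr -big_split; apply: eq_bigr => i _ /=.
by rewrite partial_lin_Y//; ring.
Qed.

Lemma gradient_linr a f g g' t : Y g -> Y g' -> D t ->
  \sum_i partial i f t * partial i (a *: g + g') t =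
  a * (\sum_i partial i f t * partial i g t) + \sum_i partial i f t * partial i g' t.
Proof.
move=> Yf Yf' Dt; rewrite mulr_sumr -big_split; apply: eq_bigr => i _ /=.
by rewrite partial_lin_Y//; ring.
Qed.

Lemma gradient0 f t : \sum_i partial i f t * partial i (0 : 'rV[R]_d -> R) t = 0.
Proof. by rewrite big1// => i _; rewrite partial0 mulr0. Qed.

Lemma vanish_gradient f g t : vanish Omega g -> D t ->
  \sum_i partial i f t * partial i g t = 0.
Proof. by move=> Ng Dt; rewrite big1// => i _; rewrite (vanish_partial i Ng Dt) mulr0. Qed.

Lemma partialZ_Y i a f t : Y f -> D t -> partial i (a *: f) t = a * partial i f t.
Proof.
move=> Yf Dt; rewrite -[a *: f]addr0 partial_lin_Y// ?partial0 ?addr0//.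
exact: (Yh_subspace Omega K).1.
Qed.

Lemma Hfun_bmeas : bmeas D (fun t => Hfun F B (phi0 t)).
Proof. exact: C0_bmeas_pieces C0_Hfun. Qed.

Lemma phase_form_bmeas x y : (Y `*` Y) x -> (Y `*` Y) y -> bmeas D (phase_form x y).
Proof.
case: x y => [phi w] [q psi] [/= Yphi Yw] [/= Yq Ypsi]; rewrite /phase_form /=.
have Bphi := Y_bmeas Yphi; have Bw := Y_bmeas Yw; have Bphi0 := Y_bmeas hphi0.
have Bq := Y_bmeas Yq; have Bpsi := Y_bmeas Ypsi; have BH := Hfun_bmeas.
have Bpphi i := Y_partial_bmeas i Yphi; have Bpw i := Y_partial_bmeas i Yw.
have Bpq i := Y_partial_bmeas i Yq; have Bppsi i := Y_partial_bmeas i Ypsi.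
bmeas_auto.
Qed.

Lemma gradient_Zr a f g t : Y g -> D t ->
  \sum_i partial i f t * partial i (a *: g) t = a * (\sum_i partial i f t * partial i g t).
Proof.
by move=> Yg Dt; rewrite mulr_sumr; apply: eq_bigr => i _; rewrite partialZ_Y//; ring.
Qed.

(** Vanishing of the weighted gradient energy of [w] is used through Cauchy-Schwarz, as the absence
    of coupling with [phi]. The functions themselves are then controlled by the two mass terms,
    tau^-1 |phi|^2 in the first equation and |w|^2 in the second. *)
Lemma phase_injective phi w : Y phi -> Y w ->
  (forall y, (Y `*` Y) y -> I (phase_form (phi, w) y) = 0) ->
  vanish Omega phi /\ vanish Omega w.
Proof.
move=> Yphi Yw h0.
have Bphi := Y_bmeas Yphi; have Bw := Y_bmeas Yw; have Bphi0 := Y_bmeas hphi0.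
have Bpphi i := Y_partial_bmeas i Yphi; have Bpw i := Y_partial_bmeas i Yw.
have [Y0 YD] := Yh_subspace Omega K.
have YZ a f : Y f -> Y (a *: f) by move=> Yf; rewrite -[_ *: _]addr0; exact: YD.
pose weight t := gamma + tau * phi0 t ^+ 2.
have Bweight : bmeas D weight by rewrite /weight; bmeas_auto.
have weight0 t : 0 <= weight t.
  by rewrite /weight addr_ge0 ?(ltW hgamma)// mulr_ge0 ?sqr_ge0 ?(ltW htau).
have Bww : bmeas D (fun t => weight t * (\sum_i partial i w t * partial i w t)) by bmeas_auto.
have ww0 : I (fun t => weight t * (\sum_i partial i w t * partial i w t)) = 0.
  apply/eqP; rewrite eq_le; apply/andP; split; last first.
    by apply: (leb_int_pieces_ge0 oO hK) => t _; rewrite mulr_ge0// sumr_ge0// => i _;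
      rewrite -expr2 sqr_ge0.
  (* The factor tau on [w] offsets tau^-1 in the first equation, so the products of [phi] and [w]
     cancel. The form then exceeds tau times the weighted gradient energy by two nonnegative
     terms. *)
  rewrite -(pmulr_rle0 _ htau) -[leRHS](h0 (tau *: w, (-1) *: phi)); last by split; exact: YZ.
  rewrite (scale_leb_int oO bO hK)//; apply: le_leb_int_pieces.
  - by bmeas_auto.
  - by apply: phase_form_bmeas; split => //=; exact: YZ.
  move=> t Dt; rewrite /phase_form /= -[(tau *: w) t]/(tau * w t) -[(-1 *: phi) t]/(-1 * phi t).
  rewrite (gradient_Zr tau w Yw Dt) (gradient_Zr (-1) phi Yphi Dt).
  have -> : gamma + tau * phi0 t ^+ 2 = weight t by [].
  set sw := \sum_i partial i w t * _; set sp := \sum_i partial i phi t * _.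
  have sp0 : 0 <= lambda * sp.
    by rewrite mulr_ge0 ?(ltW hlambda)// sumr_ge0// => i _; rewrite -expr2 sqr_ge0.
  have h1 : 0 <= lambda * 2^-1 * Hfun F B (phi0 t) ^+ 2 * phi t ^+ 2.
    by apply: mulr_ge0; [apply: mulr_ge0; [rewrite divr_ge0 ?(ltW hlambda)|exact: sqr_ge0]|exact: sqr_ge0].
  rewrite -subr_ge0.
  have -> : tau^-1 * (phi t * (tau * w t)) + weight t * (tau * sw) + w t * (-1 * phi t) -
      lambda * (-1 * sp) - lambda / 2 * Hfun F B (phi0 t) ^+ 2 * (phi t * (-1 * phi t)) -
      tau * (weight t * sw) =
      lambda * sp + lambda * 2^-1 * Hfun F B (phi0 t) ^+ 2 * phi t ^+ 2.
    by field; rewrite gt_eqF.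
  exact: addr_ge0.
have Bpp : bmeas D (fun t => weight t * (\sum_i partial i phi t * partial i phi t)) by bmeas_auto.
have Bwp : bmeas D (fun t => weight t * (\sum_i partial i w t * partial i phi t)) by bmeas_auto.
(* Cauchy-Schwarz for the weighted form: the energy of phi + s w is nonnegative for every s, and its
   s^2 coefficient is zero. *)
have wphi0 : I (fun t => weight t * (\sum_i partial i w t * partial i phi t)) = 0.
  have disc s : 0 <= I (fun t => weight t * (\sum_i partial i phi t * partial i phi t)) +
      2 * s * I (fun t => weight t * (\sum_i partial i w t * partial i phi t)) +
      s ^+ 2 * I (fun t => weight t * (\sum_i partial i w t * partial i w t)).
    rewrite !(scale_leb_int oO bO hK)// (add_leb_int oO bO hK)//; last by bmeas_auto.
    rewrite (add_leb_int oO bO hK); [|by bmeas_auto|by bmeas_auto].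
    apply: (leb_int_pieces_ge0 oO hK) => t _.
    have -> : weight t * (\sum_i partial i phi t * partial i phi t) +
        2 * s * (weight t * (\sum_i partial i w t * partial i phi t)) +
        s ^+ 2 * (weight t * (\sum_i partial i w t * partial i w t)) =
        weight t * (\sum_i (partial i phi t + s * partial i w t) ^+ 2).
      rewrite [in RHS](eq_bigr (fun i => partial i phi t * partial i phi t +
        2 * s * (partial i w t * partial i phi t) +
        s ^+ 2 * (partial i w t * partial i w t))) => [|i _]; last by ring.
      by rewrite !big_split/= -!mulr_sumr; ring.
    by rewrite mulr_ge0// sumr_ge0// => i _; exact: sqr_ge0.
  rewrite ww0 in disc; have := discriminant_le (lexx 0) disc; rewrite mulr0 => h.
  by apply/eqP; rewrite -sqrf_eq0 eq_le sqr_ge0 h.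
have Nphi : vanish Omega phi.
  apply: vanish_sqr; first by case: Yphi.
  have := h0 (phi, 0) (conj Yphi Y0).
  rewrite (_ : I _ = tau^-1 * I (fun t => phi t ^+ 2)).
    by move/eqP; rewrite mulf_eq0 invr_eq0 gt_eqF//= => /eqP.
  (* The coupling integral just shown to be zero is added, to match the form tested with (phi,
     0). *)
  rewrite -[RHS]addr0 -[X in _ + X]wphi0 (scale_leb_int oO bO hK); last by bmeas_auto.
  rewrite (add_leb_int oO bO hK)//; last by bmeas_auto.
  apply: (eq_leb_int_pieces oO hK) => t Dt; rewrite /phase_form /= gradient0.
  rewrite -[gamma + _]/(weight t).
  by rewrite -[(0 : 'rV[R]_d -> R) t]/(0 : R); ring.
split => //; apply: vanish_sqr; first by case: Yw.
rewrite -(h0 (0, w) (conj Y0 Yw)).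
apply: (eq_leb_int_pieces oO hK) => t Dt; rewrite /phase_form /= gradient0 (vanish_pieces Nphi Dt).
rewrite -[(0 : 'rV[R]_d -> R) t]/(0 : R) big1 => [|i _]; first by ring.
by rewrite (vanish_partial i Nphi Dt) mul0r.
Qed.

Lemma phase_solve U0h : Y U0h -> exists x, [/\ (Y `*` Y) x,
  forall y, (Y `*` Y) y -> I (phase_form x y) = I (phase_rhs U0h y) &
  forall x', (Y `*` Y) x' ->
    (forall y, (Y `*` Y) y -> I (phase_form x' y) = I (phase_rhs U0h y)) ->
    (@vanish R d Omega R `*` @vanish R d Omega R) (x' - x)].
Proof.
move=> YU0h.
have Bphi0 := Y_bmeas hphi0; have BU := Y_bmeas YU0h; have BH := Hfun_bmeas.
have Bu0 i : bmeas D (fun x => u0 x 0 i) by exact: X_bmeas.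
have Ys := Yh_subspace Omega K.
apply: galerkin_unique_solve => //.
- exact: prod_subspace.
- exact: prod_subspace (vanish_subspace Omega _) (vanish_subspace Omega _).
- exact: prod_finite_dim (Yh_finite_dim hK) (Yh_finite_dim hK).
- exact: phase_form_bmeas.
- move=> [q psi] [/= Yq Ypsi]; rewrite /phase_rhs /=.
  have Bq := Y_bmeas Yq; have Bpsi := Y_bmeas Ypsi.
  have Bpq i := Y_partial_bmeas i Yq.
  bmeas_auto.
- move=> a [phi w] [phi' w'] [q psi] [/= Yphi Yw] [/= Yphi' Yw'] [/= Yq Ypsi] t Dt.
  rewrite /phase_form /= (gradient_lin a q Yw Yw' Dt) (gradient_lin a psi Yphi Yphi' Dt).
  rewrite -[(a *: phi + phi') t]/(a * phi t + phi' t).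
  by rewrite -[(a *: w + w') t]/(a * w t + w' t); ring.
- move=> a [phi w] [q psi] [q' psi'] [/= Yphi Yw] [/= Yq Ypsi] [/= Yq' Ypsi'] t Dt.
  rewrite /phase_form /= (gradient_linr a w Yq Yq' Dt) (gradient_linr a phi Ypsi Ypsi' Dt).
  rewrite -[(a *: q + q') t]/(a * q t + q' t).
  by rewrite -[(a *: psi + psi') t]/(a * psi t + psi' t); ring.
- move=> a [q psi] [q' psi'] [/= Yq Ypsi] [/= Yq' Ypsi'] t Dt.
  rewrite /phase_rhs /= -[(a *: q + q') t]/(a * q t + q' t).
  rewrite -[(a *: psi + psi') t]/(a * psi t + psi' t).
  rewrite (eq_bigr (fun i => a * (u0 t 0 i * partial i q t) + u0 t 0 i * partial i q' t)) => [|i _].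
    by rewrite big_split/= -mulr_sumr; ring.
  by rewrite partial_lin_Y//; ring.
- move=> [phi w] [q psi] t _ _ [/= Nq Npsi] Dt; rewrite /phase_form /=.
  rewrite !(vanish_gradient _ _ Dt)// (vanish_pieces Nq Dt) (vanish_pieces Npsi Dt).
  by ring.
- move=> [q psi] t _ [/= Nq Npsi] Dt; rewrite /phase_rhs /=.
  rewrite (vanish_pieces Nq Dt) (vanish_pieces Npsi Dt) big1 => [|i _]; first by ring.
  by rewrite (vanish_partial i Nq Dt) mulr0.
by move=> [phi w] [/= Yphi Yw]; exact: phase_injective.
Qed.

(** * The equations of the scheme as linear systems *)

Lemma convection0 x : \sum_i u0 x 0 i * partial i (0 : 'rV[R]_d -> R) x = 0.
Proof. by rewrite big1// => i _; rewrite partial0 mulr0. Qed.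

(** The left side of the scheme equation is the residual of the coupled system on the test (q, 0).
    The intermediate velocity is known almost everywhere only, which is enough under the
    integral. *)
Lemma phase_equation_q phi w U0h uh q : Y phi -> Y w -> Y U0h -> Y q ->
  ae_on Omega (fun x => uh x = u0 x - tau *: (phi0 x *: grad w x)) ->
  inner Omega (fun x => (phi x - phi0 x) / tau) q
    - vinner Omega (fun x => phi0 x *: uh x) (grad q) + gamma * form_a Omega w q =
  I (phase_form (phi, w) (q, 0)) - I (phase_rhs U0h (q, 0)).
Proof.
move=> Yphi Yw YU Yq uhE.
have Bphi := Y_bmeas Yphi; have Bw := Y_bmeas Yw; have Bphi0 := Y_bmeas hphi0.
have Bq := Y_bmeas Yq; have BH := Hfun_bmeas; have BU := Y_bmeas YU.
have Bpw i := Y_partial_bmeas i Yw; have Bpq i := Y_partial_bmeas i Yq.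
have Bu0 i : bmeas D (fun x => u0 x 0 i) by exact: X_bmeas.
have Y0 := (Yh_subspace Omega K).1; have B0 := Y_bmeas Y0.
have -> : vinner Omega (fun x => phi0 x *: uh x) (grad q) =
    I (fun x => \sum_i phi0 x * (u0 x 0 i - tau * (phi0 x * partial i w x)) * partial i q x).
  apply: leb_int_ae; case: uhE => Z mZ ZE; exists Z => // x Ox nZx.
  by apply: eq_bigr => i _; rewrite ZE// !mxE.
have -> : form_a Omega w q = I (fun x => \sum_i partial i w x * partial i q x).
  by rewrite /form_a /vinner; congr leb_int; apply/funext => x; apply: eq_bigr => i _; rewrite !mxE.
rewrite /inner (scale_leb_int oO bO hK); last by bmeas_auto.
rewrite (sub_leb_int oO bO hK); [|by bmeas_auto|by bmeas_auto].
rewrite (add_leb_int oO bO hK); [|by bmeas_auto|by bmeas_auto].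
rewrite (sub_leb_int oO bO hK); first last.
- by rewrite /phase_rhs /=; bmeas_auto.
- exact: phase_form_bmeas.
apply: (eq_leb_int_pieces oO hK) => x Dx; rewrite /phase_form /phase_rhs /= gradient0.
rewrite -[(0 : 'rV[R]_d -> R) x]/(0 : R).
rewrite (eq_bigr (fun i => phi0 x * (u0 x 0 i * partial i q x) -
  tau * phi0 x ^+ 2 * (partial i w x * partial i q x))) => [|i _]; last by ring.
by rewrite sumrB -!mulr_sumr; ring.
Qed.

Lemma phase_equation_psi phi w U U0h psi : Y phi -> Y w -> Y U0h -> Y psi ->
  eq_C0 Omega U (fun x => U0h x + 2^-1 * Hfun F B (phi0 x) * (phi x - phi0 x)) ->
  inner Omega w psi - lambda * form_a Omega phi psi
    - lambda * inner Omega (fun x => Hfun F B (phi0 x) * U x) psi =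
  I (phase_form (phi, w) (0, psi)) - I (phase_rhs U0h (0, psi)).
Proof.
move=> Yphi Yw YU Ypsi UE.
have Bphi := Y_bmeas Yphi; have Bw := Y_bmeas Yw; have Bphi0 := Y_bmeas hphi0.
have Bpsi := Y_bmeas Ypsi; have BH := Hfun_bmeas; have BU := Y_bmeas YU.
have Bpphi i := Y_partial_bmeas i Yphi; have Bppsi i := Y_partial_bmeas i Ypsi.
have Bp0 i := Y_partial_bmeas i (Yh_subspace Omega K).1.
have B0 := Y_bmeas (Yh_subspace Omega K).1.
have Bu0 i : bmeas D (fun x => u0 x 0 i) by exact: X_bmeas.
have Y0 := (Yh_subspace Omega K).1.
have -> : inner Omega (fun x => Hfun F B (phi0 x) * U x) psi =
    I (fun x => Hfun F B (phi0 x) *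
      (U0h x + 2^-1 * Hfun F B (phi0 x) * (phi x - phi0 x)) * psi x).
  by apply: eq_leb_int => x Ox; rewrite UE//; exact: subset_closure.
have -> : form_a Omega phi psi = I (fun x => \sum_i partial i phi x * partial i psi x).
  by rewrite /form_a /vinner; congr leb_int; apply/funext => x; apply: eq_bigr => i _; rewrite !mxE.
rewrite /inner !(scale_leb_int oO bO hK); [|by bmeas_auto|by bmeas_auto].
rewrite (sub_leb_int oO bO hK); [|by bmeas_auto|by bmeas_auto].
rewrite (sub_leb_int oO bO hK); [|by bmeas_auto|by bmeas_auto].
rewrite (sub_leb_int oO bO hK); first last.
- by rewrite /phase_rhs /=; bmeas_auto.
- exact: phase_form_bmeas.
apply: (eq_leb_int_pieces oO hK) => x Dx; rewrite /phase_form /phase_rhs /= gradient0.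
by rewrite convection0 -[(0 : 'rV[R]_d -> R) x]/(0 : R); ring.
Qed.

(** Two scalar families of equations amount to one family on pairs because (q, psi) is the sum of
    (q, 0) and (0, psi). Both directions serve: one to solve the scheme, the other to transfer
    uniqueness to it. *)
Lemma phase_equations phi w U U0h uh : Y phi -> Y w -> Y U0h ->
  ae_on Omega (fun x => uh x = u0 x - tau *: (phi0 x *: grad w x)) ->
  eq_C0 Omega U (fun x => U0h x + 2^-1 * Hfun F B (phi0 x) * (phi x - phi0 x)) ->
  ((forall q, Y q ->
      inner Omega (fun x => (phi x - phi0 x) / tau) q
        - vinner Omega (fun x => phi0 x *: uh x) (grad q) + gamma * form_a Omega w q = 0) /\
   (forall psi, Y psi ->
      inner Omega w psi - lambda * form_a Omega phi psi
        - lambda * inner Omega (fun x => Hfun F B (phi0 x) * U x) psi = 0)) <->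
  (forall y, (Y `*` Y) y -> I (phase_form (phi, w) y) = I (phase_rhs U0h y)).
Proof.
move=> Yphi Yw YU uhE UE; have Y0 := (Yh_subspace Omega K).1; split; last first.
  move=> eqs; split => q Yq.
    by rewrite (phase_equation_q Yphi Yw YU Yq uhE) eqs ?subrr.
  by rewrite (phase_equation_psi Yphi Yw YU Yq UE) eqs ?subrr.
move=> [eqq eqpsi] [q psi] [/= Yq Ypsi].
have Bphi0 := Y_bmeas hphi0; have BH := Hfun_bmeas; have BU := Y_bmeas YU.
have Bu0 i : bmeas D (fun x => u0 x 0 i) by exact: X_bmeas.
have Bq := Y_bmeas Yq; have Bpsi := Y_bmeas Ypsi; have B0 := Y_bmeas Y0.
have Bpq i := Y_partial_bmeas i Yq; have Bp0 i := Y_partial_bmeas i Y0.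
have Eq := phase_equation_q Yphi Yw YU Yq uhE.
have Epsi := phase_equation_psi Yphi Yw YU Ypsi UE.
rewrite eqq// in Eq; rewrite eqpsi// in Epsi.
have -> : I (phase_form (phi, w) (q, psi)) =
    I (phase_form (phi, w) (q, 0)) + I (phase_form (phi, w) (0, psi)).
  rewrite (add_leb_int oO bO hK); [|exact: phase_form_bmeas|exact: phase_form_bmeas].
  apply: (eq_leb_int_pieces oO hK) => x Dx; rewrite /phase_form /= !gradient0.
  by rewrite -[(0 : 'rV[R]_d -> R) x]/(0 : R); ring.
have -> : I (phase_rhs U0h (q, psi)) =
    I (phase_rhs U0h (q, 0)) + I (phase_rhs U0h (0, psi)).
  rewrite (add_leb_int oO bO hK); [|by rewrite /phase_rhs /=; bmeas_auto..].
  apply: (eq_leb_int_pieces oO hK) => x Dx; rewrite /phase_rhs /=.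
  by rewrite convection0 -[(0 : 'rV[R]_d -> R) x]/(0 : R); ring.
move/esym/eqP: Eq; rewrite subr_eq0 => /eqP ->.
by move/esym/eqP: Epsi; rewrite subr_eq0 => /eqP ->.
Qed.

Lemma velocity_equation ut w v : X ut -> Y w -> X v ->
  vinner Omega (fun x => tau^-1 *: (ut x - u0 x)) v
    + mu * form_at Omega ut v + form_b Omega u0 ut v
    - inner Omega p0 (dvg v) + vinner Omega (fun x => phi0 x *: grad w x) v =
  I (velocity_form ut v) - I (velocity_rhs w v).
Proof.
move=> Xut Yw Xv.
have Bp0 : bmeas D p0 by exact: M_bmeas.
have Bphi0 : bmeas D phi0 by exact: Y_bmeas.
have BX z : X z -> forall i, bmeas D (fun x => z x 0 i) by move=> ? i; exact: X_bmeas.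
have Bu0 := BX u0 hu0; have Bdu0 := X_dvg_bmeas hu0.
have Bpw i : bmeas D (partial i w) by exact: Y_partial_bmeas.
have BpX z : X z -> forall i j, bmeas D (partial j (coor z i)).
  by move=> ? i j; exact: X_partial_bmeas.
have But := BX ut Xut; have Bv := BX v Xv; have Bput := BpX ut Xut; have Bpv := BpX v Xv.
have Bdv := X_dvg_bmeas Xv.
have -> : vinner Omega (fun x => tau^-1 *: (ut x - u0 x)) v =
    I (fun x => \sum_i tau^-1 * (ut x 0 i - u0 x 0 i) * v x 0 i).
  by congr leb_int; apply/funext => x; apply: eq_bigr => i _; rewrite !mxE.
have -> : form_at Omega ut v = I (fun x => \sum_i \sum_j
    partial j (coor ut i) x * partial j (coor v i) x) by [].
have -> : vinner Omega (fun x => phi0 x *: grad w x) v =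
    I (fun x => \sum_i phi0 x * partial i w x * v x 0 i).
  by congr leb_int; apply/funext => x; apply: eq_bigr => i _; rewrite !mxE.
rewrite /form_b.
have -> : vinner Omega (Defs.conv u0 ut) v =
    I (fun x => \sum_i (\sum_j u0 x 0 j * partial j (coor ut i) x) * v x 0 i).
  by congr leb_int; apply/funext => x; apply: eq_bigr => i _; rewrite !mxE.
have -> : vinner Omega (fun x => dvg u0 x *: ut x) v =
    I (fun x => \sum_i dvg u0 x * ut x 0 i * v x 0 i).
  by congr leb_int; apply/funext => x; apply: eq_bigr => i _; rewrite !mxE.
rewrite /inner !(scale_leb_int oO bO hK); [|by bmeas_auto|by bmeas_auto].
do 3 (rewrite (add_leb_int oO bO hK); [|by bmeas_auto|by bmeas_auto]).
rewrite (sub_leb_int oO bO hK); [|by bmeas_auto|by bmeas_auto].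
rewrite (add_leb_int oO bO hK); [|by bmeas_auto|by bmeas_auto].
rewrite (sub_leb_int oO bO hK); first last.
- by rewrite /velocity_rhs; bmeas_auto.
- by rewrite /velocity_form; bmeas_auto.
apply: (eq_leb_int_pieces oO hK) => x Dx; rewrite /velocity_form /velocity_rhs.
rewrite [in RHS]opprD [in RHS]addrA -[in RHS]sumrB.
rewrite [in RHS](eq_bigr (fun i => tau^-1 * (ut x 0 i - u0 x 0 i) * v x 0 i +
  mu * (\sum_j partial j (coor ut i) x * partial j (coor v i) x) +
  (\sum_j u0 x 0 j * partial j (coor ut i) x) * v x 0 i +
  2^-1 * (dvg u0 x * ut x 0 i * v x 0 i) +
  phi0 x * partial i w x * v x 0 i)) => [|i _]; last by ring.
by rewrite !big_split/= -!mulr_sumr; ring.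
Qed.

Lemma pressure_equation_chi ut u p chi : X ut -> X u -> M p -> X chi ->
  vinner Omega (fun x => tau^-1 *: (u x - ut x)) chi
    - inner Omega (fun x => p x - p0 x) (dvg chi) =
  I (pressure_form (u, p) (chi, 0)) - I (pressure_rhs ut (chi, 0)).
Proof.
move=> Xut Xu Mp Xchi.
have Bp0 := M_bmeas hp0; have Bp := M_bmeas Mp; have Bdchi := X_dvg_bmeas Xchi.
have BX z : X z -> forall i, bmeas D (fun x => z x 0 i) by move=> ? i; exact: X_bmeas.
have But := BX ut Xut; have Bu := BX u Xu; have Bchi := BX chi Xchi.
have Bdu := X_dvg_bmeas Xu.
have -> : vinner Omega (fun x => tau^-1 *: (u x - ut x)) chi =
    I (fun x => \sum_i tau^-1 * (u x 0 i - ut x 0 i) * chi x 0 i).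
  by congr leb_int; apply/funext => x; apply: eq_bigr => i _; rewrite !mxE.
rewrite /inner (sub_leb_int oO bO hK); [|by bmeas_auto|by bmeas_auto].
have B0 : bmeas D (0 : 'rV[R]_d -> R) by exact: bmeas_cst.
rewrite (sub_leb_int oO bO hK); [|by rewrite /pressure_form /=; bmeas_auto|
  by rewrite /pressure_rhs /=; bmeas_auto].
apply: (eq_leb_int_pieces oO hK) => x Dx; rewrite /pressure_form /pressure_rhs /=.
rewrite -[(0 : 'rV[R]_d -> R) x]/(0 : R).
rewrite (eq_bigr (fun i => tau^-1 * (u x 0 i * chi x 0 i) - tau^-1 * (ut x 0 i * chi x 0 i))).
  by rewrite sumrB; ring.
by move=> i _; ring.
Qed.

Lemma pressure_equation_q ut u p q : M q ->
  inner Omega (dvg u) q = I (pressure_form (u, p) (0, q)) - I (pressure_rhs ut (0, q)).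
Proof.
move=> Mq.
have V0 : @vanish R d Omega 'rV[R]_d 0 by [].
have -> : I (pressure_rhs ut (0, q)) = 0.
  apply: (leb_int_pieces_eq0 oO hK) => x Dx; rewrite /pressure_rhs /= (vanish_dvg V0 Dx) mulr0 subr0.
  by rewrite big1// => i _; rewrite -[(0 : 'rV[R]_d -> 'rV[R]_d) x]/(0 : 'rV[R]_d) mxE !mulr0.
rewrite subr0; apply: (eq_leb_int_pieces oO hK) => x Dx.
rewrite /pressure_form /= (vanish_dvg V0 Dx) mulr0 subr0.
rewrite big1 ?add0r// => i _.
by rewrite -[(0 : 'rV[R]_d -> 'rV[R]_d) x]/(0 : 'rV[R]_d) mxE !mulr0.
Qed.

(** The same splitting of a test pair, now into (chi, 0) and (0, q). *)
Lemma pressure_equations ut u p : X ut -> X u -> M p ->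
  ((forall chi, X chi ->
      vinner Omega (fun x => tau^-1 *: (u x - ut x)) chi
        - inner Omega (fun x => p x - p0 x) (dvg chi) = 0) /\
   (forall q, M q -> inner Omega (dvg u) q = 0)) <->
  (forall y, (X `*` M) y -> I (pressure_form (u, p) y) = I (pressure_rhs ut y)).
Proof.
move=> Xut Xu Mp.
have X0 : X 0 by exact: (@Xh_subspace R d N Omega K oO bO).1.
have M0 : M 0 by exact: (@Mh_subspace R d N Omega K oO bO).1.
split; last first.
  move=> eqs; split => [chi Xchi|q Mq].
    by rewrite (pressure_equation_chi Xut Xu Mp Xchi) eqs ?subrr.
  by rewrite (pressure_equation_q ut u p Mq) eqs ?subrr.
move=> [eqchi eqq] [chi q] [/= Xchi Mq].
have Bp0 := M_bmeas hp0; have Bp := M_bmeas Mp; have Bdchi := X_dvg_bmeas Xchi.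
have BX z : X z -> forall i, bmeas D (fun x => z x 0 i) by move=> ? i; exact: X_bmeas.
have But := BX ut Xut; have Bu := BX u Xu; have Bchi := BX chi Xchi; have BX0 := BX 0 X0.
have Bdu := X_dvg_bmeas Xu; have Bd0 := X_dvg_bmeas X0; have B0 := M_bmeas M0.
have Bq := M_bmeas Mq.
have Echi := pressure_equation_chi Xut Xu Mp Xchi; rewrite eqchi// in Echi.
have Eq := pressure_equation_q ut u p Mq; rewrite eqq// in Eq.
have V0 : @vanish R d Omega 'rV[R]_d 0 by [].
have -> : I (pressure_form (u, p) (chi, q)) =
    I (pressure_form (u, p) (chi, 0)) + I (pressure_form (u, p) (0, q)).
  rewrite (add_leb_int oO bO hK); [|by rewrite /pressure_form /=; bmeas_auto..].
  apply: (eq_leb_int_pieces oO hK) => x Dx; rewrite /pressure_form /= (vanish_dvg V0 Dx).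
  rewrite [X in _ = _ + (X - _ + _)]big1 => [|i _].
    by rewrite -[(0 : 'rV[R]_d -> R) x]/(0 : R); ring.
  by rewrite -[(0 : 'rV[R]_d -> 'rV[R]_d) x]/(0 : 'rV[R]_d) mxE !mulr0.
have -> : I (pressure_rhs ut (chi, q)) =
    I (pressure_rhs ut (chi, 0)) + I (pressure_rhs ut (0, q)).
  rewrite (add_leb_int oO bO hK); [|by rewrite /pressure_rhs /=; bmeas_auto..].
  apply: (eq_leb_int_pieces oO hK) => x Dx; rewrite /pressure_rhs /= (vanish_dvg V0 Dx).
  rewrite [X in _ = _ + (X - _)]big1 => [|i _]; first by ring.
  by rewrite -[(0 : 'rV[R]_d -> 'rV[R]_d) x]/(0 : 'rV[R]_d) mxE !mulr0.
move/esym/eqP: Echi; rewrite subr_eq0 => /eqP ->.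
by move/esym/eqP: Eq; rewrite subr_eq0 => /eqP ->.
Qed.

End scheme_forms.

(** * Extension by zero and assembly of the solution *)

Lemma L2_patch (R : realType) (n : nat) (Omega A : set 'rV[R]_n) (g : 'rV[R]_n -> R) :
  open Omega -> bounded_set Omega -> measurable (@pt R n @^-1` A) -> A `<=` Omega ->
  bmeas A g -> L2 Omega (fun x => if `[< A x >] then g x else 0).
Proof.
move=> oO bO mA AO [mg [M gM]]; have mO := measurable_Phi_Omega oO.
apply: bmeas_L2 => //; first exact: leb_Omega_lty; split; last first.
  (* The absolute value is taken because [M] may be negative when [A] is empty, while the extension
     takes the value 0. *)
  exists `|M| => x _; case: asboolP => [Ax|_]; last by rewrite normr0.
  by apply: le_trans (gM x Ax) _; exact: ler_norm.
rewrite (_ : _ \o _ = ((g \o @pt R n) \_ (@pt R n @^-1` A))).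
  by apply/measurable_restrict => //; apply: measurable_funS mg => //.
by apply/funext => t; rewrite patchE /=; congr (if _ then _ else _).
Qed.

Lemma vanish_eq_C0 (R : realType) (d : nat) (Omega : set 'rV[R]_d) (T : zmodType)
  (f g : 'rV[R]_d -> T) : vanish Omega (f - g) -> eq_C0 Omega f g.
Proof.
by move=> fg x Ox; apply/eqP; rewrite -subr_eq0; apply/eqP; exact: fg.
Qed.

Theorem theorem3p7 (R : realType) (d : nat) (hd : d = 2%N \/ d = 3%N)
    (Omega : set 'rV[R]_d) (hOmega : bounded_domain Omega)
    (N : nat) (K : 'I_N -> set 'rV[R]_d) (hK : fe_partition Omega K)
    (sigma C : R) (hsigma : shape_regular sigma K) (hC : quasi_uniform C K)
    (hinfsup : inf_sup Omega K)
    (gamma lambda mu tau : R) (hgamma : 0 < gamma) (hlambda : 0 < lambda)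
    (hmu : 0 < mu) (htau : 0 < tau)
    (F : R -> R) (hF : potential F) (B : R) (hB : forall s, 0 < F s + B)
    (phi0 : 'rV[R]_d -> R) (u0 : 'rV[R]_d -> 'rV[R]_d) (p0 U0 : 'rV[R]_d -> R)
    (hphi0 : Yh Omega K phi0) (hu0 : Vh Omega K u0) (hp0 : Mh Omega K p0)
    (hU0 : C0 Omega U0) :
  exists (phi w : 'rV[R]_d -> R) (u : 'rV[R]_d -> 'rV[R]_d)
      (p U : 'rV[R]_d -> R),
    scheme_solution Omega K gamma lambda mu tau F B phi0 u0 p0 U0 phi w u p U /\
    forall phi' w' u' p' U',
      scheme_solution Omega K gamma lambda mu tau F B phi0 u0 p0 U0
        phi' w' u' p' U' ->
      [/\ eq_C0 Omega phi' phi, eq_C0 Omega w' w, eq_C0 Omega u' u,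
          eq_C0 Omega p' p & eq_C0 Omega U' U].
Proof.
have [oO _ _ bO] := hOmega.
have [U0h [YU0h projU uniqU]] := projection_solve oO bO hK hU0.
have [[phi w] [[/= Yphi Yw] phase uniq_phase]] :=
  phase_solve oO bO hK hgamma hlambda htau hF hB hphi0 hu0 YU0h.
have [ut [Xut velocity uniq_velocity]] :=
  velocity_solve oO bO hK hmu htau hphi0 hu0 hp0 Yw.
have [[u p] [[/= Xu Mp] pressure uniq_pressure]] :=
  pressure_solve oO bO hK htau hp0 hinfsup Xut.
pose U x := U0h x + 2^-1 * Hfun F B (phi0 x) * (phi x - phi0 x).
have CH := C0_Hfun hF hB hphi0.
have CU : C0 Omega U.
  have [CU0h _] := YU0h; have [Cphi _] := Yphi; have [Cphi0 _] := hphi0.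
  move=> x; exact: (cvgD (CU0h x) (cvgM (cvgM (cvg_cst _) (CH x)) (cvgB (Cphi x) (Cphi0 x)))).
exists phi, w, u, p, U; split.
  have mD := measurable_Phi_pieces K oO.
  (* Outside the element interiors the formula involves an uncontrolled pointwise gradient; the
     value zero there keeps the field in L^2 and alters it on a null set only. *)
  pose uh x := if `[< pieces Omega K x >] then u0 x - tau *: (phi0 x *: grad w x) else 0.
  have uhE : ae_on Omega (fun x => uh x = u0 x - tau *: (phi0 x *: grad w x)).
    have [mZ Z0] := pieces_null oO hK; exists (Omega `\` pieces Omega K) => // x Ox nZx.
    rewrite /uh; case: asboolP => // nDx.
    by exfalso; apply: nZx.
  have UE : eq_C0 Omega U (fun x => U0h x + 2^-1 * Hfun F B (phi0 x) * (phi x - phi0 x)) by [].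
  have [eq_phi eq_w] := (phase_equations oO bO hK gamma lambda hF hB hphi0 hu0 Yphi Yw YU0h
    uhE UE).2 phase.
  have [eq_u eq_p] := (pressure_equations oO bO hK tau hp0 Xut Xu Mp).2 pressure.
  exists U0h, ut, uh; split => //; split => //.
    move=> i; rewrite (_ : coor uh i = fun x => if `[< pieces Omega K x >] then
      u0 x 0 i - tau * (phi0 x * partial i w x) else 0); last first.
      by apply/funext => x; rewrite /coor /uh; case: asboolP => _; rewrite !mxE.
    apply: L2_patch => //; first exact: pieces_sub.
    have Bu0 := X_bmeas oO bO i hu0; have Bphi0 := Y_bmeas oO bO hphi0.
    have Bpw := Y_partial_bmeas oO bO hK i Yw.
    by bmeas_auto.
  by move=> v Xv; rewrite (velocity_equation oO bO hK mu tau hphi0 hu0 hp0 Xut Yw Xv) velocity// subrr.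
move=> phi' w' u' p' U'.
move=> [U0h' [ut' [uh' [spaces [CU' _ YU0h' projU'] [eq_phi' eq_w' uhE' UE'] [eq_v' eq_u' eq_p']]]]].
have [Yphi' Yw' Xut' Xu' Mp'] := spaces.
(* A second solution comes with its own projection, which agrees with the first on the closure of
   Omega; the phase system it satisfies therefore has the same right-hand side. *)
have U0hE : eq_C0 Omega U0h' U0h by apply: vanish_eq_C0; exact: uniqU.
have phase' := (phase_equations oO bO hK gamma lambda hF hB hphi0 hu0 Yphi' Yw' YU0h' uhE' UE').1
  (conj eq_phi' eq_w').
have [phiE wE] : eq_C0 Omega phi' phi /\ eq_C0 Omega w' w.
  have [|y Yy|/= phiE wE] := uniq_phase (phi', w').
  - by split.
  - rewrite phase'//; apply: eq_leb_int => x Ox; rewrite /phase_rhs U0hE//.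
    exact: subset_closure.
  - by split; exact: vanish_eq_C0.
have OD := @pieces_sub R d N Omega K.
have utE : eq_C0 Omega ut' ut.
  apply: vanish_eq_C0; apply: uniq_velocity => // v Xv; apply/eqP; rewrite -subr_eq0.
  have -> : leb_int Omega (velocity_rhs tau phi0 u0 p0 w v) =
      leb_int Omega (velocity_rhs tau phi0 u0 p0 w' v).
    apply: (eq_leb_int_pieces oO hK) => x Dx; rewrite /velocity_rhs; congr (_ + _).
    (* The two potentials agree on the open set Omega, hence near each of its points, so their
       pointwise derivatives agree there as well. *)
    apply: eq_bigr => i _; congr (_ - _ * _ * _); apply: near_eq_derive.
    have : nbhs x Omega by apply: open_nbhs_nbhs; split => //; exact: OD.
    by apply: filterS => y Oy; rewrite wE//; exact: subset_closure.
  by rewrite -(velocity_equation oO bO hK mu tau hphi0 hu0 hp0 Xut' Yw' Xv) eq_v'.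
have pressure' := (pressure_equations oO bO hK tau hp0 Xut' Xu' Mp').1 (conj eq_u' eq_p').
have [uE pE] : eq_C0 Omega u' u /\ eq_C0 Omega p' p.
  have [|y Yy|/= uE pE] := uniq_pressure (u', p').
  - by split.
  - rewrite pressure'//; apply: eq_leb_int => x Ox; rewrite /pressure_rhs utE//.
    exact: subset_closure.
  - by split; exact: vanish_eq_C0.
split => // x clx.
by rewrite UE'// U0hE// phiE.
Qed.
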